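(* Let $n\ge 2$. The map $\psi:R\otimes L_n\to R\otimes L_n$ coincides with the ($R$-linearly extended) quantization map $\widehat Q$. In particular, for every $w\in S_n$, $$\mathfrak G_w^q(X)(1)=\mathfrak G_w .$$
   Context: Permutations are composed as functions, $t_{ij}$ is the transposition of $i,j$, $\ell$ is length. Grothendieck polynomials: $\partial_i=\frac{1-s_i}{x_i-x_{i+1}}$ ($s_i$ exchanging $x_i,x_{i+1}$), $\pi_i=1+(1-x_i)\partial_i$, $\pi_u=\pi_{i_1}\cdots\pi_{i_l}$ for a reduced decomposition $u=s_{i_1}\cdots s_{i_l}$ (well defined). For $w\in S_n$ with longest element $w_\circ$: $\mathfrak G_{w_\circ}=\prod_{i=1}^{n-1}x_i^{n-i}$, $\mathfrak G_w=\pi_{w^{-1}w_\circ}\mathfrak G_{w_\circ}$. Quantization map: let $e_p^k=e_p(x_1,\ldots,x_k)$. For $0\le p\le k$ let $F_0^k=1$ and, for $p\ge1$, $$F_p^k=\sum_{I\subseteq\{1,\ldots,k\},\,|I|=p}\ \prod_{i\in I}(1-x_i)\prod_{i\in I,\ i+1\notin I}(1-q_i),\qquad \widehat E_p^k=\sum_{i=0}^p(-1)^i\binom{k-i}{p-i}F_i^k .$$ Let $L_n$ be the $\mathbb Z$-span of the monomials $x_1^{i_1}\cdots x_{n-1}^{i_{n-1}}$ with $0\le i_j\le n-j$, and $L_n^q=\mathbb Z[q_1,\ldots,q_{n-1}]\otimes L_n$. Both the products $e_{p_1}^1\cdots e_{p_{n-1}}^{n-1}$ ($0\le p_i\le i$)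 and the $\mathfrak G_w$ ($w\in S_n$) form $\mathbb Z$-bases of $L_n$. $\widehat Q:L_n^q\to L_n^q$ is the $\mathbb Z[q_1,\ldots,q_{n-1}]$-linear map with $\widehat Q(e_{p_1}^1\cdots e_{p_{n-1}}^{n-1})=\widehat E_{p_1}^1\cdots\widehat E_{p_{n-1}}^{n-1}$, and $\mathfrak G_w^q:=\widehat Q(\mathfrak G_w)$ for $w\in S_n$. Operators $X_k$: let $R=\mathbb Z[(1-q_1)^{\pm1},\ldots,(1-q_{n-1})^{\pm1}]$ and $q_{ij}=q_iq_{i+1}\cdots q_{j-1}$. The quantum Fomin–Kirillov algebra $\mathcal E_n^q$ is the associative $R$-algebra with generators $[i,j]$ ($1\le i\ne j\le n$) and relations $[i,j]=-[j,i]$; for $i<j$, $[i,j]^2=q_i$ if $j=i+1$ and $0$ if $j>i+1$; $[i,j][k,l]=[k,l][i,j]$ if $\{i,j\}\cap\{k,l\}=\emptyset$; $[i,j][j,k]+[j,k][k,i]+[k,i][i,j]=0$. It acts $R$-linearly on $R\otimes L_n$ by identifying $\mathfrak G_w$ with $w\in S_n$ and letting $[i,j]$ ($i<j$) send $w$ to $wt_{ij}$ if $\ell(wt_{ij})=\ell(w)+1$, to $q_{ij}wt_{ij}$ if $\ell(wt_{ij})=\ell(w)-2(j-i)+1$, and to $0$ otherwise; a product $u_1u_2\cdots u_m$ of elements acts by applying $u_1$ first, then $u_2$, and so on. Let $h_{ij}=1+[i,j]$ (invertible), and for $1\le k\le n$ $$X_k=1-h_{k-1,k}h_{k-2,k}\cdots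 h_{1k}\,h_{kn}^{-1}h_{k,n-1}^{-1}\cdots h_{k,k+1}^{-1}.$$ The $X_k$ commute. For a polynomial $F$ in the $x_i$ with coefficients in $R$, $F(X)$ denotes the operator on $R\otimes L_n$ obtained by substituting $x_i\mapsto X_i$, and $F(X)(1)$ its value at $1=\mathfrak G_{\mathrm{id}}$. Definition of $\psi$: for every $f\in R\otimes L_n$ there is a unique $F\in R\otimes L_n$ with $F(X)(1)=f$; $\psi$ is the $R$-linear map $f\mapsto F$. *)

(* Defs.v *)
From Stdlib Require Import ClassicalEpsilon.
From HB Require Import structures.
From mathcomp Require Import all_boot all_order all_fingroup all_algebra.
From mathcomp Require Import fraction.
From mathcomp Require Import mpoly.

Set Implicit Arguments.
Unset Strict Implicit.
Unset Printing Implicit Defensive.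

Import GRing.Theory.
Local Open Scope ring_scope.

(* Indices are shifted by one: the paper's x_1, ..., x_n and q_1, ..., q_(n-1) *)
(* are 'X_0, ..., 'X_(n-1) and q 0, ..., q (n-2) here, and permutations act on *)
(* 'I_n = {0, ..., n-1}.                                                       *)

(* The ring R = Z[(1 - q_i)^{+-1}], inside Frac(Z[q_1, ..., q_m]), m = n - 1.  *)

Section LaurentRing.
Variable m : nat.

Local Notation K := {fraction {mpoly int[m]}}.
Local Notation y i := (FracField.tofrac (1 - 'X_i : {mpoly int[m]}) : K).

Inductive in_laurent : K -> Prop :=
| in_laurent1 : in_laurent 1
| in_laurent_gen i : in_laurent (y i)
| in_laurent_inv i : in_laurent (y i)^-1
| in_laurentB u v : in_laurent u -> in_laurent v -> in_laurent (u - v)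
| in_laurentM u v : in_laurent u -> in_laurent v -> in_laurent (u * v).

Definition laurent_pred : {pred K} :=
  fun u => if excluded_middle_informative (in_laurent u) then true else false.

Lemma laurent_predP u : reflect (in_laurent u) (u \in laurent_pred).
Proof.
rewrite unfold_in /laurent_pred.
by case: excluded_middle_informative => h; constructor.
Qed.

Fact laurent_subring : subring_closed laurent_pred.
Proof.
split=> [|u v /laurent_predP hu /laurent_predP hv|u v /laurent_predP hu /laurent_predP hv];
  apply/laurent_predP.
- exact: in_laurent1.
- exact: in_laurentB.
- exact: in_laurentM.
Qed.

HB.instance Definition _ :=
  GRing.isSubringClosed.Build K laurent_pred laurent_subring.

Record laurent := Laurent {laurent_val :> K; _ : laurent_val \in laurent_pred}.

HB.instance Definition _ := [isSub for laurent_val].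
HB.instance Definition _ := [Choice of laurent by <:].
HB.instance Definition _ := [SubChoice_isSubComNzRing of laurent by <:].

Definition laurent_unit : {pred laurent} :=
  fun u => (val u != 0) && ((val u)^-1 \in laurent_pred).

Definition laurent_invr (u : laurent) : laurent :=
  if u \in laurent_unit then insubd u (val u)^-1 else u.

Fact laurent_mulVr : {in laurent_unit, left_inverse 1 laurent_invr *%R}.
Proof.
move=> u uU; rewrite /laurent_invr uU; have /andP[u0 uV] := uU.
by apply: val_inj; rewrite rmorphM rmorph1 /= [laurent_val _](insubdK _ uV) mulVf.
Qed.

Fact laurent_unitPl (u v : laurent) : v * u = 1 -> laurent_unit u.
Proof.
move=> /(congr1 laurent_val) vu1.
have {}vu1 : val v * val u = 1 by exact: vu1.
have u0 : val u != 0.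
  by apply: contra_eq_neq vu1 => ->; rewrite mulr0 eq_sym oner_neq0.
rewrite /laurent_unit u0 /=.
suff <- : val v = (val u)^-1 by exact: valP.
by rewrite -[LHS](mulfK u0) vu1 mul1r.
Qed.

Fact laurent_invr_out : {in [predC laurent_unit], laurent_invr =1 id}.
Proof. by move=> u uN; rewrite /laurent_invr ifN. Qed.

HB.instance Definition _ := GRing.ComNzRing_hasMulInverse.Build laurent
  laurent_mulVr laurent_unitPl laurent_invr_out.

Fact qlaurent_subproof (i : 'I_m) :
  FracField.tofrac ('X_i : {mpoly int[m]}) \in laurent_pred.
Proof.
have -> : FracField.tofrac ('X_i : {mpoly int[m]}) = 1 - y i.
  by rewrite rmorphB rmorph1 subKr.
by apply/laurent_predP/in_laurentB; [exact: in_laurent1|exact: in_laurent_gen].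
Qed.

Definition qlaurent (i : nat) : laurent :=
  if insub i is Some j then Laurent (qlaurent_subproof j) else 0.

End LaurentRing.

Section Permutations.
Variable n : nat.
Implicit Types u v w : 'S_n.

(* MathComp's s * t applies s first; pcomp u v is u o v. *)
Definition pcomp u v : 'S_n := (v * u)%g.

Definition plen w : nat :=
  #|[set ij : 'I_n * 'I_n | (ij.1 < ij.2)%N && (w ij.2 < w ij.1)%N]|.

Definition longest : 'S_n := perm (@rev_ord_inj n).

(* ordS is the cyclic successor: only i with i.+1 < n are simple reflections. *)
Definition simple_refl (i : 'I_n) : 'S_n := tperm i (ordS i).

Definition is_reduced_word u (a : seq 'I_n) : bool :=
  [&& all (fun i : 'I_n => (i.+1 < n)%N) a,
      foldr (fun i => pcomp (simple_refl i)) 1%g a == u & size a == plen u].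

(* Every permutation has a reduced word, so the default [::] is never used. *)
Definition reduced_word u : seq 'I_n :=
  if [pick a : (plen u).-tuple 'I_n | is_reduced_word u a] is Some a
  then a else [::].

End Permutations.

Section Grothendieck.
Variable n : nat.
Implicit Types (i : 'I_n) (f : {mpoly int[n]}) (w : 'S_n).

Fact divdiff_subproof i f :
  exists g, ('X_i - 'X_(ordS i)) * g == f - msym (simple_refl i) f.
Proof.
pose d : {mpoly int[n]} := 'X_i - 'X_(ordS i).
pose P f := exists g, d * g == f - msym (simple_refl i) f.
have PD f1 f2 : P f1 -> P f2 -> P (f1 + f2).
  move=> [g1 /eqP e1] [g2 /eqP e2]; exists (g1 + g2).
  by rewrite mulrDr e1 e2 rmorphD /= opprD addrACA.
have PM f1 f2 : P f1 -> P f2 -> P (f1 * f2).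
  move=> [g1 /eqP e1] [g2 /eqP e2].
  exists (g1 * f2 + msym (simple_refl i) f1 * g2).
  by rewrite mulrDr mulrA e1 mulrCA e2 mulrBl mulrBr -rmorphM /= subrKA.
have PC c : P c%:MP.
  exists 0; rewrite mulr0 -[c%:MP]mulr1 mul_mpolyC.
  by rewrite linearZ /= rmorph1 subrr.
have PX j : P 'X_j.
  have msX : msym (simple_refl i) 'X_j = 'X_(simple_refl i j) :> {mpoly int[n]}.
    rewrite msymX; congr 'X_[_]; apply/mnmP => k.
    by rewrite mnmE !mnm1E -(inj_eq (@perm_inj _ (simple_refl i))) permKV.
  rewrite /P msX; case: tpermP => [->|->|_ _].
  - by exists 1; rewrite mulr1.
  - by exists (-1); rewrite mulrN1 opprB.
  - by exists 0; rewrite mulr0 subrr.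
have PXn a : P 'X_[a].
  rewrite mpolyXE_id; apply: (big_ind P) => [|g h|j _]; [exact: PC|exact: PM|].
  by elim: (a j) => [|k IH]; [exact: PC|rewrite exprS; apply: PM].
rewrite -/(P f) [f]mpolyE; apply: (big_ind P) => [|g h|a _].
- exact: (PC 0).
- exact: PD.
- by rewrite -mul_mpolyC; apply: PM.
Qed.

Definition divdiff i f : {mpoly int[n]} := xchoose (divdiff_subproof i f).

Definition isobaric i f : {mpoly int[n]} := f + (1 - 'X_i) * divdiff i f.

Definition isobaric_perm (u : 'S_n) f : {mpoly int[n]} :=
  foldr isobaric f (reduced_word u).

Definition groth w : {mpoly int[n]} :=
  isobaric_perm (pcomp w^-1 (longest n))
    (\prod_(i < n) 'X_i ^+ (n - i.+1)).

End Grothendieck.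

(* Everything below is over any R with elements q i such that the 1 - q i are *)
(* units; it is used for R = laurent n.-1 and q = qlaurent n.-1.              *)

Section Quantization.
Variables (R : comUnitRingType) (n : nat) (q : nat -> R).
Implicit Types (f F : {mpoly R[n]}) (p k : nat).

(* R (x) L_n; in particular 'X_(n-1), the paper's x_n, does not occur. *)
Definition tensL : {pred {mpoly R[n]}} :=
  fun f => all (fun a : 'X_{1..n} => [forall j, a j <= n - j.+1]%N) (msupp f).

Definition grothR (w : 'S_n) : {mpoly R[n]} := map_mpoly intr (groth w).

Definition epk p k : {mpoly R[n]} :=
  \sum_(I : {set 'I_n} | (#|I| == p) && [forall i in I, (i < k)%N])
     \prod_(i in I) 'X_i.

Definition Fpk p k : {mpoly R[n]} :=
  \sum_(I : {set 'I_n} | (#|I| == p) && [forall i in I, (i < k)%N])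
     (\prod_(i in I) (1 - 'X_i)) *
     (\prod_(i in I | [forall j in I, j != i.+1 :> nat]) (1 - q i)%:MP).

Definition Epk p k : {mpoly R[n]} :=
  \sum_(i < p.+1) (-1) ^+ i *+ 'C(k - i, p - i) * Fpk i k.

(* The exponent tuples (p_1, ..., p_(n-1)), 0 <= p_i <= i. *)
Definition eindex : {set {ffun 'I_n.-1 -> 'I_n}} :=
  [set p : {ffun 'I_n.-1 -> 'I_n} | [forall i, p i <= i.+1]%N].

Definition eprod (p : {ffun 'I_n.-1 -> 'I_n}) : {mpoly R[n]} :=
  \prod_(i < n.-1) epk (p i) i.+1.

Definition Eprod (p : {ffun 'I_n.-1 -> 'I_n}) : {mpoly R[n]} :=
  \prod_(i < n.-1) Epk (p i) i.+1.

(* Coordinates in the basis (eprod p) of R (x) L_n. *)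
Definition ecoord f : {ffun 'I_n.-1 -> 'I_n} -> R :=
  epsilon (inhabits (fun=> 0))
    (fun c => f = \sum_(p in eindex) c p *: eprod p).

(* The linear map with Qhat (eprod p) = Eprod p. *)
Definition Qhat f : {mpoly R[n]} := \sum_(p in eindex) ecoord f p *: Eprod p.

Definition qgroth (w : 'S_n) : {mpoly R[n]} := Qhat (grothR w).

(* Endomorphisms of R (x) L_n are given by their matrices in the basis        *)
(* (grothR w), acting on row vectors; thus A *m B applies A first, and the    *)
(* right action of the quantum Fomin-Kirillov algebra is the algebra          *)
(* morphism sending the generator [i, j] to bracket i j.                      *)

Local Notation op := 'M[R]_#|{: 'S_n}|.

Definition qint (i j : 'I_n) : R := \prod_(i <= k < j) q k.

Definition bracket_coef (i j : 'I_n) (w : 'S_n) : R :=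
  let wt := pcomp w (tperm i j) in
  if plen wt == (plen w).+1 then 1
  else if (plen wt + 2 * (j - i) == (plen w).+1)%N then qint i j
  else 0.

Definition bracket_lt (i j : 'I_n) : op :=
  \matrix_(a, b) let w := enum_val a in
    if enum_val b == pcomp w (tperm i j) then bracket_coef i j w else 0.

Definition bracket (i j : 'I_n) : op :=
  if (i < j)%N then bracket_lt i j else - bracket_lt j i.

Definition hop (i j : 'I_n) : op := 1 + bracket i j.

Definition Xop (k : 'I_n) : op :=
  1 - (\prod_(i <- rev (enum 'I_n) | (i < k)%N) hop i k) *
      (\prod_(j <- rev (enum 'I_n) | (k < j)%N) invmx (hop k j)).

(* The order of the factors is immaterial, as the Xop k commute. *)
Definition subst_Xop F : op :=
  \sum_(a <- msupp F) F@_a *: \prod_(k < n) Xop k ^+ a k.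

Definition of_groth_coord (v : 'rV[R]_#|{: 'S_n}|) : {mpoly R[n]} :=
  \sum_(w : 'S_n) v 0 (enum_rank w) *: grothR w.

(* F(X)(1), where 1 = grothR 1%g. *)
Definition evalX1 F : {mpoly R[n]} :=
  of_groth_coord (delta_mx 0 (enum_rank (1%g : 'S_n)) *m subst_Xop F).

(* For f in R (x) L_n, the unique F in R (x) L_n with F(X)(1) = f. *)
Definition psi f : {mpoly R[n]} :=
  epsilon (inhabits 0) (fun F => F \in tensL /\ evalX1 F = f).

End Quantization.

Arguments tensL {R n}.
Arguments grothR R {n} w.

(* Main.v *)
From Pilot Require Import Defs.
From Stdlib Require Import ClassicalEpsilon.
From HB Require Import structures.
From mathcomp Require Import all_boot all_order all_fingroup all_algebra.
From mathcomp Require Import fraction mpoly.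
From mathcomp Require Import zify ring.

Set Implicit Arguments.
Unset Strict Implicit.
Unset Printing Implicit Defensive.

Import GRing.Theory Pilot.Defs.
Local Open Scope ring_scope.

(* Covers of the quantum Bruhat order are described by one cyclic-order condition on values
   (qcover), which yields the Fomin-Kirillov relations for the brackets, hence the Yang-Baxter
   equation and the commutation of Theta_k = 1 - X_k.  Yang-Baxter moves turn the I-summand of
   F_p^k(X) into a product FI of factors 1 + [b, c], b and c on both sides of I, in which all
   inverses have been absorbed by the factors 1 - q_i.  Counting supports, such a product takes
   no quantum step on the identity, and F_p^k(X) involves only q_1, ..., q_(k-1) on vectors
   supported on S_k.  Setting q_k = q_(k+1) = ... = 0 and using that the F_m^n(X), computed from
   all n variables, act on 1 as binomial coefficients, one shows by induction on k that
   E_(p_1)^1(X) ... E_(p_k)^k(X) (1) takes its classical value (q = 0).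

   At q = 0, 1 + [i, i+1] satisfies a Hecke relation that intertwines it with the isobaric
   divided difference, so G_w(X)(1) = w by descending from the longest element.  As the
   e-products span and both sides are free of rank n!, evaluation at X is injective on L_n, and the
   quantization map inverts it. *)

(** On the identity the products [FI] take no quantum step, but E_p^k(X) has to be applied to the
    image of the earlier factors, where quantum steps do occur. Showing that their total effect
    vanishes is the difficulty. A commuting operator resolves it: vectors supported on S_k do not
    see the later parameters, so these may be set to 0, and then the polynomial obtained from F_m^n
    by making only its first k variables quantum still acts on 1 by a binomial coefficient, because
    on 1 it agrees with the classical one. It commutes with every polynomial in the X_i, so it acts
    by the same scalar on the image of 1, and a unitriangular system in m isolates F_m^k. Neither
    the e-products nor the Grothendieck polynomials are assumed to form a basis: what is needed of
    this comes from the surjectivity of f -> f(X)(1) at q = 0 and from counting the n! monomials of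
    L_n. *)

(** * Lengths and cyclic order *)

(* Cyclic order of the values at i, j, s with i < s < j says at once that no value lies
   between (when w i < w j, an ordinary cover) and that all do (when w i > w j, a quantum one). *)
Definition cyc (x y z : nat) : bool :=
  [|| (x < y < z)%N, (y < z < x)%N | (z < x < y)%N].

Lemma cyc_rot x y z : cyc x y z = cyc y z x.
Proof. rewrite /cyc; lia. Qed.

(** Transitivity of the cyclic order; this is what compares the covers of two interlaced
    transpositions. *)
Lemma cyc4 x y z t : cyc x y z -> cyc x z t -> cyc x y t /\ cyc y z t.
Proof. rewrite /cyc; lia. Qed.

Section Lengths.
Variable n : nat.
Implicit Types (i j s : 'I_n) (w : 'S_n).

Definition qcover i j w : bool :=
  [forall s : 'I_n, (i < s < j)%N ==> cyc (w i) (w j) (w s)].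

Lemma qcoverP i j w :
  reflect (forall s : 'I_n, (i < s < j)%N -> cyc (w i) (w j) (w s)) (qcover i j w).
Proof. by apply: (iffP forallP) => h s; apply/implyP/h. Qed.

Lemma pcompE w (t : 'S_n) x : pcomp w t x = w (t x).
Proof. by rewrite permM. Qed.

Lemma pcompA (u v w : 'S_n) : pcomp u (pcomp v w) = pcomp (pcomp u v) w.
Proof. by rewrite /pcomp mulgA. Qed.

Lemma perm_val_inj w x y : (w x == w y :> nat) = (x == y :> nat).
Proof. by rewrite !(inj_eq val_inj) (inj_eq perm_inj). Qed.

Lemma tperm_other i j s : s != i -> s != j -> tperm i j s = s.
Proof. by move=> si sj; apply: tpermD; rewrite eq_sym. Qed.

Lemma pcomp_tpermK i j w : pcomp (pcomp w (tperm i j)) (tperm i j) = w.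
Proof. by apply/permP => x; rewrite !pcompE tpermK. Qed.

Lemma ltn_neq i j : (i < j)%N -> i != j.
Proof. by move=> h; apply: contraTneq h => ->; rewrite ltnn. Qed.

(** Isolates the terms that meet {i, j}: exchanging the values at i and j changes the inversion
    count only there. *)
Lemma sum_two i j (f : 'I_n -> 'I_n -> nat) : i != j ->
  (\sum_x \sum_y f x y = (f i i + f i j + f j i + f j j) +
    \sum_(s | (s != i) && (s != j)) (f i s + f s i + f j s + f s j) +
    \sum_(x | (x != i) && (x != j)) \sum_(y | (y != i) && (y != j)) f x y)%N.
Proof.
move=> ij; have ji : j != i by rewrite eq_sym.
rewrite (bigD1 i) //= [X in (_ + X)%N](bigD1 j) //=.
rewrite (bigD1 i (F := f i)) //= (bigD1 j (P := fun y => y != i) (F := f i)) //=.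
rewrite (bigD1 i (F := f j)) //= (bigD1 j (P := fun y => y != i) (F := f j)) //=.
have -> : (\sum_(x | (x != i) && (x != j)) \sum_y f x y =
  \sum_(x | (x != i) && (x != j)) (f x i + f x j) +
  \sum_(x | (x != i) && (x != j)) \sum_(y | (y != i) && (y != j)) f x y)%N.
  rewrite -big_split /=; apply: eq_bigr => x _.
  by rewrite (bigD1 i) //= (bigD1 j) //= addnA.
have -> : (\sum_(s | (s != i) && (s != j)) (f i s + f s i + f j s + f s j) =
  \sum_(s | (s != i) && (s != j)) f i s + \sum_(s | (s != i) && (s != j)) f j s +
  \sum_(s | (s != i) && (s != j)) (f s i + f s j))%N.
  by rewrite -!big_split /=; apply: eq_bigr => x _; lia.
set a := (\sum_(s | (s != i) && (s != j)) f i s)%N.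
set b := (\sum_(s | (s != i) && (s != j)) f j s)%N.
set c := (\sum_(s | (s != i) && (s != j)) (f s i + f s j))%N.
by set d := (\sum_(x | _) \sum_(y | _) _)%N; lia.
Qed.

Lemma plenE w :
  plen w = (\sum_(x : 'I_n) \sum_(y : 'I_n) ((x < y) && (w y < w x)))%N.
Proof.
rewrite /plen -sum1dep_card big_mkcond pair_big /=.
by apply: eq_bigr => -[x y] _ /=; case: ifP.
Qed.

(** The two inversion counts are compared after reindexing by the transposition, so that pairs
    avoiding i and j cancel. Each s between i and j both in position and in value accounts for two
    new inversions. *)
Lemma plen_tperm i j w : (i < j)%N -> (w i < w j)%N ->
  plen (pcomp w (tperm i j)) = (plen w + 1 +
    2 * \sum_(s | (s != i) && (s != j)) ((i < s < j) && (w i < w s < w j)))%N.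
Proof.
move=> ij wij; set t := tperm i j; have nij := ltn_neq ij.
have -> : plen (pcomp w t) =
    (\sum_(x : 'I_n) \sum_(y : 'I_n) ((t x < t y) && (w y < w x)))%N.
  rewrite plenE (reindex_inj (@perm_inj _ t)) /=; apply: eq_bigr => x _.
  rewrite (reindex_inj (@perm_inj _ t)) /=; apply: eq_bigr => y _.
  by rewrite !pcompE /t !tpermK.
rewrite plenE !(sum_two _ nij).
have -> : (\sum_(x | (x != i) && (x != j)) \sum_(y | (y != i) && (y != j))
    ((t x < t y) && (w y < w x)) = \sum_(x | (x != i) && (x != j))
    \sum_(y | (y != i) && (y != j)) ((x < y) && (w y < w x)))%N.
  apply: eq_bigr => x /andP[xi xj]; apply: eq_bigr => y /andP[yi yj].
  by rewrite /t !tperm_other.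
have -> : (\sum_(s | (s != i) && (s != j))
    (((t i < t s) && (w s < w i)) + ((t s < t i) && (w i < w s)) +
     ((t j < t s) && (w s < w j)) + ((t s < t j) && (w j < w s))) =
  \sum_(s | (s != i) && (s != j))
    (((i < s) && (w s < w i)) + ((s < i) && (w i < w s)) +
     ((j < s) && (w s < w j)) + ((s < j) && (w j < w s))) + 2 *
  \sum_(s | (s != i) && (s != j)) ((i < s < j) && (w i < w s < w j)))%N.
  rewrite big_distrr -big_split /=; apply: eq_bigr => s /andP[si sj].
  rewrite /t tpermL tpermR tperm_other //.
  have := perm_val_inj w s i; have := perm_val_inj w s j.
  move: si sj; rewrite -!val_eqE /=; lia.
rewrite /t tpermL tpermR; lia.
Qed.

Lemma sum_between (a b m : nat) :
  (\sum_(s < m) (a < s < b) = minn m b - a.+1)%N.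
Proof.
elim: m => [|m IH]; first by rewrite big_ord0 min0n.
rewrite big_ord_recr /= IH; lia.
Qed.

Lemma sum_between2 i j w : (i < j)%N ->
  (\sum_(s | (s != i) && (s != j)) ((i < s < j) && (w i < w s < w j)) +
   \sum_(s | (s != i) && (s != j)) ((i < s < j) && ~~ (w i < w s < w j)) =
   j - i.+1)%N.
Proof.
move=> ij; rewrite -big_split /=.
have := sum_between i j n; rewrite (minn_idPr (ltnW (ltn_ord j))) => <-.
rewrite [RHS](bigID (fun s => (s != i) && (s != j))) /=.
rewrite [X in (_ = _ + X)%N]big1 ?addn0; last first.
  by move=> s; rewrite -!val_eqE /=; case: ltngtP; case: ltngtP => //=; lia.
by apply: eq_bigr => s _; case: (_ < _ < _)%N; case: (_ < _ < _)%N.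
Qed.

Lemma qcover_up i j w : (i < j)%N -> (w i < w j)%N ->
  (plen (pcomp w (tperm i j)) == (plen w).+1) = qcover i j w.
Proof.
move=> ij wij; rewrite plen_tperm //.
apply/eqP/qcoverP => [h s sij|h].
  have /eqP : (\sum_(s | (s != i) && (s != j))
    ((i < s < j) && (w i < w s < w j)) = 0)%N by lia.
  rewrite sum_nat_eq0 => /forallP/(_ s); rewrite -!val_eqE /= sij /cyc.
  have := perm_val_inj w s i; have := perm_val_inj w s j; lia.
rewrite big1 ?muln0; first by lia.
by move=> s /andP[si sj]; case: (boolP (i < s < j)%N) => //= /h; rewrite /cyc; lia.
Qed.

Lemma qcover_down i j w : (i < j)%N -> (w j < w i)%N ->
  (plen (pcomp w (tperm i j)) + 2 * (j - i) == (plen w).+1)%N = qcover i j w.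
Proof.
(* Read backwards, w arises from v by an ascending swap. The drop 2(j - i) - 1 is the largest
   possible one, reached when all j - i - 1 intermediate positions have their values in between. *)
move=> ij wji; pose v := pcomp w (tperm i j).
have vi : v i = w j by rewrite pcompE tpermL.
have vj : v j = w i by rewrite pcompE tpermR.
have vo s : s != i -> s != j -> v s = w s.
  by move=> si sj; rewrite pcompE tperm_other.
have wE : w = pcomp v (tperm i j) by rewrite pcomp_tpermK.
have vij : (v i < v j)%N by rewrite vi vj.
have := plen_tperm ij vij; rewrite -wE -/v => ->.
have := sum_between2 v ij.
set a := (\sum_(_ | _) _)%N; set b := (\sum_(_ | _) _)%N => ab.
transitivity (b == 0)%N; first by apply/eqP/eqP; lia.
rewrite sum_nat_eq0; apply/forallP/qcoverP => h s.
  move=> sij; have := h s; rewrite -!val_eqE /= sij vi vj.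
  have si : s != i by rewrite -val_eqE /=; lia.
  have sj : s != j by rewrite -val_eqE /=; lia.
  by rewrite vo //= /cyc; lia.
apply/implyP => /andP[si sj]; rewrite vi vj vo //.
by case: (boolP (i < s < j)%N) => //= /h; rewrite /cyc; lia.
Qed.

Lemma plen_tperm_neq i j w : (i < j)%N -> (w i < w j)%N ->
  (plen w < plen (pcomp w (tperm i j)))%N.
Proof. by move=> ij wij; rewrite plen_tperm //; lia. Qed.

Lemma plen_tperm_gt i j w : (i < j)%N -> (w j < w i)%N ->
  (plen (pcomp w (tperm i j)) < plen w)%N.
Proof.
move=> ij wji.
have := @plen_tperm_neq i j (pcomp w (tperm i j)) ij.
by rewrite !pcompE tpermL tpermR pcomp_tpermK; apply.
Qed.

End Lengths.

(** * The bracket operators *)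

Section Brackets.
Variable n : nat.
Implicit Types (i j k s : 'I_n) (w : 'S_n).

(** The end values x, y are arguments because a transposition of the end positions changes them but
    not the values strictly inside; a cover of [pcomp w t] thus becomes a condition on w itself. *)
Definition qcover_on i j (x y : nat) w : bool :=
  [forall s : 'I_n, (i < s < j)%N ==> cyc x y (w s)].

Lemma qcover_onP i j (x y : nat) w :
  reflect (forall s : 'I_n, (i < s < j)%N -> cyc x y (w s)) (qcover_on i j x y w).
Proof. by apply: (iffP forallP) => h s; apply/implyP/h. Qed.

Lemma qcover_on_val i j w : qcover i j w = qcover_on i j (w i) (w j) w.
Proof. by []. Qed.

Lemma qcover_on_pcomp i j x y w (t : 'S_n) :
  (forall s, (i < s < j)%N -> t s = s) ->
  qcover_on i j x y (pcomp w t) = qcover_on i j x y w.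
Proof.
move=> ts; apply: eq_forallb => s; rewrite pcompE.
by case: (boolP (i < s < j)%N) => // /ts ->.
Qed.

Lemma qcover_on_split i j k x y w : (i < j < k)%N ->
  qcover_on i k x y w =
  [&& qcover_on i j x y w, qcover_on j k x y w & cyc x y (w j)].
Proof.
move=> ijk; apply/qcover_onP/and3P => [h|[/qcover_onP h1 /qcover_onP h2 h3] s sik].
  by split; [apply/qcover_onP => s ss|apply/qcover_onP => s ss|]; apply: h; lia.
case: (ltngtP s j) => [sj|sj|/val_inj -> //]; first by apply: h1; lia.
by apply: h2; lia.
Qed.

(** [cyc x y s] puts s on the open arc from y to x, and the arcs from y to x and from z to y meet
    exactly in the arc from z to x. *)
Lemma qcover_on_trans i j x y z w : cyc x y z ->
  (forall s, (i < s < j)%N -> y <> w s) ->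
  qcover_on i j x y w && qcover_on i j y z w = qcover_on i j x z w.
Proof.
move=> xyz ny; apply/andP/qcover_onP => [[/qcover_onP h1 /qcover_onP h2] s sij|h].
  by have := h1 s sij; have := h2 s sij; move: xyz; rewrite /cyc; lia.
by split; apply/qcover_onP => s sij; have := h s sij; have := ny s sij; move: xyz;
  rewrite /cyc; lia.
Qed.

End Brackets.

(** * The Fomin-Kirillov relations for the brackets *)

Section BracketAlgebra.
Variables (R : comUnitRingType) (n : nat).
Implicit Types (q : nat -> R) (i j k l s : 'I_n) (w : 'S_n).
Local Notation op := 'M[R]_#|{: 'S_n}|.

Definition bv w : 'rV[R]_#|{: 'S_n}| := delta_mx 0 (enum_rank w).

Lemma mx_bv_ext (A B : op) : (forall w, bv w *m A = bv w *m B) -> A = B.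
Proof.
move=> h; apply/row_matrixP => a; rewrite !rowE.
by have := h (enum_val a); rewrite /bv enum_valK.
Qed.

Lemma rv_mulM (v : 'rV[R]_#|{: 'S_n}|) (A B : op) : v *m (A * B) = v *m A *m B.
Proof. by rewrite -mulmxE mulmxA. Qed.

Lemma rv_mul1 (v : 'rV[R]_#|{: 'S_n}|) : v *m 1 = v.
Proof. exact: mulmx1. Qed.

Lemma rv_bvE (v : 'rV[R]_#|{: 'S_n}|) : v = \sum_w v 0 (enum_rank w) *: bv w.
Proof.
apply/rowP => a; rewrite summxE (bigD1 (enum_val a)) //= big1 ?addr0.
  by rewrite !mxE enum_valK !eqxx mulr1.
move=> w wa; rewrite !mxE eqxx /=; case: eqP => [e|]; last by rewrite mulr0.
by rewrite e enum_rankK eqxx in wa.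
Qed.

Definition bcoef q i j w : R :=
  if qcover i j w then (if (w i < w j)%N then 1 else qint q i j) else 0.

(** The order of w i and w j decides the sign of the length change, so at most one of the two length
    tests can succeed. *)
Lemma bracket_coefE q i j w : (i < j)%N -> bracket_coef q i j w = bcoef q i j w.
Proof.
move=> ij; rewrite /bracket_coef /bcoef.
case: (ltngtP (w i) (w j)) => [wij|wij|/val_inj/perm_inj e]; last first.
- by rewrite e ltnn in ij.
- rewrite qcover_down // ifF //.
  by have := plen_tperm_gt ij wij; lia.
rewrite qcover_up //; case: ifP => // _; rewrite ifF //.
by have := plen_tperm_neq ij wij; lia.
Qed.

Lemma bv_bracket q i j w : (i < j)%N ->
  bv w *m bracket q i j = bcoef q i j w *: bv (pcomp w (tperm i j)).
Proof.
move=> ij; rewrite /bracket ij -rowE; apply/rowP => b; rewrite !mxE /=.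
rewrite enum_rankK bracket_coefE //.
case: eqP => [e|ne].
  by rewrite -e enum_valK !eqxx mulr1.
case: eqP => [e|]; last by rewrite mulr0.
by case: ne; rewrite e enum_rankK.
Qed.

Lemma bv_bracket2 q i j k l w : (i < j)%N -> (k < l)%N ->
  bv w *m (bracket q i j * bracket q k l) =
  (bcoef q i j w * bcoef q k l (pcomp w (tperm i j))) *:
    bv (pcomp (pcomp w (tperm i j)) (tperm k l)).
Proof.
move=> ij kl.
by rewrite rv_mulM bv_bracket // -scalemxAl bv_bracket // scalerA.
Qed.

Lemma qint_cat q i j k : (i < j < k)%N -> qint q i k = qint q i j * qint q j k.
Proof.
by move=> /andP[ij jk]; rewrite /qint (big_cat_nat (n := j)) //= ltnW.
Qed.

Lemma qint_next q i j : j = i.+1 :> nat -> qint q i j = q i.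
Proof. by rewrite /qint => ->; rewrite big_nat1. Qed.

Lemma bracketN q i j : i != j -> bracket q j i = - bracket q i j.
Proof.
rewrite -val_eqE /bracket /=; case: (ltngtP i j) => // ij _.
by rewrite opprK.
Qed.

Lemma bracket_sqr q i j : (i < j)%N -> bracket q i j * bracket q i j =
  (if j == i.+1 :> nat then q i else 0) *: (1 : op).
Proof.
move=> ij; apply: mx_bv_ext => w; rewrite bv_bracket2 // -scalemxAr rv_mul1.
rewrite pcomp_tpermK; congr (_ *: _).
rewrite /bcoef [in X in _ * X]qcover_on_val qcover_on_pcomp; last first.
  by move=> s sij; apply: tperm_other; rewrite -val_eqE /=; lia.
rewrite !pcompE tpermL tpermR qcover_on_val.
have nij := ltn_neq ij.
case: eqP => [e|ne].
  have h x y : qcover_on i j x y w.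
    by apply/qcover_onP => s; lia.
  rewrite !h -(qint_next q e).
  case: (ltngtP (w i) (w j)) => [_|_|/val_inj/perm_inj e'].
  - by rewrite mul1r.
  - by rewrite mulr1.
  by rewrite e' eqxx in nij.
(* The position i + 1 lies strictly between i and j, and its value would have to lie on both
   complementary open arcs cut out by w i and w j. *)
have si : (i.+1 < n)%N by have := ltn_ord j; lia.
case: (@qcover_onP _ i j (w i) (w j) w) => [/(_ (Ordinal si)) h1|_]; last by rewrite mul0r.
case: (@qcover_onP _ i j (w j) (w i) w) => [/(_ (Ordinal si)) h2|_]; last by rewrite mulr0.
have hs : (i < Ordinal si < j)%N by rewrite /=; lia.
by have := h1 hs; have := h2 hs; rewrite /cyc; lia.
Qed.

Section Triple.
Variables (q : nat -> R) (i j k : 'I_n) (ijk : (i < j < k)%N).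

Let ij : (i < j)%N. Proof. by case/andP: ijk. Qed.
Let jk : (j < k)%N. Proof. by case/andP: ijk. Qed.
Let ik : (i < k)%N. Proof. exact: ltn_trans ij jk. Qed.

Let fix1 (t : 'S_n) w x y : t \in [:: tperm i j; tperm i k; tperm j k] ->
  qcover_on i j x y (pcomp w t) = qcover_on i j x y w.
Proof.
rewrite !inE => /or3P[]/eqP->; apply: qcover_on_pcomp => s sij;
  by apply: tperm_other; rewrite -val_eqE /=; lia.
Qed.

Let fix2 (t : 'S_n) w x y : t \in [:: tperm i j; tperm i k; tperm j k] ->
  qcover_on j k x y (pcomp w t) = qcover_on j k x y w.
Proof.
rewrite !inE => /or3P[]/eqP->; apply: qcover_on_pcomp => s sij;
  by apply: tperm_other; rewrite -val_eqE /=; lia.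
Qed.

Let nij : i != j. Proof. exact: ltn_neq. Qed.
Let njk : j != k. Proof. exact: ltn_neq. Qed.
Let nik : i != k. Proof. exact: ltn_neq. Qed.
Let nji : j != i. Proof. by rewrite eq_sym. Qed.
Let nkj : k != j. Proof. by rewrite eq_sym. Qed.
Let nki : k != i. Proof. by rewrite eq_sym. Qed.

Let tv := (pcompE, @tpermL, @tpermR, tperm_other nki nkj, tperm_other nji njk,
  tperm_other nij nik).

Let bcoef_ij w : bcoef q i j w = if qcover_on i j (w i) (w j) w
  then (if (w i < w j)%N then 1 else qint q i j) else 0.
Proof. by []. Qed.
Let bcoef_jk w : bcoef q j k w = if qcover_on j k (w j) (w k) w
  then (if (w j < w k)%N then 1 else qint q j k) else 0.
Proof. by []. Qed.
Let bcoef_ik w : bcoef q i k w =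
  if [&& qcover_on i j (w i) (w k) w, qcover_on j k (w i) (w k) w & cyc (w i) (w k) (w j)]
  then (if (w i < w k)%N then 1 else qint q i j * qint q j k) else 0.
Proof. by rewrite /bcoef qcover_on_val (qcover_on_split _ _ _ ijk) (qint_cat _ ijk). Qed.

(** The cyclic orientation of (w i, w j, w k) kills exactly one term on the left. By
    [qcover_on_trans] the other one has the same cover conditions as the right-hand side, and the
    weights match because [qint] is multiplicative along i < j < k. *)
Lemma bcoef_triple1 w :
  bcoef q i j w * bcoef q i k (pcomp w (tperm i j)) +
  bcoef q i k w * bcoef q j k (pcomp w (tperm i k)) =
  bcoef q j k w * bcoef q i j (pcomp w (tperm j k)).
Proof.
rewrite !(bcoef_ij, bcoef_jk, bcoef_ik).
rewrite !fix1 ?inE ?eqxx ?orbT // !fix2 ?inE ?eqxx ?orbT // !tv.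
have nj1 s : (i < s < j)%N -> w j <> w s :> nat.
  by move=> ss /eqP; rewrite perm_val_inj => /eqP; lia.
have ni2 s : (j < s < k)%N -> w i <> w s :> nat.
  by move=> ss /eqP; rewrite perm_val_inj => /eqP; lia.
have := perm_val_inj w i j; have := perm_val_inj w i k; have := perm_val_inj w j k.
move: nij njk nik; rewrite -!val_eqE /= => /negPf -> /negPf -> /negPf ->.
move=> ajk aik aij.
have [C|C] := boolP (cyc (w i) (w j) (w k)).
  have C1 : cyc (w j) (w k) (w i) by move: C; rewrite /cyc; lia.
  have C2 : cyc (w i) (w k) (w j) = false by move: C; rewrite /cyc; lia.
  rewrite C1 C2 !andbF mul0r addr0 andbT -(qcover_on_trans C nj1).
  case: (qcover_on i j (w i)) => /=; last by rewrite mul0r mulr0.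
  case: (qcover_on i j (w j)) => /=; last by rewrite !mulr0.
  case: (qcover_on j k (w j)) => /=; last by rewrite mulr0 mul0r.
  case: (ltngtP (w i) (w j)) aij => // h1 _; case: (ltngtP (w j) (w k)) ajk => // h2 _;
    case: (ltngtP (w i) (w k)) aik => // h3 _; rewrite ?mul1r ?mulr1 // 1?mulrC //;
    move: C; rewrite /cyc; lia.
have C1 : cyc (w j) (w k) (w i) = false by move: C; rewrite /cyc; lia.
have C2 : cyc (w i) (w k) (w j) by move: C; rewrite /cyc; lia.
have C3 : cyc (w j) (w i) (w k) by move: C; rewrite /cyc; lia.
rewrite C1 C2 !andbF mulr0 add0r andbT -(qcover_on_trans C3 ni2).
case: (qcover_on i j (w i) (w k)) => /=; last by rewrite mul0r mulr0.
case: (qcover_on j k (w j) (w i)) => /=; last by rewrite mulr0 mul0r.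
case: (qcover_on j k (w i) (w k)) => /=; last by rewrite !mul0r.
case: (ltngtP (w i) (w j)) aij => // h1 _; case: (ltngtP (w j) (w k)) ajk => // h2 _;
  case: (ltngtP (w i) (w k)) aik => // h3 _; rewrite ?mul1r ?mulr1 // 1?mulrC //;
  move: C; rewrite /cyc; lia.
Qed.

(** Same mechanism as in [bcoef_triple1]: the orientation selects which term on the right
    survives. *)
Lemma bcoef_triple2 w :
  bcoef q i j w * bcoef q j k (pcomp w (tperm i j)) =
  bcoef q j k w * bcoef q i k (pcomp w (tperm j k)) +
  bcoef q i k w * bcoef q i j (pcomp w (tperm i k)).
Proof.
rewrite !(bcoef_ij, bcoef_jk, bcoef_ik).
rewrite !fix1 ?inE ?eqxx ?orbT // !fix2 ?inE ?eqxx ?orbT // !tv.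
have nj2 s : (j < s < k)%N -> w j <> w s :> nat.
  by move=> ss /eqP; rewrite perm_val_inj => /eqP; lia.
have nk1 s : (i < s < j)%N -> w k <> w s :> nat.
  by move=> ss /eqP; rewrite perm_val_inj => /eqP; lia.
have := perm_val_inj w i j; have := perm_val_inj w i k; have := perm_val_inj w j k.
move: nij njk nik; rewrite -!val_eqE /= => /negPf -> /negPf -> /negPf ->.
move=> ajk aik aij.
have [C|C] := boolP (cyc (w i) (w j) (w k)).
  have C1 : cyc (w i) (w k) (w j) = false by move: C; rewrite /cyc; lia.
  rewrite C1 !andbF mul0r addr0 andbT -(qcover_on_trans C nj2).
  case: (qcover_on i j (w i)) => /=; last by rewrite mul0r mulr0.
  case: (qcover_on j k (w j)) => /=; last by rewrite ?(andbF, mulr0, mul0r).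
  case: (qcover_on j k (w i)) => /=; last by rewrite !mulr0.
  case: (ltngtP (w i) (w j)) aij => // h1 _; case: (ltngtP (w j) (w k)) ajk => // h2 _;
    case: (ltngtP (w i) (w k)) aik => // h3 _; rewrite ?mul1r ?mulr1 // 1?mulrC //;
    move: C; rewrite /cyc; lia.
have C2 : cyc (w i) (w k) (w j) by move: C; rewrite /cyc; lia.
rewrite C2 !andbF mulr0 add0r andbT -(qcover_on_trans C2 nk1).
case: (qcover_on i j (w i) (w k)) => /=; last by rewrite !mul0r.
case: (qcover_on i j (w k) (w j)) => /=; last by rewrite mulr0 mul0r.
case: (qcover_on j k (w i) (w k)) => /=; last by rewrite mulr0 mul0r.
case: (ltngtP (w i) (w j)) aij => // h1 _; case: (ltngtP (w j) (w k)) ajk => // h2 _;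
  case: (ltngtP (w i) (w k)) aik => // h3 _; rewrite ?mul1r ?mulr1 // 1?mulrC //;
  move: C; rewrite /cyc; lia.
Qed.

Let ptriple w (s t u v : 'S_n) :
  (s * t = u * v)%g -> pcomp (pcomp w t) s = pcomp (pcomp w v) u.
Proof. by move=> e; rewrite /pcomp !mulgA e. Qed.

Let tpermE3 : (tperm i k * tperm i j = tperm j k * tperm i k)%g /\
  (tperm i k * tperm i j = tperm i j * tperm j k)%g.
Proof.
split; apply/permP => x; rewrite !permM;
  (have [->|xi] := eqVneq x i; first by rewrite !tv);
  (have [->|xj] := eqVneq x j; first by rewrite !tv);
  (have [->|xk] := eqVneq x k; first by rewrite !tv);
  by rewrite !tperm_other.
Qed.

Let tpermE3' : (tperm j k * tperm i j = tperm i k * tperm j k)%g /\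
  (tperm j k * tperm i j = tperm i j * tperm i k)%g.
Proof.
split; apply/permP => x; rewrite !permM;
  (have [->|xi] := eqVneq x i; first by rewrite !tv);
  (have [->|xj] := eqVneq x j; first by rewrite !tv);
  (have [->|xk] := eqVneq x k; first by rewrite !tv);
  by rewrite !tperm_other.
Qed.

Lemma bracket_triple1 : bracket q i j * bracket q i k + bracket q i k * bracket q j k =
  bracket q j k * bracket q i j.
Proof.
apply: mx_bv_ext => w; rewrite mulmxDr !bv_bracket2 //.
have [e1 e2] := tpermE3.
by rewrite -(ptriple w e1) -(ptriple w e2) -scalerDl bcoef_triple1.
Qed.

Lemma bracket_triple2 : bracket q i j * bracket q j k =
  bracket q j k * bracket q i k + bracket q i k * bracket q i j.
Proof.
apply: mx_bv_ext => w; rewrite mulmxDr !bv_bracket2 //.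
have [e1 e2] := tpermE3'.
by rewrite -(ptriple w e1) -(ptriple w e2) -scalerDl bcoef_triple2.
Qed.

End Triple.

(** Only interlaced positions need work. There each cover condition involves a value that the other
    transposition moves, and the two cyclic triples are combined through [cyc4]. *)
Lemma qcover_comm i j k l w : (i < j)%N -> (k < l)%N ->
  uniq [:: i; j; k; l] ->
  qcover i j w && qcover k l (pcomp w (tperm i j)) ->
  qcover k l w && qcover i j (pcomp w (tperm k l)).
Proof.
move=> ij kl; rewrite /= !inE !negb_or andbT => /and3P[/and3P[nij nik nil] /andP[njk njl] nkl].
have nki : k != i by rewrite eq_sym. have nli : l != i by rewrite eq_sym.
have nkj : k != j by rewrite eq_sym. have nlj : l != j by rewrite eq_sym.
have [vk vl] : pcomp w (tperm i j) k = w k /\ pcomp w (tperm i j) l = w l.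
  by rewrite !pcompE !tperm_other.
have [vi vj] : pcomp w (tperm k l) i = w i /\ pcomp w (tperm k l) j = w j.
  by rewrite !pcompE !tperm_other.
move=> /andP[/qcoverP h1 /qcoverP h2].
have h2i : (k < i < l)%N -> cyc (w k) (w l) (w j).
  by move/h2; rewrite vk vl pcompE tpermL.
have h2j : (k < j < l)%N -> cyc (w k) (w l) (w i).
  by move/h2; rewrite vk vl pcompE tpermR.
have h2s s : s != i -> s != j -> (k < s < l)%N -> cyc (w k) (w l) (w s).
  by move=> si sj /h2; rewrite vk vl pcompE tperm_other.
have dvd (a b : 'I_n) : a != b -> (a < b)%N \/ (b < a)%N.
  by rewrite -val_eqE /= neq_ltn => /orP.
apply/andP; split; apply/qcoverP => s ss.
  have [es|si] := eqVneq s i.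
    rewrite es in ss *; have /h2i cj : (k < i < l)%N by [].
    case: (dvd j l njl) => [jl|lj]; first by apply: h2j; clear -ss ij jl; lia.
    have /h1 ci : (i < l < j)%N by clear -ss lj; lia.
    move: cj ci; rewrite cyc_rot => cj; rewrite -cyc_rot => ci.
    by have [+ _] := cyc4 ci cj; rewrite cyc_rot cyc_rot.
  have [es|sj] := eqVneq s j; last exact: h2s.
  rewrite es in ss *; have /h2j ci : (k < j < l)%N by [].
  case: (dvd i k nik) => [ik|ki]; last by apply: h2i; clear -ss ki ij; lia.
  have /h1 ck : (i < k < j)%N by clear -ss ik; lia.
  by move: ck; rewrite -cyc_rot => /(cyc4 ci)[].
rewrite vi vj pcompE.
have [es|sk] := eqVneq s k.
  rewrite es tpermL in ss *; have /h1 ck : (i < k < j)%N by [].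
  case: (dvd j l njl) => [jl|lj]; last by apply: h1; clear -ss lj kl; lia.
  have /h2j ci : (k < j < l)%N by clear -ss jl; lia.
  by move: ck; rewrite -cyc_rot => /(cyc4 ci)[_]; rewrite cyc_rot.
have [es|sl] := eqVneq s l; last by rewrite tperm_other //; apply: h1.
rewrite es tpermR in ss *; have /h1 cl : (i < l < j)%N by [].
case: (dvd i k nik) => [ik|ki]; first by apply: h1; clear -ss ik kl; lia.
have /h2i cj : (k < i < l)%N by clear -ss ki; lia.
by move: cj cl; rewrite cyc_rot => cj; rewrite -cyc_rot => /cyc4/(_ cj)[].
Qed.

Lemma bracket_comm_lt q i j k l : (i < j)%N -> (k < l)%N -> uniq [:: i; j; k; l] ->
  GRing.comm (bracket q i j) (bracket q k l).
Proof.
move=> ij kl u; apply: mx_bv_ext => w; rewrite !bv_bracket2 //.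
have u' : uniq [:: k; l; i; j].
  by move: u; rewrite -[[:: i; j; k; l]]/([:: i; j] ++ [:: k; l]) uniq_catC.
have := @qcover_comm i j k l w ij kl u; have := @qcover_comm k l i j w kl ij u'.
move: u; rewrite /= !inE !negb_or andbT => /and3P[/and3P[nij nik nil] /andP[njk njl] nkl].
have nki : k != i by rewrite eq_sym. have nli : l != i by rewrite eq_sym.
have nkj : k != j by rewrite eq_sym. have nlj : l != j by rewrite eq_sym.
have -> : pcomp (pcomp w (tperm k l)) (tperm i j) = pcomp (pcomp w (tperm i j)) (tperm k l).
  apply/permP => x; rewrite !pcompE; congr (w _).
  have [->|xi] := eqVneq x i; first by rewrite (tperm_other nik nil) !tpermL tperm_other.
  have [->|xj] := eqVneq x j; first by rewrite (tperm_other njk njl) !tpermR tperm_other.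
  rewrite (tperm_other xi xj).
  have [->|xk] := eqVneq x k; first by rewrite !tpermL tperm_other.
  have [->|xl] := eqVneq x l; first by rewrite !tpermR tperm_other.
  by rewrite !tperm_other.
rewrite /bcoef !pcompE (tperm_other nik nil) (tperm_other njk njl).
rewrite (tperm_other nki nkj) (tperm_other nli nlj) => h1 h2; congr (_ *: _).
have mul_if (a b : bool) (x y : R) :
    (if a then x else 0) * (if b then y else 0) = if a && b then x * y else 0.
  by case: a; case: b; rewrite ?(mul0r, mulr0).
rewrite !mul_if; have -> : qcover i j w && qcover k l (pcomp w (tperm i j)) =
  qcover k l w && qcover i j (pcomp w (tperm k l)) by apply/idP/idP.
by case: ifP => // _; rewrite mulrC.
Qed.

Lemma bracket_comm q i j k l : i != j -> k != l -> uniq [:: i; j; k; l] ->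
  GRing.comm (bracket q i j) (bracket q k l).
Proof.
have H (a b c d : 'I_n) : (c < d)%N -> a != b -> uniq [:: a; b; c; d] ->
    GRing.comm (bracket q a b) (bracket q c d).
  move=> cd ab u; case: (ltngtP a b) ab => [ab _|ab _|/val_inj ->]; last by rewrite eqxx.
    exact: bracket_comm_lt.
  rewrite bracketN; last exact: ltn_neq.
  apply/commr_sym/commrN/commr_sym/bracket_comm_lt => //.
  by rewrite (perm_uniq (permEl (perm_catCA [:: b] [:: a] [:: c; d]))).
move=> ij kl u; case: (ltngtP k l) kl => [kl _|kl _|/val_inj ->]; last by rewrite eqxx.
  exact: H.
rewrite (@bracketN q l k); last exact: ltn_neq.
apply/commrN/H => //.
by rewrite (perm_uniq (s2 := [:: i; j; k; l])) // !perm_cons; apply/permPl/(perm_catC [:: l] [:: k]).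
Qed.

End BracketAlgebra.

(** * Yang-Baxter equation and commutation of the operators X_k *)

Section DecreasingProducts.
Variables (n : nat) (S : pzRingType).
Implicit Types (P Q : pred 'I_n) (F G : 'I_n -> S).

(** Decreasing order is the order of the factors in X_k. The predicate allows single factors to be
    deleted, as happens when products attached to a set I are normally ordered. *)
Definition dprod P F : S := \prod_(b <- rev (enum 'I_n) | P b) F b.

Lemma rev_enum_split (c : 'I_n) : exists s1 s2 : seq 'I_n,
  [/\ rev (enum 'I_n) = s1 ++ c :: s2, {in s1, forall b : 'I_n, c < b}%N &
      {in s2, forall b : 'I_n, b < c}%N].
Proof.
have : c \in rev (enum 'I_n) by rewrite mem_rev mem_enum.
have : pairwise (fun a b : 'I_n => b < a)%N (rev (enum 'I_n)).
  rewrite -sorted_pairwise; last by move=> x y z /= yx zy; apply: ltn_trans zy yx.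
  by rewrite rev_sorted; have := iota_ltn_sorted 0 n; rewrite -val_enum_ord sorted_map.
move=> + /path.splitPr s12; case: s12 => s1 s2.
rewrite pairwise_cat allrel_consr pairwise_cons.
case/and3P => /andP[/allP h1 _] _ /andP[/allP h2 _].
by exists s1, s2.
Qed.

Lemma eq_dprod P Q F G : P =1 Q -> (forall b, Q b -> F b = G b) ->
  dprod P F = dprod Q G.
Proof.
move=> PQ FG; rewrite /dprod (eq_bigl _ _ PQ); exact: eq_bigr.
Qed.

Lemma eq_dprodl P Q F : P =1 Q -> dprod P F = dprod Q F.
Proof. by move=> PQ; apply: eq_dprod. Qed.

Lemma dprod_pred0 P F : (forall b, P b = false) -> dprod P F = 1.
Proof. by move=> P0; rewrite /dprod (eq_bigl _ _ P0) big_pred0_eq. Qed.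

Lemma dprod_split (c : 'I_n) P F : dprod P F =
  dprod (fun b => P b && (c < b)%N) F * (if P c then F c else 1) *
  dprod (fun b => P b && (b < c)%N) F.
Proof.
rewrite /dprod; have [s1 [s2 [-> h1 h2]]] := rev_enum_split c.
rewrite !big_cat !big_cons /= ltnn !andbF.
have -> : \prod_(b <- s2 | P b && (c < b)%N) F b = 1.
  rewrite big_seq_cond big1 // => b /and3P[/h2 bc _]; lia.
have -> : \prod_(b <- s1 | P b && (b < c)%N) F b = 1.
  rewrite big_seq_cond big1 // => b /and3P[/h1 bc _]; lia.
have -> : \prod_(b <- s1 | P b && (c < b)%N) F b = \prod_(b <- s1 | P b) F b.
  by rewrite big_seq_cond [RHS]big_seq_cond; apply: eq_bigl => b;
    case: (boolP (b \in s1)) => // /h1 ->; rewrite andbT.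
have -> : \prod_(b <- s2 | P b && (b < c)%N) F b = \prod_(b <- s2 | P b) F b.
  by rewrite big_seq_cond [RHS]big_seq_cond; apply: eq_bigl => b;
    case: (boolP (b \in s2)) => // /h2 ->; rewrite andbT.
by case: (P c); rewrite /= ?(mulr1, mul1r) ?mulrA.
Qed.

Lemma comm_dprod P F x : (forall b, P b -> GRing.comm x (F b)) ->
  GRing.comm x (dprod P F).
Proof. by move=> h; apply: commr_prod. Qed.

Lemma comm_dprod2 P Q F G :
  (forall a b, P a -> Q b -> GRing.comm (F a) (G b)) ->
  GRing.comm (dprod P F) (dprod Q G).
Proof.
move=> h; apply: comm_dprod => b Qb; apply/commr_sym/comm_dprod => a Pa.
exact/commr_sym/h.
Qed.

(** x is carried through the factors one index at a time by the local exchange relation; factors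
    with different indices commute out of the way. The local relation will be a form of the
    Yang-Baxter equation. *)
Lemma dprod_exchange P F G x :
  (forall b, P b -> x * F b * G b = G b * F b * x) ->
  (forall a b, P a -> P b -> a != b -> GRing.comm (F a) (G b)) ->
  x * dprod P F * dprod P G = dprod P G * dprod P F * x.
Proof.
rewrite /dprod => hx hc.
have : uniq (rev (enum 'I_n)) by rewrite rev_uniq enum_uniq.
elim: (rev _) => [|b s IH /= /andP[bs us]]; first by rewrite !big_nil !(mulr1, mul1r).
rewrite !big_cons; case: (boolP (P b)) => [Pb|_]; last exact: IH.
have h1 : GRing.comm (\prod_(c <- s | P c) F c) (G b).
  apply/commr_sym; rewrite big_seq_cond; apply: commr_prod => c /andP[cs Pc].
  by apply/commr_sym/hc => //; apply: contraNneq bs => <-.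
have h2 : GRing.comm (F b) (\prod_(c <- s | P c) G c).
  rewrite big_seq_cond; apply: commr_prod => c /andP[cs Pc].
  by apply/hc => //; apply: contraNneq bs => ->.
rewrite !mulrA -[_ * _ * G b]mulrA h1 !mulrA hx // -!mulrA.
congr (_ * _); rewrite [in RHS](mulrA _ (F b)) -h2 -!mulrA; congr (_ * _).
by have := IH us; rewrite !mulrA.
Qed.

Lemma dprod_intertwine P F G x : (forall b, P b -> F b * x = x * G b) ->
  dprod P F * x = x * dprod P G.
Proof.
move=> h; rewrite /dprod; elim: (rev _) => [|b s IH]; first by rewrite !big_nil mul1r mulr1.
rewrite !big_cons; case: (boolP (P b)) => // Pb.
by rewrite -mulrA IH mulrA h // mulrA.
Qed.

End DecreasingProducts.

Section YangBaxter.
Variables (R : comUnitRingType) (n : nat) (q : nat -> R).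
Hypothesis q_unit : forall i, 1 - q i \is a GRing.unit.
Implicit Types (i j k a b c : 'I_n).
Local Notation op := 'M[R]_#|{: 'S_n}|.
Local Notation H := (@hop R n q).
Local Notation G i j := (invmx (hop q i j)).

Lemma hop_rev i j : i != j -> hop q j i = 1 - bracket q i j.
Proof. by move=> ij; rewrite /hop bracketN. Qed.

(** The origin of the factors 1 - q_i: (1 + [i, j])(1 - [i, j]) = 1 - [i, j]^2, which is 1 - q_i for
    neighbours and 1 otherwise. *)
Definition hscale i j : R := if j == i.+1 :> nat then (1 - q i)^-1 else 1.

Lemma hop_inverse i j : (i < j)%N ->
  hop q i j *m (hscale i j *: hop q j i) = 1%:M.
Proof.
move=> ij; rewrite -scalemxAr (@hop_rev i j) ?ltn_neq // /hop mulmxE.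
rewrite mulrDl mul1r mulrBr mulr1 addrA subrK bracket_sqr // /hscale.
case: eqP => _; last by rewrite !scale0r subr0 scale1r.
have -> : (1 : op) - q i *: (1 : op) = (1 - q i) *: (1 : op) by rewrite scalerBl scale1r.
by rewrite scalerA mulVr ?scale1r.
Qed.

Lemma hop_unitmx i j : (i < j)%N -> hop q i j \in unitmx.
Proof. by case/hop_inverse/mulmx1_unit. Qed.

Lemma hop_invE i j : (i < j)%N -> G i j = hscale i j *: hop q j i.
Proof. by move=> ij; rewrite -[LHS]mulmx1 -(hop_inverse ij) mulKmx ?hop_unitmx. Qed.

Lemma hopV i j : (i < j)%N -> H i j * G i j = 1.
Proof. by move=> ij; rewrite -mulmxE mulmxV ?hop_unitmx. Qed.

Lemma Vhop i j : (i < j)%N -> G i j * H i j = 1.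
Proof. by move=> ij; rewrite -mulmxE mulVmx ?hop_unitmx. Qed.

Lemma hop_comm i j k l : i != j -> k != l -> uniq [:: i; j; k; l] ->
  GRing.comm (H i j) (H k l).
Proof.
move=> ij kl u; apply/commr_sym/commrD; first exact: commr1.
apply/commr_sym/commrD; first exact: commr1.
exact: bracket_comm.
Qed.

Lemma hopV_comm i j (A : op) : (i < j)%N -> GRing.comm (H i j) A -> GRing.comm (G i j) A.
Proof.
move=> ij c; rewrite /GRing.comm -[RHS]mul1r -(Vhop ij) -!mulrA; congr (_ * _).
by rewrite mulrA c -mulrA hopV // mulr1.
Qed.

Lemma yang_baxter i j k : (i < j < k)%N ->
  H i j * H i k * H j k = H j k * H i k * H i j.
Proof.
move=> ijk; have [ij jk] := andP ijk.
have t1 := bracket_triple1 q ijk; have t2 := bracket_triple2 q ijk.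
(* Cubic terms: by the two quadratic relations each side becomes [j,k][i,j][j,k] minus [i,k] times
   the scalar [j,k]^2. The quadratic terms of the expansion are the relations themselves. *)
have e : bracket q i j * bracket q i k * bracket q j k =
         bracket q j k * bracket q i k * bracket q i j.
  have sq := bracket_sqr q jk.
  have -> : bracket q i j * bracket q i k =
    bracket q j k * bracket q i j - bracket q i k * bracket q j k by rewrite -t1 addrK.
  rewrite mulrBl -[bracket q i k * _ * _]mulrA -[in RHS]mulrA.
  have -> : bracket q i k * bracket q i j =
    bracket q i j * bracket q j k - bracket q j k * bracket q i k by rewrite t2 addrC addKr.
  rewrite mulrBr !mulrA sq -[bracket q i k * _ * _]mulrA sq; congr (_ - _).
  by rewrite -!mulmxE -scalemxAl -scalemxAr !mulmxE mul1r mulr1.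
rewrite /hop !(mulrDl, mulrDr) !(mul1r, mulr1) e.
move: t1 t2; set ab := bracket q i j * bracket q i k; set bc := bracket q i k * bracket q j k.
set ca := bracket q j k * bracket q i j; set ac := bracket q i j * bracket q j k.
set cb := bracket q j k * bracket q i k; set ba := bracket q i k * bracket q i j.
set t := _ * _ * _ => /esym -> ->; apply/matrixP => u v; rewrite !mxE; ring.
Qed.

Lemma yang_baxterV a b c : (a < b < c)%N ->
  G a c * G a b * H b c = H b c * G a b * G a c.
Proof.
move=> abc; have [ab bc] := andP abc; have ac := ltn_trans ab bc.
have e := yang_baxter abc.
have -> : G a c * G a b * H b c =
    G a c * G a b * (H b c * H a c * H a b) * G a b * G a c.
  by rewrite !mulrA -[_ * H a b * _]mulrA hopV // mulr1 -[_ * H a c * _]mulrA hopV // mulr1.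
rewrite -e !mulrA -[_ * G a b * H a b]mulrA Vhop // mulr1 Vhop // mul1r.
by rewrite -!mulrA.
Qed.

Lemma yang_baxterVV a b c : (a < b < c)%N ->
  G a b * G a c * G b c = G b c * G a c * G a b.
Proof.
move=> abc; have [ab bc] := andP abc; have ac := ltn_trans ab bc.
have h1 : H a b * H a c * H b c * (G b c * G a c * G a b) = 1.
  by rewrite -!mulrA (mulrA (H b c)) hopV // mul1r (mulrA (H a c)) hopV // mul1r hopV.
rewrite -[LHS]mulr1 -h1 yang_baxter // !mulrA.
rewrite -[_ * H b c]mulrA Vhop // mulr1 -[_ * H a c]mulrA Vhop // mulr1.
by rewrite Vhop // mul1r.
Qed.

Definition Lop (P : pred 'I_n) c : op := dprod (fun b => P b && (b < c)%N) (H ^~ c).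
Definition Rop (P : pred 'I_n) a : op := dprod (fun b => P b && (a < b)%N) (fun b => G a b).
Definition Theta k : op := Lop predT k * Rop predT k.

Lemma XopE k : Xop q k = 1 - Theta k.
Proof. by []. Qed.

(** When the right half of Theta_a crosses the left half of Theta_c, the inverse of [hop a c] meets
    [hop a c] and cancels. P and Q must agree between a and c because there the factors with second
    index b come in pairs, one from each product. *)
Lemma Rop_Lop (P Q : pred 'I_n) a c : (a < c)%N -> P c -> Q a ->
  (forall b, (a < b < c)%N -> P b = Q b) ->
  Rop P a * Lop Q c = Lop (fun b => Q b && (b != a)) c * Rop (fun b => P b && (b != c)) a.
Proof.
move=> ac Pc Qa PQ; rewrite /Rop /Lop.
rewrite (dprod_split c) Pc ac /= [X in _ * X](dprod_split a) Qa ac /=.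
rewrite [X in _ = X * _](dprod_split a) eqxx /= andbF /= mulr1.
rewrite [X in _ = _ * X](dprod_split c) eqxx /= andbF /= mulr1.
set RG1 := dprod _ _; set RG2 := dprod _ _; set LH1 := dprod _ _; set LH2 := dprod _ _.
set LH1' := dprod _ _; set LH2' := dprod _ _; set RG1' := dprod _ _; set RG2' := dprod _ _.
have -> : LH1' = LH1.
  apply: eq_dprod => // b; rewrite -val_eqE; case: (Q b) => //=; lia.
have -> : LH2' = LH2.
  apply: eq_dprod => // b; rewrite -val_eqE; case: (Q b) => //=; lia.
have -> : RG1' = RG1.
  apply: eq_dprod => // b; rewrite -val_eqE; case: (P b) => //=; lia.
have -> : RG2' = RG2.
  apply: eq_dprod => // b; rewrite -val_eqE; case: (P b) => //=; lia.
(* Only the indices strictly between a and c interact with both products; the others commute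
   past. *)
have mid : G a c * RG2 * LH1 = LH1 * RG2 * G a c.
  have -> : LH1 = dprod (fun b => P b && (a < b)%N && (b < c)%N) (H ^~ c).
    apply: eq_dprod => // b; case: (boolP (a < b < c)%N) => [h|].
      by rewrite (PQ _ h) andbAC.
    by case: (Q b); case: (P b) => //=; lia.
  apply: dprod_exchange => [b /andP[/andP[_ ab] bc]|b d].
    by apply: yang_baxterV; rewrite ab.
  move=> /andP[/andP[_ ab] bc] /andP[/andP[_ ad] dc] bd.
  apply: hopV_comm => //; apply: hop_comm; [exact: ltn_neq|exact: ltn_neq|].
  by move: bd; rewrite /= !inE -!val_eqE /=; lia.
have c1 : GRing.comm RG1 (LH1 * LH2).
  apply: commrM; apply: comm_dprod2 => b d /andP[/andP[_ ab] cb] /andP[/andP[Qd dc] ad];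
    (apply: hopV_comm => //; apply: hop_comm; [exact: ltn_neq|exact: ltn_neq|];
     by rewrite /= !inE -!val_eqE /=; lia).
have c2 : GRing.comm RG2 LH2.
  apply: comm_dprod2 => b d /andP[/andP[_ ab] cb] /andP[/andP[Qd dc] ad].
  apply: hopV_comm => //; apply: hop_comm; [exact: ltn_neq|exact: ltn_neq|].
  by rewrite /= !inE -!val_eqE /=; lia.
transitivity (RG1 * (G a c * RG2 * LH1) * H a c * LH2); first by rewrite !mulrA.
rewrite mid -!mulrA (mulrA (G a c)) Vhop // mul1r c2 !mulrA; congr (_ * _).
by rewrite -mulrA c1.
Qed.

Lemma Rop_Lop_comm (P Q : pred 'I_n) a c : (a < c)%N ->
  GRing.comm (Rop P c) (Lop Q a).
Proof.
move=> ac; apply: comm_dprod2 => b d /andP[_ cb] /andP[_ da].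
apply: hopV_comm => //; apply: hop_comm; [exact: ltn_neq|exact: ltn_neq|].
by rewrite /= !inE -!val_eqE /=; lia.
Qed.

Lemma Lop_Lop a c : (a < c)%N ->
  Lop predT c * Lop predT a = Lop predT a * Lop (fun b => b != a) c * H a c.
Proof.
move=> ac; rewrite /Lop (dprod_split a) ac /=.
rewrite [X in _ = _ * X * _](dprod_split a) eqxx /= mulr1.
set A1 := dprod _ _; set A2 := dprod _ _; set B := dprod _ _; set A1' := dprod _ _; set A2' := dprod _ _.
have -> : A1' = A1 by apply: eq_dprod => // b; rewrite -val_eqE /=; lia.
have -> : A2' = A2 by apply: eq_dprod => // b; rewrite -val_eqE /=; lia.
have ex : H a c * A2 * B = B * A2 * H a c.
  rewrite /A2 /B.
  have -> : dprod (fun b => (b < c)%N && (b < a)%N) (H ^~ c) = dprod (fun b => (b < a)%N) (H ^~ c).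
    by apply: eq_dprod => // b; lia.
  apply: dprod_exchange => [b ba|b d ba da bd].
    by apply/esym/yang_baxter; rewrite ba.
  apply: hop_comm; [by apply: ltn_neq; lia|by apply: ltn_neq; lia|].
  by move: bd; rewrite /= !inE -!val_eqE /=; lia.
have c1 : GRing.comm A1 B.
  apply: comm_dprod2 => b d /andP[bc ab] da.
  apply: hop_comm; [by apply: ltn_neq; lia|by apply: ltn_neq; lia|].
  by rewrite /= !inE -!val_eqE /=; lia.
by rewrite -!mulrA (mulrA (H a c)) ex !mulrA c1.
Qed.

Lemma Rop_Rop a c : (a < c)%N ->
  Rop (fun b => b != c) a * Rop predT c = H a c * Rop predT c * Rop predT a.
Proof.
move=> ac; rewrite /Rop (dprod_split c) eqxx /= mulr1.
rewrite [X in _ = _ * X](dprod_split c) ac /=.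
set A1 := dprod _ _; set A2 := dprod _ _; set B := dprod _ _; set A1' := dprod _ _; set A2' := dprod _ _.
have -> : A1' = A1 by apply: eq_dprod => // b; rewrite -val_eqE /=; lia.
have -> : A2' = A2 by apply: eq_dprod => // b; rewrite -val_eqE /=; lia.
have ex : G a c * A1 * B = B * A1 * G a c.
  rewrite /A1 /B.
  have -> : dprod (fun b => (b != c) && (a < b)%N && (c < b)%N) (fun b => G a b) =
      dprod (fun b => (c < b)%N) (fun b => G a b).
    by apply: eq_dprod => // b; rewrite -val_eqE /=; lia.
  apply: dprod_exchange => [b cb|b d cb cd bd].
    by apply: yang_baxterVV; rewrite ac.
  have ab := ltn_trans ac cb; apply: hopV_comm => //; apply/commr_sym/hopV_comm => //.
  apply/commr_sym/hop_comm; [exact: ltn_neq|exact: ltn_neq|].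
  by move: bd; rewrite /= !inE -!val_eqE /=; lia.
have c1 : GRing.comm A2 B.
  apply: comm_dprod2 => b d /andP[/andP[_ ab] bc] cd.
  apply: hopV_comm => //; apply/commr_sym/hopV_comm => //.
  apply/commr_sym/hop_comm; [exact: ltn_neq|exact: ltn_neq|].
  by rewrite /= !inE -!val_eqE /=; lia.
rewrite -(mulrA (H a c)) !mulrA -[H a c * B * A1]mulrA -(mulrA _ (B * A1)) -ex.
by rewrite !mulrA hopV // mul1r -!mulrA c1.
Qed.

(** For i < j both products equal L_j L_i R_j R_i. In Theta_i Theta_j, crossing R_i with L_j deletes
    [hop i j] and its inverse; [Rop_Rop] followed by [Lop_Lop] restores them. *)
Lemma Theta_comm i j : GRing.comm (Theta i) (Theta j).
Proof.
wlog ij : i j / (i < j)%N.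
  move=> h; case: (ltngtP i j) => [|ji|/val_inj ->]; [exact: h|exact/commr_sym/h|by []].
rewrite /GRing.comm /Theta.
have e : Rop predT i * Lop predT j =
    Lop (fun b => b != i) j * Rop (fun b => b != j) i by rewrite Rop_Lop.
rewrite !mulrA -(mulrA _ (Rop _ i)) e.
rewrite -!mulrA (mulrA (Rop predT j)) Rop_Lop_comm // Rop_Rop // !mulrA.
by rewrite Lop_Lop.
Qed.

Lemma Xop_comm i j : GRing.comm (Xop q i) (Xop q j).
Proof.
rewrite !XopE; apply/commrB/commr_sym/commrB/commr_sym/Theta_comm;
  by [exact: commr1|exact/commr_sym/commr1].
Qed.
End YangBaxter.

(** * Substituting the commuting operators X_k in polynomials *)

Section Substitution.
Variables (R : comUnitRingType) (n : nat) (q : nat -> R).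
Implicit Types (F : {mpoly R[n]}) (m : 'X_{1..n}).
Local Notation op := 'M[R]_#|{: 'S_n}|.
Local Notation sub := (@subst_Xop R n q).

Let Xmon m : op := \prod_(k < n) Xop q k ^+ m k.

Lemma subst_XopE d F : (msize F <= d)%N ->
  sub F = \sum_(m : 'X_{1..n < d}) F@_m *: Xmon m.
Proof.
move=> Fd; rewrite /subst_Xop (ssrcomplements.big_mksub ('X_{1..n < d} : subFinType _)) /=.
- by rewrite big_rmcond //= => m /memN_msupp_eq0 ->; rewrite scale0r.
- exact: msupp_uniq.
- by move=> m /msize_mdeg_lt /leq_trans; apply.
Qed.

Lemma substD : {morph sub : F1 F2 / F1 + F2}.
Proof.
move=> F1 F2; pose d := maxn (msize F1) (msize F2).
rewrite !(@subst_XopE d) ?(leq_maxl, leq_maxr, msizeD_le) //.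
by rewrite -big_split; apply: eq_bigr => m _; rewrite mcoeffD scalerDl.
Qed.

Lemma substZ c F : sub (c *: F) = c *: sub F.
Proof.
rewrite !(@subst_XopE (msize F)) ?msizeZ_le // scaler_sumr.
by apply: eq_bigr => m _; rewrite mcoeffZ scalerA.
Qed.

Lemma subst0 : sub 0 = 0.
Proof. by rewrite -(scale0r 0) substZ scale0r. Qed.

Lemma substN F : sub (- F) = - sub F.
Proof. by rewrite -scaleN1r substZ scaleN1r. Qed.

Lemma substB : {morph sub : F1 F2 / F1 - F2}.
Proof. by move=> F1 F2; rewrite substD substN. Qed.

Lemma subst_sum I (r : seq I) P (F : I -> {mpoly R[n]}) :
  sub (\sum_(i <- r | P i) F i) = \sum_(i <- r | P i) sub (F i).
Proof. exact: (big_morph _ substD subst0). Qed.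

Lemma substXm m : sub 'X_[m] = Xmon m.
Proof. by rewrite /subst_Xop msuppX big_seq1 mcoeffX eqxx scale1r. Qed.

Lemma subst1 : sub 1 = 1.
Proof.
rewrite -mpolyX0 substXm /Xmon big1 // => k _.
by rewrite mnm0E expr0.
Qed.

Lemma substC c : sub c%:MP = c *: (1 : op).
Proof. by rewrite -[c%:MP]mulr1 mul_mpolyC substZ subst1. Qed.

Lemma substX k : sub 'X_k = Xop q k.
Proof.
rewrite substXm /Xmon; have : k \in index_enum 'I_n by rewrite mem_index_enum.
have : uniq (index_enum 'I_n) by exact: index_enum_uniq.
elim: (index_enum _) => // a s IH /= /andP[sa us].
rewrite inE big_cons mnm1E => /orP[/eqP ka|ks].
  rewrite ka eqxx expr1 big_seq big1 ?mulr1 // => b bs.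
  by rewrite mnm1E; case: eqP => [ab|]; [rewrite ab bs in sa|rewrite expr0].
by case: eqP => [ka|_]; [rewrite -ka ks in sa|rewrite expr0 mul1r IH].
Qed.

Hypothesis q_unit : forall i, 1 - q i \is a GRing.unit.

Lemma Xmon_add m1 m2 : Xmon (m1 + m2) = Xmon m1 * Xmon m2.
Proof.
rewrite /Xmon -prodrM_comm => [|i j _ _]; last first.
  exact/commrX/commr_sym/commrX/Xop_comm.
by apply: eq_bigr => k _; rewrite mnmDE exprD.
Qed.

Lemma substM : {morph sub : F1 F2 / F1 * F2}.
Proof.
move=> F1 F2; elim/mpolyind: F1 => [|c m F1 _ _ IH]; first by rewrite mul0r subst0 mul0r.
rewrite mulrDl !substD IH mulrDl -scalerAl !substZ; congr (_ + _).
rewrite -mulmxE -scalemxAl mulmxE; congr (_ *: _).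
elim/mpolyind: F2 {IH} => [|c' m' F2 _ _ IH]; first by rewrite mulr0 subst0 mulr0.
rewrite mulrDr !substD IH mulrDr -scalerAr !substZ; congr (_ + _).
rewrite -mulmxE -scalemxAr mulmxE; congr (_ *: _).
by rewrite -mpolyXD !substXm Xmon_add.
Qed.

Lemma subst_prod I (r : seq I) P (F : I -> {mpoly R[n]}) :
  sub (\prod_(i <- r | P i) F i) = \prod_(i <- r | P i) sub (F i).
Proof. exact: (big_morph _ substM subst1). Qed.

Lemma subst_comm F1 F2 : GRing.comm (sub F1) (sub F2).
Proof. by rewrite /GRing.comm -!substM mulrC. Qed.

Lemma subst_1BX k : sub (1 - 'X_k) = Theta q k.
Proof. by rewrite substB subst1 substX XopE subKr. Qed.

End Substitution.

(** * Normal ordering of products of Theta_i over a set *)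

Section ThetaProducts.
Variables (R : comUnitRingType) (n : nat) (q : nat -> R).
Hypothesis q_unit : forall i, 1 - q i \is a GRing.unit.
Implicit Types (i j a b c : 'I_n) (P Q : pred 'I_n) (I : {set 'I_n}) (r t u : seq 'I_n).
Local Notation op := 'M[R]_#|{: 'S_n}|.
Local Notation Lop := (@Lop R n q).
Local Notation Rop := (@Rop R n q).

Lemma eq_Lop P Q c : (forall b, (b < c)%N -> P b = Q b) -> Lop P c = Lop Q c.
Proof.
move=> h; apply: eq_dprod => // b; case: (boolP (b < c)%N) => [/h ->//|].
by rewrite !andbF.
Qed.

Lemma eq_Rop P Q a : (forall b, (a < b)%N -> P b = Q b) -> Rop P a = Rop Q a.
Proof.
move=> h; apply: eq_dprod => // b; case: (boolP (a < b)%N) => [/h ->//|].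
by rewrite !andbF.
Qed.

(** The left half of Theta_c crosses the right halves for t from the last one to the first. Each
    crossing enlarges the set u of indices deleted from it, until all of r is deleted, while c is
    deleted from every right half. *)
Lemma Rprod_Lop r t u c : r = t ++ u ->
  sorted (fun a b => a < b)%N (rcons r c) ->
  (\prod_(a <- t) Rop (fun b => b \notin r) a) * Lop (fun b => b \notin u) c =
  Lop (fun b => b \notin r) c * \prod_(a <- t) Rop (fun b => b \notin rcons r c) a.
Proof.
move=> + srt; elim/last_ind: t u => [|t a IH] u e.
  by rewrite !big_nil mul1r mulr1 e.
have tr : transitive (fun a b : 'I_n => a < b)%N by move=> x y z; apply: ltn_trans.
have [h1 h2] : all (fun b => b < c)%N r /\ pairwise (fun a b => a < b)%N r.
  by move: srt; rewrite (sorted_pairwise tr) pairwise_rcons => /andP.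
have ac : (a < c)%N by move/allP: h1; apply; rewrite e mem_cat mem_rcons mem_head.
have cr : c \notin r by apply/negP => /(allP h1); rewrite ltnn.
rewrite e pairwise_cat pairwise_rcons in h2; case/and3P: h2 => h3 /andP[h4 h5] h6.
have au b : b \in u -> (a < b)%N.
  by move=> bu; apply: (allrelP h3) => //; rewrite mem_rcons mem_head.
have ta b : b \in t -> (b < a)%N by move=> bt; apply: (allP h4 b bt).
rewrite -cats1 !big_cat !big_seq1 /=.
rewrite -mulrA (@Rop_Lop _ _ _ q_unit _ _ a c) //; last first.
- move=> b /andP[ab _]; rewrite e mem_cat mem_rcons inE.
  have -> : (b == a) = false by rewrite -val_eqE /=; lia.
  by case: (boolP (b \in t)) => // /ta; lia.
- by apply/negP => /au; rewrite ltnn.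
rewrite mulrA (@eq_Lop _ (fun b => b \notin a :: u)); last first.
  by move=> b _; rewrite inE negb_or andbC.
rewrite IH; last by rewrite e cat_rcons.
rewrite mulrA; congr (_ * _); apply: eq_Rop => b _.
by rewrite mem_rcons inE negb_or andbC.
Qed.

(** All left halves come first, then all right halves; the factors with both indices in r have
    cancelled, so the remaining ones join r to its complement. *)
Lemma prod_Theta_seq r : sorted (fun a b => a < b)%N r ->
  \prod_(i <- r) Theta q i =
  (\prod_(c <- r) Lop (fun b => b \notin r) c) *
  (\prod_(a <- r) Rop (fun b => b \notin r) a).
Proof.
have tr : transitive (fun a b : 'I_n => a < b)%N by move=> x y z; apply: ltn_trans.
elim/last_ind: r => [|r c IH] srt; first by rewrite !big_nil mul1r.
have [h1 h2] : all (fun b => b < c)%N r /\ sorted (fun a b => a < b)%N r.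
  by move: srt; rewrite !(sorted_pairwise tr) pairwise_rcons => /andP.
rewrite -cats1 !big_cat !big_seq1 /= cats1 IH // /Theta mulrA.
rewrite -[_ * _ * Lop _ _]mulrA.
have e := @Rprod_Lop r r [::] c (esym (cats0 r)) srt.
rewrite (@eq_Lop predT (fun b => b \notin [::])) // e !mulrA.
have e1 : \prod_(c0 <- r) Lop (fun b => b \notin rcons r c) c0 =
          \prod_(c0 <- r) Lop (fun b => b \notin r) c0.
  apply: eq_big_seq => d dr; apply: eq_Lop => b bd; rewrite mem_rcons inE negb_or.
  have := allP h1 d dr => dc; have -> : b != c by rewrite -val_eqE /=; lia.
  by [].
have e2 : Lop (fun b => b \notin rcons r c) c = Lop (fun b => b \notin r) c.
  apply: eq_Lop => b bc; rewrite mem_rcons inE negb_or.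
  by have -> : b != c by rewrite -val_eqE /=; lia.
have e3 : Rop (fun b => b \notin rcons r c) c = Rop predT c.
  apply: eq_Rop => b cb; rewrite mem_rcons inE negb_or.
  have -> : b != c by rewrite -val_eqE /=; lia.
  by apply/negP => /(allP h1); lia.
by rewrite e1 e2 e3.
Qed.

Lemma sorted_enum_set I : sorted (fun a b => a < b)%N (enum I).
Proof.
rewrite /enum_mem -enumT; apply: sorted_filter; first by move=> x y z; apply: ltn_trans.
by have := iota_ltn_sorted 0 n; rewrite -val_enum_ord sorted_map.
Qed.

Lemma prod_enum_set I (F : 'I_n -> op) :
  \prod_(i <- enum I) F i = \prod_(i in I) F i.
Proof. by rewrite /enum_mem big_filter [index_enum _]unlock. Qed.

Lemma prod_Theta I : \prod_(i in I) Theta q i =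
  (\prod_(c in I) Lop (fun b => b \notin I) c) *
  (\prod_(a in I) Rop (fun b => b \notin I) a).
Proof.
rewrite -!prod_enum_set (prod_Theta_seq (sorted_enum_set I)).
by congr (_ * _); apply: eq_bigr => c _; [apply: eq_Lop|apply: eq_Rop] => b _;
  rewrite mem_enum.
Qed.

(** The inverses are replaced by [hop b a] = 1 - [a, b], their scalars being collected in
    [hscale]. *)
Definition Rop' P a : op := dprod (fun b => P b && (a < b)%N) (fun b => hop q b a).

Lemma prod_scale (J : Type) (s : seq J) (P : pred J) (c : J -> R) (F : J -> op) :
  \prod_(b <- s | P b) (c b *: F b) =
  (\prod_(b <- s | P b) c b) *: \prod_(b <- s | P b) F b.
Proof.
elim: s => [|b s IH]; first by rewrite !big_nil scale1r.
rewrite !big_cons; case: (P b) => //; rewrite IH -!mulmxE.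
by rewrite -scalemxAl -scalemxAr scalerA.
Qed.

Lemma Rop_scale P a : Rop P a =
  (\prod_(b <- rev (enum 'I_n) | P b && (a < b)%N) hscale q a b) *: Rop' P a.
Proof.
rewrite -prod_scale; apply: eq_dprod => // b /andP[_ ab].
exact: hop_invE.
Qed.

Definition FI I : op :=
  (\prod_(c in I) Lop (fun b => b \notin I) c) *
  (\prod_(a in I) Rop' (fun b => b \notin I) a).

(** Only b = a + 1 contributes a scalar, and it occurs exactly when a + 1 is not in I, which is the
    condition on the factors 1 - q_i in F_p^k. *)
Lemma hscale_prod I a : (a.+1 < n)%N ->
  \prod_(b <- rev (enum 'I_n) | (b \notin I) && (a < b)%N) hscale q a b =
  if [forall j in I, j != a.+1 :> nat] then (1 - q a)^-1 else 1.
Proof.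
move=> an; pose a' := Ordinal an.
have -> : \prod_(b <- rev (enum 'I_n) | (b \notin I) && (a < b)%N) hscale q a b =
    \prod_(b | (b \notin I) && (a < b)%N) hscale q a b.
  by rewrite (perm_big (enum 'I_n)) ?perm_rev //= big_enum_cond.
case: ifP => [/forall_inP h|/negbT].
  have aI : (a' \notin I) && (a < a')%N.
    by rewrite ltnSn andbT; apply/negP => /h; rewrite eqxx.
  rewrite (bigD1 a') //= big1 ?mulr1 /hscale ?eqxx // => b /andP[_].
  by rewrite -val_eqE /= => /negPf ->.
rewrite negb_forall_in => /exists_inP[j jI /negPn/eqP ja].
apply: big1 => b /andP[bI _]; rewrite /hscale; case: eqP => // ba.
by rewrite (_ : b = j) ?jI // in bI; apply: val_inj; rewrite /= ba ja.
Qed.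

Lemma FIE I : (forall i, i \in I -> i.+1 < n)%N ->
  (\prod_(i in I | [forall j in I, j != i.+1 :> nat]) (1 - q i)) *:
    \prod_(i in I) Theta q i = FI I.
Proof.
move=> hI; rewrite prod_Theta /FI.
rewrite [\prod_(a in I) Rop _ _](eq_bigr _ (fun a _ => Rop_scale _ a)).
rewrite prod_scale -!mulmxE -scalemxAr scalerA.
have -> : \prod_(a in I) \prod_(b <- rev (enum 'I_n) | (b \notin I) && (a < b)%N) hscale q a b
   = \prod_(a in I | [forall j in I, j != a.+1 :> nat]) (1 - q a)^-1.
  rewrite [RHS]big_mkcondr; apply: eq_bigr => a aI.
  by rewrite hscale_prod ?hI.
rewrite -big_split big1 ?scale1r // => i _; exact: mulrV.
Qed.

(** The bound k < n gives each i in I a successor position, whose factor supplies the inverse of 1 -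
    q_i when i + 1 is not in I. *)
Lemma subst_Fpk p k : (k < n)%N -> subst_Xop q (@Fpk R n q p k) =
  \sum_(I : {set 'I_n} | (#|I| == p) && [forall i in I, (i < k)%N]) FI I.
Proof.
move=> kn; rewrite /Fpk subst_sum; apply: eq_bigr => I /andP[_ /forall_inP Ik].
rewrite -FIE => [|i /Ik]; last by lia.
rewrite substM // -rmorph_prod /= substC subst_prod //.
rewrite (eq_bigr _ (fun i _ => subst_1BX q i)) -!mulmxE -scalemxAr mulmxE mulr1.
by [].
Qed.
End ThetaProducts.

(** * Products of brackets that take no quantum step *)

Section Support.
Variables (R : comUnitRingType) (n : nat).
Implicit Types (S : 'S_n -> Prop) (v : 'rV[R]_#|{: 'S_n}|) (w : 'S_n).
Local Notation op := 'M[R]_#|{: 'S_n}|.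
Local Notation bv := (@bv R n).

Definition supp S v := forall w, v 0 (enum_rank w) != 0 -> S w.

Lemma supp_bv S w : S w -> supp S (bv w).
Proof.
move=> Sw w'; have [-> //|ne] := eqVneq w' w.
by rewrite mxE (inj_eq enum_rank_inj) (negPf ne) andbF eqxx.
Qed.

Lemma suppD S v1 v2 : supp S v1 -> supp S v2 -> supp S (v1 + v2).
Proof.
move=> h1 h2 w; rewrite mxE.
by have [->|/h1 //] := eqVneq (v1 0 (enum_rank w)) 0; rewrite add0r => /h2.
Qed.

Lemma suppZ S c v : supp S v -> supp S (c *: v).
Proof.
move=> h w; rewrite mxE.
by have [->|/h //] := eqVneq (v 0 (enum_rank w)) 0; rewrite mulr0 eqxx.
Qed.

Lemma supp0 S : supp S 0.
Proof. by move=> w; rewrite mxE eqxx. Qed.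

Lemma supp_sum S (J : Type) (r : seq J) (P : pred J) (F : J -> 'rV[R]_#|{: 'S_n}|) :
  (forall j, P j -> supp S (F j)) -> supp S (\sum_(j <- r | P j) F j).
Proof. by move=> h; apply: big_ind => //; [apply: supp0|apply: suppD]. Qed.

(** A Hoare-style triple on supports: it composes, so each factor of a product can have its own
    invariant. *)
Definition agree S S' (A B : op) := forall v, supp S v -> v *m A = v *m B /\ supp S' (v *m A).

Lemma agree_bv S S' (A B : op) :
  (forall w, S w -> bv w *m A = bv w *m B /\ supp S' (bv w *m A)) -> agree S S' A B.
Proof.
move=> h v Sv; rewrite [v]rv_bvE !mulmx_suml.
have h' w : v 0 (enum_rank w) *: bv w *m A = v 0 (enum_rank w) *: bv w *m B /\
    supp S' (v 0 (enum_rank w) *: bv w *m A).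
  rewrite -!scalemxAl; have [e|ne] := eqVneq (v 0 (enum_rank w)) 0.
    by rewrite e !scale0r; split=> //; apply: supp0.
  by have [-> s] := h w (Sv w ne); split=> //; apply: suppZ.
by split; [apply: eq_bigr => w _; have [] := h' w|apply: supp_sum => w _; have [] := h' w].
Qed.

Lemma agree_mul S S' S'' (A B C D : op) :
  agree S S' A B -> agree S' S'' C D -> agree S S'' (A * C) (B * D).
Proof.
move=> h1 h2 v Sv; rewrite !rv_mulM.
by have [<- /h2] := h1 v Sv.
Qed.

Lemma agree1 S S' : (forall w, S w -> S' w) -> agree S S' 1 1.
Proof. by move=> h v Sv; rewrite rv_mul1; split=> // w /Sv /h. Qed.

(** The decreasing product meets the indices n - 1, ..., 0 in turn, hence [St b.+1] before the
    factor b and [St b] after it; deleted indices must preserve the invariant too. *)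
Lemma agree_dprod (St : nat -> 'S_n -> Prop) (P : pred 'I_n) (F F' : 'I_n -> op) :
  (forall b : 'I_n, P b -> agree (St b.+1) (St b) (F b) (F' b)) ->
  (forall (b : 'I_n) w, ~~ P b -> St b.+1 w -> St b w) ->
  agree (St n) (St 0) (dprod P F) (dprod P F').
Proof.
move=> h1 h2.
have H m : (m <= n)%N -> agree (St m) (St 0)
    (dprod (fun b => P b && (b < m)%N) F) (dprod (fun b => P b && (b < m)%N) F').
  elim: m => [_|m IH mn].
    by rewrite !dprod_pred0 => [|b|b]; [exact: agree1|case: (P b)|case: (P b)].
  pose c := Ordinal mn.
  have hm (F0 : 'I_n -> op) : dprod (fun b => P b && (b < m.+1)%N) F0 =
      (if P c then F0 c else 1) * dprod (fun b => P b && (b < m)%N) F0.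
    rewrite (dprod_split c) /= ltnSn andbT dprod_pred0 ?mul1r; last first.
      by move=> b; case: (P b) => //=; lia.
    by congr (_ * _); apply: eq_dprod => // b /=; case: (P b) => //=; lia.
  rewrite !hm; apply: agree_mul (IH (ltnW mn)).
  case: (boolP (P c)) => [/h1 //|Pc]; apply: agree1 => w; exact: (h2 c).
have := H n (leqnn n).
by rewrite !(@eq_dprodl _ _ (fun b => P b && (b < n)%N) P) // => b; rewrite ltn_ord andbT.
Qed.

Lemma agree_prod (St : nat -> 'S_n -> Prop) (P : pred 'I_n) (F F' : 'I_n -> op) :
  (forall a : 'I_n, P a -> agree (St a) (St a.+1) (F a) (F' a)) ->
  (forall (a : 'I_n) w, ~~ P a -> St a w -> St a.+1 w) ->
  agree (St 0) (St n) (\prod_(a | P a) F a) (\prod_(a | P a) F' a).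
Proof.
move=> h1 h2.
pose f (F0 : 'I_n -> op) m := if insub m is Some a then (if P a then F0 a else 1) else 1.
have e (F0 : 'I_n -> op) : \prod_(a | P a) F0 a = \prod_(0 <= m < n) f F0 m.
  by rewrite big_mkcond big_mkord; apply: eq_bigr => a _; rewrite /f valK.
rewrite !e; have H m : (m <= n)%N -> agree (St 0) (St m)
    (\prod_(0 <= i < m) f F i) (\prod_(0 <= i < m) f F' i).
  elim: m => [_|m IH mn]; first by rewrite !big_geq //; apply: agree1.
  rewrite !big_nat_recr //=; apply: (agree_mul (IH (ltnW mn))).
  rewrite /f insubT /=; case: (boolP (P _)) => [/h1 //|Pa].
  by apply: agree1 => w; apply: (h2 (Ordinal mn)).
exact: H.
Qed.

(** The parameters enter only through quantum steps, so it is enough that each possible step ascends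
    or has equal weights. *)
Lemma agree_hop S S' (q q' : nat -> R) (i j : 'I_n) : (i < j)%N ->
  (forall w, S w -> S' w /\ (qcover i j w ->
     ((w i < w j)%N \/ qint q i j = qint q' i j) /\ S' (pcomp w (tperm i j)))) ->
  agree S S' (hop q i j) (hop q' i j) /\ agree S S' (hop q j i) (hop q' j i).
Proof.
move=> ij h.
have hb w : S w -> bv w *m bracket q i j = bv w *m bracket q' i j /\
    supp S' (bv w *m bracket q i j).
  case/h => _ hq; rewrite !bv_bracket // /bcoef.
  case: (boolP (qcover i j w)) hq => [_ /(_ isT)[e St]|_ _]; last first.
    by rewrite !scale0r; split=> //; apply: supp0.
  split; last by apply: suppZ; apply: supp_bv.
  by congr (_ *: _); case: ifP => // wij; case: e => //; rewrite wij.
split; apply: agree_bv => w Sw; have [e1 s1] := hb w Sw; have [s2 _] := h w Sw.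
  rewrite /hop !mulmxDr e1 rv_mul1; split=> //.
  by apply: suppD; [apply: supp_bv|rewrite -e1].
rewrite !(@hop_rev _ _ _ i j) ?ltn_neq // !mulmxBr e1 rv_mul1; split=> //.
rewrite -scaleN1r; apply: suppD; first exact: supp_bv.
by apply: suppZ; rewrite -e1.
Qed.

End Support.

Section NoQuantumStep.
Variables (R : comUnitRingType) (n : nat).
Implicit Types (w : 'S_n) (I : {set 'I_n}) (q : nat -> R).
Local Notation op := 'M[R]_#|{: 'S_n}|.

Definition fixes_from (k : nat) w := forall x : 'I_n, (k <= x)%N -> w x = x.

Lemma fixes_from_le k w (x : 'I_n) : fixes_from k w -> (x < k)%N -> (w x < k)%N.
Proof.
move=> wk xk; rewrite ltnNge; apply/negP => h.
by have /perm_inj e := wk _ h; rewrite e leqNgt xk in h.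
Qed.

(** Each step exchanges c in I with an earlier b outside I and ascends, so values at I only decrease
    and values outside I only increase. *)
Lemma Lop_identity q q' I (c : 'I_n) : c \in I ->
  let St m w := [/\ fixes_from m w, (forall i, i \in I -> w i <= i)%N &
                  (forall j, j \notin I -> j <= w j)%N] in
  agree (St c) (St c.+1) (Lop q (fun b => b \notin I) c) (Lop q' (fun b => b \notin I) c).
Proof.
move=> cI St.
(* T follows the value c, the largest one on the positions up to c. It starts at c and, once moved,
   sits at a position between the current b and c, where the cyclic condition then forces w b < w
   c. *)
pose T m w := St c.+1 w /\ (w c = c \/ exists2 y : 'I_n, (m <= y < c)%N & w y = c).
suff h : agree (T n) (T 0%N) (Lop q (fun b => b \notin I) c) (Lop q' (fun b => b \notin I) c).
  move=> v Sv; have [|-> s] := h v.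
    move=> w /Sv[h1 h2 h3]; split; last by left; apply: h1.
    by split=> // x cx; apply: h1; apply: ltnW.
  by split=> // w /s[].
apply: agree_dprod => [b /andP[bI bc]|b w _ [Sw [wc|[y yc wy]]]]; last 2 first.
- by split=> //; left.
- by split=> //; right; exists y => //; lia.
have nbc := ltn_neq bc.
apply: (proj1 (agree_hop bc _)) => w [[w1 w2 w3] wc]; split.
  split=> //; case: wc => [|[y yc wy]]; [by left|by right; exists y => //; lia].
move/qcoverP => qc.
have wbc : (w b < w c)%N.
  have wb : (w b <= c)%N by rewrite -ltnS; apply: (fixes_from_le w1); lia.
  have := perm_val_inj w b c; case: wc => [wc|[y yc wy]].
    by rewrite wc; move: wb bc; clear; lia.
  have yb : (b < y < c)%N by lia.
  by have := qc y yb; rewrite wy /cyc; lia.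
split; first by left.
have wo x : x != b -> x != c -> pcomp w (tperm b c) x = w x.
  by move=> xb xc; rewrite pcompE tperm_other.
have wb' : pcomp w (tperm b c) b = w c by rewrite pcompE tpermL.
have wc' : pcomp w (tperm b c) c = w b by rewrite pcompE tpermR.
split; first split.
- move=> x cx; rewrite wo; [exact: w1| |]; rewrite -val_eqE /=; lia.
- move=> x xI; have [->|xc] := eqVneq x c; first by rewrite wc'; have := w2 c cI; lia.
  by rewrite wo ?w2 //; apply: contraNneq bI => <-.
- move=> x xI; have [->|xb] := eqVneq x b; first by rewrite wb'; have := w3 b bI; lia.
  by rewrite wo ?w3 //; apply: contraNneq xI => ->.
right; case: wc => [wc|[y yc wy]]; first by exists b; rewrite ?leqnn ?wb'.
exists y; first by lia.
by rewrite wo //; rewrite -val_eqE /=; lia.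
Qed.

(** While w i < w j holds for i in I before j outside I, only ascending steps are possible; the
    cover condition keeps this order for the pairs that are still needed. *)
Lemma Rop_identity q q' I (a : 'I_n) : a \in I ->
  let St m w := forall i j, i \in I -> j \notin I -> (m <= i < j)%N -> (w i < w j)%N in
  agree (St a) (St a.+1) (Rop' q (fun b => b \notin I) a) (Rop' q' (fun b => b \notin I) a).
Proof.
move=> aI St.
(* Inside the factor of a the indices b decrease, so the order of w a and w j is needed only for j
   below the bound m. *)
pose T m w := (forall j : 'I_n, j \notin I -> (a < j < m)%N -> (w a < w j)%N) /\ St a.+1 w.
suff h : agree (T n) (T 0%N) (Rop' q (fun b => b \notin I) a) (Rop' q' (fun b => b \notin I) a).
  move=> v Sv; have [|-> s] := h v.
    move=> w /Sv Sw; split=> [j jI /andP[aj _]|i j iI jI /andP[ai ij]].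
      by apply: Sw => //; rewrite leqnn.
    by apply: Sw => //; rewrite ij ltnW.
  by split=> // w /s[].
apply: agree_dprod => [b /andP[bI ab]|b w _ [w1 w2]]; last first.
  by split=> // j jI /andP[aj jb]; apply: w1; rewrite // aj ltnW.
have nab := ltn_neq ab.
apply: (proj2 (agree_hop ab _)) => w [w1 w2]; split.
  by split=> // j jI /andP[aj jb]; apply: w1; rewrite // aj ltnW.
move/qcoverP => qc; have wab : (w a < w b)%N by apply: w1; rewrite // ab ltnSn.
split; first by left.
have wo x : x != a -> x != b -> pcomp w (tperm a b) x = w x.
  by move=> xb xc; rewrite pcompE tperm_other.
have wa' : pcomp w (tperm a b) a = w b by rewrite pcompE tpermL.
have wb' : pcomp w (tperm a b) b = w a by rewrite pcompE tpermR.
split=> [j jI /andP[aj jb]|i j iI jI /andP[ai ij]].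
  have ja : j != a by rewrite -val_eqE /=; lia.
  have njb : j != b by rewrite -val_eqE /=; lia.
  rewrite wa' wo //; have : (w a < w j)%N by apply: w1 => //; lia.
  by have := qc j; rewrite aj jb => /(_ isT); rewrite /cyc; lia.
have ia : i != a by rewrite -val_eqE /=; lia.
have ib : i != b by apply: contraNneq bI => <-.
rewrite (wo i) //; have [jb|jb] := eqVneq j b; last first.
  by rewrite wo ?w2 ?ai //; apply: contraNneq jI => ->.
rewrite jb wb'; have : (w i < w b)%N by apply: w2; rewrite // -?jb ?ai.
by have := qc i; rewrite ai -jb ij => /(_ isT); rewrite /cyc jb; lia.
Qed.

Lemma FI_identity q q' I : bv R (1%g : 'S_n) *m FI q I = bv R (1%g : 'S_n) *m FI q' I.
Proof.
pose St m w := [/\ fixes_from m w, (forall i, i \in I -> w i <= i)%N &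
                  (forall j, j \notin I -> j <= w j)%N].
pose St' m w := forall i j, i \in I -> j \notin I -> (m <= i < j)%N -> (w i < w j)%N.
have h1 : agree (St 0%N) (St n) (\prod_(c in I) Lop q (fun b => b \notin I) c)
    (\prod_(c in I) Lop q' (fun b => b \notin I) c).
  apply: agree_prod => [a|a w _ [w1 w2 w3]]; first exact: Lop_identity.
  by split=> // x ax; apply: w1; apply: ltnW.
have h2 : agree (St' 0%N) (St' n) (\prod_(c in I) Rop' q (fun b => b \notin I) c)
    (\prod_(c in I) Rop' q' (fun b => b \notin I) c).
  apply: agree_prod => [a|a w _ w1]; first exact: Rop_identity.
  by move=> i j iI jI /andP[ai ij]; apply: w1; rewrite // ij ltnW.
(* The two invariants fit together: w i <= i < j <= w j. *)
have h : agree (St n) (St' 0%N) (1 : op) 1.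
  apply: agree1 => w [w1 w2 w3] i j iI jI /andP[_ ij].
  by have := w2 i iI; have := w3 j jI; lia.
have s0 : supp (St 0%N) (bv R (1%g : 'S_n)).
  by apply: supp_bv; split=> x; rewrite perm1.
by have [+ _] := agree_mul h1 (agree_mul h h2) s0; rewrite !mul1r.
Qed.

(** On S_k the steps that stay below position k involve only the parameters on which q and q' agree.
    The steps of the right halves that reach position k are ascending, and none goes beyond. *)
Lemma FI_agree q q' I (k : 'I_n) : (forall m, (m.+1 < k)%N -> q m = q' m) ->
  (forall i, i \in I -> i < k)%N ->
  agree (fixes_from k) (fixes_from k.+1) (FI q I) (FI q' I).
Proof.
move=> qq Ik.
have qint_eq (i j : 'I_n) : (j < k)%N -> qint q i j = qint q' i j.
  move=> jk; apply: eq_big_nat => m /andP[_ mj]; apply: qq; lia.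
have pfix (i j : 'I_n) m w : (i < m)%N -> (j < m)%N -> fixes_from m w ->
    fixes_from m (pcomp w (tperm i j)).
  move=> im jm wm x mx; rewrite pcompE tperm_other ?wm // -val_eqE /=; lia.
apply: (agree_mul (S' := fixes_from k)).
  apply: (agree_prod (St := fun=> fixes_from k)) => // c /Ik ck.
  apply: (agree_dprod (St := fun=> fixes_from k)) => // b /andP[_ bc].
  apply: (proj1 (agree_hop bc _)) => w wk; split=> // _; split.
    by right; apply: qint_eq.
  by apply: pfix => //; lia.
pose C m w := fixes_from k.+1 w /\ (forall a, a \in I -> m <= a -> w a < w k)%N.
suff h : agree (C 0%N) (C n) (\prod_(a in I) Rop' q (fun b => b \notin I) a)
     (\prod_(a in I) Rop' q' (fun b => b \notin I) a).
  move=> v Sv; have [|-> s] := h v; last by split=> // w /s[].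
  move=> w /Sv wk; split=> [x kx|a aI _]; first by apply: wk; apply: ltnW.
  by rewrite (wk k) //; apply: fixes_from_le => //; apply: Ik.
apply: agree_prod => [a aI|a w _ [w1 w2]]; last first.
  by split=> // b bI ab; apply: w2 => //; apply: ltnW.
have ak := Ik a aI; have nak := ltn_neq ak.
(* The condition w a < w k is needed only until b = k has been treated: there it forces an ascent,
   and afterwards only smaller b occur. *)
pose T m w := C a.+1 w /\ ((k < m)%N -> (w a < w k)%N).
suff h : agree (T n) (T 0%N) (Rop' q (fun b => b \notin I) a) (Rop' q' (fun b => b \notin I) a).
  move=> v Sv; have [|-> s] := h v; last by split=> // w /s[].
  move=> w /Sv[w1 w2]; split=> [|_]; last exact: w2.
  by split=> // b bI ab; apply: w2 => //; apply: ltnW.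
apply: agree_dprod => [b /andP[bI ab]|b w _ [w1 w2]]; last first.
  by split=> // kb; apply: w2; lia.
have nab := ltn_neq ab.
apply: (proj2 (agree_hop ab _)) => w [[w1 w2] w3]; split.
  by split=> // kb; apply: w3; lia.
move/qcoverP => qc.
have wo x : x != a -> x != b -> pcomp w (tperm a b) x = w x.
  by move=> xb xc; rewrite pcompE tperm_other.
have wa' : pcomp w (tperm a b) a = w b by rewrite pcompE tpermL.
have wb' : pcomp w (tperm a b) b = w a by rewrite pcompE tpermR.
case: (ltngtP b k) => [bk|kb|/val_inj bk].
- split; first by right; apply: qint_eq.
  split; last by lia.
  split; first by apply: pfix => //; lia.
  move=> i iI ai; have ia : i != a by rewrite -val_eqE /=; lia.
  have ib : i != b by apply: contraNneq bI => <-.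
  rewrite (wo i) // wo ?w2 //; first by rewrite eq_sym.
  by rewrite -val_eqE /=; lia.
(* A step to b > k is no cover: position k lies in between, and w a < w k < b = w b. *)
- have wak : (w a < w k)%N by apply: w3; apply: leqW.
  have wkk : (w k < k.+1)%N by apply: fixes_from_le.
  have := qc k; rewrite ak kb (w1 b) // => /(_ isT); rewrite /cyc; lia.
rewrite bk in wa' wb' wo qc *.
have wak : (w a < w k)%N by apply: w3; rewrite bk.
split; first by left.
split; last by rewrite ltnn.
split; first by apply: pfix => //; apply: leqW.
move=> i iI ai; have ik := Ik i iI.
have ia : i != a by rewrite -val_eqE /=; lia.
rewrite (wo i ia) ?wb'; last by apply: ltn_neq.
have := w2 i iI ai; have := qc i; rewrite ai ik => /(_ isT); rewrite /cyc; lia.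
Qed.

End NoQuantumStep.

(** * The classical case q = 0 and isobaric divided differences *)

Section Classical.
Variables (R : comUnitRingType) (n : nat).
Implicit Types (w : 'S_n) (a b k : 'I_n).
Local Notation op := 'M[R]_#|{: 'S_n}|.
Local Notation bv := (@bv R n).
Local Notation z := (fun _ : nat => 0 : R).

Lemma z_unit : forall i : nat, 1 - z i \is a GRing.unit.
Proof. by move=> i; rewrite subr0 unitr1. Qed.

Lemma bcoef0 a b w : (a < b)%N ->
  bcoef z a b w = (qcover a b w && (w a < w b)%N)%:R.
Proof.
move=> ab; rewrite /bcoef; case: qcover => //=; case: ifP => // _.
by rewrite /qint big_ltn // mul0r.
Qed.

Lemma hop_inv0 a b : (a < b)%N -> invmx (hop z a b) = hop z b a.
Proof.
move=> ab; rewrite (hop_invE z_unit) // /hscale.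
by case: eqP => _; rewrite ?subr0 ?invr1 scale1r.
Qed.

Definition opof (f : 'S_n -> 'rV[R]_#|{: 'S_n}|) : op := \matrix_a f (enum_val a).

Lemma bv_opof f w : bv w *m opof f = f w.
Proof. by rewrite -rowE rowK enum_rankK. Qed.

Lemma ordSE (i : 'I_n) : (i.+1 < n)%N -> ordS i = i.+1 :> nat.
Proof. by move=> hi; rewrite /= modn_small. Qed.

Section Simple.
Variables (i i' : 'I_n) (e' : i' = i.+1 :> nat).
Local Notation s := (tperm i i').

Let ii : (i < i')%N. Proof. by rewrite e'. Qed.
Let nii : i != i'. Proof. exact: ltn_neq. Qed.

(** At q = 0 the bracket [i, i'] is the ascending half of right multiplication by s_i; this is the
    descending half. *)
Definition dd : op := opof (fun w =>
  if (w i' < w i)%N then bv (pcomp w s) else 0).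

Let si : s i = i'. Proof. by rewrite tpermL. Qed.
Let si' : s i' = i. Proof. by rewrite tpermR. Qed.
Let so x : x != i -> x != i' -> s x = x.
Proof. by move=> h1 h2; rewrite tperm_other. Qed.
Let sK x : s (s x) = x. Proof. by rewrite tpermK. Qed.

Lemma simple_refl_ltn a b : (a < b)%N -> (a, b) != (i, i') -> (s a < s b)%N.
Proof.
move=> ab nab; have [ai|ai] := eqVneq a i.
  have bi' : b != i' by move: nab; rewrite ai xpair_eqE eqxx.
  have bi : b != i by rewrite -val_eqE /=; move: ab; rewrite ai; lia.
  rewrite ai si (so bi bi'); move: ab bi'; rewrite ai -val_eqE /=; lia.
have [ai'|ai'] := eqVneq a i'.
  have bi' : b != i' by rewrite -val_eqE /= -ai'; lia.
  have bi : b != i by rewrite -val_eqE /=; move: ab; rewrite ai'; lia.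
  by rewrite ai' si' so //; move: ab; rewrite ai'; lia.
rewrite (so ai ai'); have [bi|bi] := eqVneq b i; first by rewrite bi si; move: ab; rewrite bi; lia.
have [bi'|bi'] := eqVneq b i'; last by rewrite so.
by rewrite bi' si'; move: ab ai; rewrite bi' -val_eqE /=; lia.
Qed.

(** No position lies between i and i'. Hence, if a or b is one of them, splitting the interval at
    the other one isolates a single cyclic condition, and the claim reduces to the relative order of
    three values. *)
Let cover_dd w a b : (a < b)%N -> (a, b) != (i, i') ->
  [&& qcover a b w, (w a < w b)%N & (pcomp w (tperm a b) i' < pcomp w (tperm a b) i)%N] =
  [&& (w i' < w i)%N, qcover (s a) (s b) (pcomp w s) & (w a < w b)%N].
Proof.
move=> ab nab.
have wE (x y : 'I_n) : (x < y)%N -> w x <> w y :> nat.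
  by move=> xy /eqP; rewrite perm_val_inj; lia.
have on0 x y v : qcover_on i i' x y v by apply/qcover_onP => c; lia.
have wii := wE _ _ ii; have wab := wE _ _ ab.
have ni'i : i' != i by rewrite eq_sym.
have [ai|ai] := eqVneq a i.
  have bi' : b != i' by move: nab; rewrite ai xpair_eqE eqxx.
  have bi : b != i by rewrite -val_eqE /=; move: ab; rewrite ai; lia.
  have ib : (i < i' < b)%N by rewrite ii; move: ab bi'; rewrite ai -val_eqE /=; lia.
  have i'b : (i' < b)%N by case/andP: ib.
  have wib := wE _ _ i'b.
  rewrite ai in wab *; rewrite si (so bi bi') !pcompE tpermL (tperm_other ni'i); last by rewrite eq_sym.
  rewrite !qcover_on_val (qcover_on_split _ _ _ ib) on0 /=.
  rewrite qcover_on_pcomp => [|c cb]; last by apply: so; rewrite -val_eqE /=; lia.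
  rewrite !pcompE si' (so bi bi'); case: (qcover_on i' b) => /=; last by rewrite andbF.
  by rewrite /cyc; clear -wii wab wib; lia.
have [ai'|ai'] := eqVneq a i'.
  have bi' : b != i' by rewrite eq_sym -ai' ltn_neq.
  have bi : b != i by rewrite eq_sym ltn_neq // (ltn_trans ii) // -ai'.
  have ib : (i < i' < b)%N by rewrite ii -ai'.
  have i_b : (i < b)%N by case/andP: ib => h; apply: ltn_trans.
  have wib := wE _ _ i_b.
  rewrite ai' in wab *; rewrite si' (so bi bi') !pcompE tpermL (tperm_other nii); last by rewrite eq_sym.
  rewrite !qcover_on_val (qcover_on_split _ _ _ ib) on0 /=.
  rewrite qcover_on_pcomp => [|c cb]; last by apply: so; rewrite -val_eqE /=; lia.
  rewrite !pcompE si si' (so bi bi'); case: (qcover_on i' b) => /=; last by rewrite andbF.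
  by rewrite /cyc; clear -wii wab wib; lia.
have [bi|bi] := eqVneq b i.
  have aii : (a < i < i')%N by rewrite ii -bi ab.
  have a_i' : (a < i')%N by case/andP: aii => h; apply: ltn_trans.
  have wai := wE _ _ a_i'.
  rewrite bi in wab *; rewrite si (so ai ai') !pcompE tpermR tperm_other //; last by rewrite eq_sym.
  rewrite !qcover_on_val (qcover_on_split _ _ _ aii) on0 /=.
  rewrite qcover_on_pcomp => [|c cb]; last by apply: so; rewrite -val_eqE /=; lia.
  rewrite !pcompE si si' (so ai ai'); case: (qcover_on a i) => /=; last by rewrite andbF.
  by rewrite /cyc; clear -wii wab wai; lia.
have [bi'|bi'] := eqVneq b i'.
  have a_i : (a < i)%N.
    by move: ab ai; rewrite bi' -val_eqE /=; lia.
  have aii : (a < i < i')%N by rewrite a_i ii.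
  have wai := wE _ _ a_i.
  rewrite bi' in wab *; rewrite si' (so ai ai') !pcompE tpermR tperm_other //; last by rewrite eq_sym.
  rewrite !qcover_on_val (qcover_on_split _ _ _ aii) on0 /=.
  rewrite qcover_on_pcomp => [|c cb]; last by apply: so; rewrite -val_eqE /=; lia.
  rewrite !pcompE si (so ai ai'); case: (qcover_on a i) => /=; last by rewrite andbF.
  by rewrite /cyc; clear -wii wab wai; lia.
rewrite (so ai ai') (so bi bi') !pcompE.
rewrite (tperm_other (i := a) (j := b) (s := i')) 1?eq_sym //.
rewrite (tperm_other (i := a) (j := b) (s := i)) 1?eq_sym //.
have -> : qcover a b (pcomp w s) = qcover a b w.
  have sr c : ((a < s c < b) = (a < c < b))%N.
    have [->|ci] := eqVneq c i; first by rewrite si; move: ai ai' bi bi'; rewrite -!val_eqE /=; lia.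
    have [->|ci'] := eqVneq c i'; first by rewrite si'; move: ai ai' bi bi'; rewrite -!val_eqE /=; lia.
    by rewrite so.
  apply/qcoverP/qcoverP => h c cb.
    by have := h (s c); rewrite sr !pcompE sK (so ai ai') (so bi bi'); apply.
  by rewrite !pcompE (so ai ai') (so bi bi'); apply: h; rewrite sr.
by case: (_ < _)%N; rewrite ?andbF ?andbT //= andbC.
Qed.

Lemma bracket_dd a b : (a < b)%N -> (a, b) != (i, i') ->
  bracket z a b * dd = dd * bracket z (s a) (s b).
Proof.
move=> ab nab; have sab := simple_refl_ltn ab nab.
have if_scale (c : bool) (v : 'rV[R]_#|{: 'S_n}|) : (if c then v else 0) = c%:R *: v.
  by case: c; rewrite ?scale1r ?scale0r.
apply: mx_bv_ext => w; rewrite !rv_mulM bv_bracket // -scalemxAl !bv_opof !if_scale.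
rewrite -scalemxAl bv_bracket // !scalerA !bcoef0 // -!natrM !mulnb.
have -> : pcomp (pcomp w (tperm a b)) s = pcomp (pcomp w s) (tperm (s a) (s b)).
  by apply/permP => x; rewrite !pcompE (inj_tperm _ _ _ (@perm_inj _ s)) !sK.
have := cover_dd w ab nab; rewrite (pcompE w s) (pcompE w s (s b)) !sK -andbA => ->.
by rewrite andbA.
Qed.

Lemma hop_dd a b : a != b -> (a, b) != (i, i') -> (a, b) != (i', i) ->
  hop z a b * dd = dd * hop z (s a) (s b).
Proof.
have H (c d : 'I_n) : (c < d)%N -> (c, d) != (i, i') ->
    hop z c d * dd = dd * hop z (s c) (s d) /\ hop z d c * dd = dd * hop z (s d) (s c).
  move=> cd ncd; have e := bracket_dd cd ncd; have scd := simple_refl_ltn cd ncd.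
  rewrite (@hop_rev _ _ _ c d) ?ltn_neq // (@hop_rev _ _ _ (s c) (s d)) ?ltn_neq //.
  by rewrite /hop !mulrDl !mulrDr mulrN mulNr !mul1r !mulr1 e.
move=> nab n1 n2; case: (ltngtP a b) => [ab|ba|/val_inj e].
- by have [] := H _ _ ab n1.
- by have [|] := H _ _ ba => //; rewrite xpair_eqE andbC -xpair_eqE.
by rewrite e eqxx in nab.
Qed.

Local Notation u := (bracket z i i').

Lemma dd_leibniz : u * dd + dd * u = 1.
Proof.
apply: mx_bv_ext => w; rewrite rv_mul1 mulmxDr !rv_mulM bv_bracket // -scalemxAl !bv_opof.
have q0 v : qcover i i' v by apply/qcoverP => c; lia.
rewrite bcoef0 // q0 /= !pcompE si si'.
have wii : w i <> w i' :> nat by move/eqP; rewrite perm_val_inj; lia.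
case: (ltngtP (w i) (w i')) wii => // h _.
  by rewrite scale1r mul0mx addr0 pcomp_tpermK.
by rewrite scale0r add0r bv_bracket // bcoef0 // q0 !pcompE si si' h scale1r pcomp_tpermK.
Qed.

Lemma u_sqr : u * u = 0.
Proof. by rewrite bracket_sqr // if_same scale0r. Qed.

(** It sends w to whichever of w and w s_i ascends at i ([bv_hecke]); on values at 1 it represents
    the isobaric operator ([bv1_isobaric]). *)
Definition hecke : op := hop z i i' * dd.
Local Notation h := (hop z i i').
Local Notation D := hecke.

Lemma hopu : h * (1 - u) = 1.
Proof. by rewrite /hop mulrBr mulr1 mulrDl mul1r u_sqr addr0 addrK. Qed.

Lemma dd_hop : dd * h = (1 - u) * dd + 1.
Proof. by rewrite /hop mulrDr mulr1 mulrBl mul1r -dd_leibniz addrA subrK. Qed.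

Lemma dd_hopV : dd * (1 - u) = D - 1.
Proof.
by rewrite /hecke /hop mulrBr mulr1 mulrDl mul1r -dd_leibniz opprD addrA addrK.
Qed.

End Simple.
End Classical.

(** * Exchange relations between Theta_k and the Hecke operators *)

Section HeckeRelations.
Variables (R : comUnitRingType) (n : nat).
Implicit Types (w : 'S_n) (a b k : 'I_n).
Local Notation op := 'M[R]_#|{: 'S_n}|.
Local Notation bv := (@bv R n).
Local Notation z := (fun _ : nat => 0 : R).
Variables (i i' : 'I_n) (e' : i' = i.+1 :> nat).
Local Notation s := (tperm i i').
Local Notation T := (@Theta R n z).
Local Notation D := (hecke R i i').
Local Notation d := (dd R i i').
Local Notation h := (hop z i i').
Local Notation u := (bracket z i i').
Local Notation H := (@hop R n z).

Let ii : (i < i')%N. Proof. by rewrite e'. Qed.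
Let nii : i != i'. Proof. exact: ltn_neq. Qed.
Let zu := @z_unit R.

Let hV : invmx h = 1 - u.
Proof. by rewrite hop_inv0 // hop_rev. Qed.

Let hopd a b : a != b -> (a, b) != (i, i') -> (a, b) != (i', i) ->
  H a b * d = d * H (s a) (s b).
Proof. exact: hop_dd. Qed.

(** Theta_i without its factor for the pair (i, i'). Exchanging i and i' gives [sY], which is
    Theta_i' without that pair, and [dd] intertwines the two. *)
Let Y : op := Lop z predT i * dprod (fun b => (i' < b)%N) (fun b => H b i).
Let sY : op := dprod (fun b => (b < i)%N) (H ^~ i') * Rop z predT i'.

Let ThetaY : T i = Y * (1 - u).
Proof.
rewrite /Theta /Rop (dprod_split i') /= ii /= [X in _ * (_ * X)]dprod_pred0; last by move=> b; lia.
rewrite mulr1 hV mulrA; congr (_ * _ * _); apply: eq_dprod => [b|b i'b]; first by lia.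
by rewrite hop_inv0 //; lia.
Qed.

Let ThetasY : T i' = h * sY.
Proof.
rewrite /Theta /Lop (dprod_split i) /= ii /= [X in X * _ * _]dprod_pred0; last by move=> b; lia.
rewrite mul1r /sY -!mulrA; congr (_ * (_ * _)); apply: eq_dprodl => b; lia.
Qed.

Let sL a : (a < i)%N -> s a = a.
Proof. by move=> ai; apply: tperm_other; rewrite -val_eqE /=; lia. Qed.

Let sR a : (i' < a)%N -> s a = a.
Proof. by move=> ai; apply: tperm_other; rewrite -val_eqE /=; lia. Qed.

Let RopE a : Rop z predT a = dprod (fun b => (a < b)%N) (fun b => H b a).
Proof. by apply: eq_dprod => // b /= ab; rewrite hop_inv0. Qed.

Let npair (a b c d : 'I_n) : (a != c) || (b != d) -> (a, b) != (c, d).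
Proof. by rewrite xpair_eqE negb_and. Qed.

Let Yd : Y * d = d * sY.
Proof.
rewrite /Y /sY RopE /Lop -mulrA (@dprod_intertwine _ _ _ _ (fun b => H b i') d) => [|b ib].
  rewrite !mulrA; congr (_ * _); apply: (dprod_intertwine (P := fun b => (b < i)%N)) => b bi.
  rewrite hopd ?tpermL ?sL //; first exact: ltn_neq.
    by apply: npair; rewrite ltn_neq.
  by apply: npair; rewrite ltn_neq //; lia.
rewrite hopd ?tpermL ?sR //; first by rewrite -val_eqE /=; lia.
  by apply: npair; rewrite -!val_eqE /=; lia.
by apply: npair; rewrite -!val_eqE /=; lia.
Qed.

Let sYd : sY * d = d * Y.
Proof.
rewrite /Y /sY RopE /Lop -mulrA (@dprod_intertwine _ _ _ _ (fun b => H b i) d) => [|b ib].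
  rewrite !mulrA; congr (_ * _); apply: (dprod_intertwine (P := fun b => (b < i)%N)) => b bi.
  rewrite hopd ?tpermR ?sL //; first by rewrite -val_eqE /=; lia.
    by apply: npair; rewrite -!val_eqE /=; lia.
  by apply: npair; rewrite -!val_eqE /=; lia.
rewrite hopd ?tpermR ?sR //; first by rewrite -val_eqE /=; lia.
  by apply: npair; rewrite -!val_eqE /=; lia.
by apply: npair; rewrite -!val_eqE /=; lia.
Qed.

Let hdh : h * d * h = d + h.
Proof.
have hu := @hopu R n i i' e'.
by rewrite -mulrA (@dd_hop R n i i' e') mulrDr mulr1 mulrA hu mul1r.
Qed.

Lemma Theta_hecke_i : T i * D = D * T i' - T i'.
Proof.
move: ThetaY ThetasY Yd; move: (Y) (sY) => Y0 sY0 -> -> Yd0; rewrite /hecke.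
have uh : (1 - u) * h = 1 by rewrite -hV Vhop.
by rewrite !mulrA hdh mulrDl addrK -[Y0 * _ * _]mulrA uh mulr1 Yd0.
Qed.

Lemma Theta_hecke_i' : T i' * D = D * T i + T i'.
Proof.
move: ThetaY ThetasY sYd; move: (Y) (sY) => Y0 sY0 -> -> sYd0; rewrite {2}/hecke.
rewrite !mulrA -[_ * d * Y0]mulrA -sYd0.
rewrite -!mulrA (@dd_hopV R n i i' e') !mulrA mulrBr mulr1 subrK.
by rewrite -!mulrA.
Qed.

(** Only the two factors joining k to i and i' matter. The Yang-Baxter equation moves [h] across
    them and reverses their order, and [dd], which exchanges i and i', reverses it back. *)
Lemma Theta_hecke_other k : k != i -> k != i' -> T k * D = D * T k.
Proof.
move=> ki ki'.
have c a b : uniq [:: a; b; i; i'] -> GRing.comm (H a b) D.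
  move=> uq; apply: commrM.
    by apply: hop_comm => //; move: uq; rewrite /= !inE !negb_or; case/and4P => /and3P[].
  move: uq; rewrite /= !inE !negb_or andbT => /and3P[/and3P[ab ai ai'] /andP[bi bi'] _].
  rewrite /GRing.comm hopd //; try by apply: npair; rewrite ?ai ?ai'.
  by rewrite !tperm_other.
have cR a b : (a < b)%N -> uniq [:: a; b; i; i'] -> GRing.comm (invmx (H a b)) D.
  by move=> ab uq; apply: hopV_comm => //; exact: c.
have cLop (P : pred 'I_n) : (forall b, P b -> b != i /\ b != i') ->
    GRing.comm (dprod (fun b => P b && (b < k)%N) (H ^~ k)) D.
  move=> hP; apply/commr_sym/comm_dprod => b /andP[/hP[bi bi'] bk].
  apply/commr_sym/c; rewrite /= !inE !negb_or bi bi' ki ki' nii !andbT.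
  exact: ltn_neq.
have cRop (P : pred 'I_n) : (forall b, P b -> b != i /\ b != i') ->
    GRing.comm (dprod (fun b => P b && (k < b)%N) (fun b => invmx (H k b))) D.
  move=> hP; apply/commr_sym/comm_dprod => b /andP[/hP[bi bi'] kb].
  apply: commr_sym; apply: cR => //; rewrite /= !inE !negb_or bi bi' ki ki' nii !andbT.
  exact: ltn_neq.
rewrite -/(GRing.comm _ _) /Theta.
have [ik|ki0] := ltnP i' k.
- have i_k : (i < k)%N by apply: ltn_trans ik.
  apply/commr_sym/commrM; apply/commr_sym; last first.
    rewrite /Rop (@eq_dprodl _ _ _ (fun b => (i' < b)%N && (k < b)%N)); last by move=> b /=; lia.
    by apply: cRop => b ib; rewrite -!val_eqE /=; lia.
  rewrite /Lop (dprod_split i') ik /= [X in _ * X](dprod_split i) i_k ii /=.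
  rewrite (@eq_dprodl _ _ _ (fun b => (i' < b)%N && (b < k)%N)); last by move=> b /=; lia.
  rewrite [X in _ * _ * (X * _ * _)]dprod_pred0; last by move=> b /=; lia.
  rewrite [X in _ * _ * (_ * X)](@eq_dprodl _ _ _ (fun b => (b < i)%N && (b < k)%N)); last first.
    by move=> b /=; lia.
  rewrite mul1r !mulrA -[_ * H i' k * H i k]mulrA.
  apply/commr_sym/commrM; last first.
    by apply/commr_sym/cLop => b bi; rewrite -!val_eqE /=; lia.
  apply: commrM; apply/commr_sym.
    by apply: cLop => b bi; rewrite -!val_eqE /=; lia.
  have iik : (i < i' < k)%N by rewrite ii.
  have yb := yang_baxter z iik.
  rewrite /GRing.comm /hecke mulrA -yb -!mulrA; congr (_ * _).
  have e1 : H i' k * d = d * H i k.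
    by rewrite hopd ?tpermR ?sR // ?npair // -?val_eqE /=; lia.
  have e2 : H i k * d = d * H i' k.
    by rewrite hopd ?tpermL ?sR // ?npair // -?val_eqE /=; lia.
  rewrite e1 [LHS]mulrA. by rewrite e2 mulrA.
have k_i : (k < i)%N by move: ki ki'; rewrite -!val_eqE /=; lia.
have ki_ : (k < i')%N by apply: ltn_trans ii.
apply/commr_sym/commrM; apply/commr_sym.
  rewrite /Lop (@eq_dprodl _ _ _ (fun b => (b < k)%N && (b < k)%N)); last by move=> b /=; lia.
  by apply: cLop => b ib; rewrite -!val_eqE /=; lia.
rewrite /Rop (dprod_split i') ki_ /= [X in _ * X](dprod_split i) k_i ii /=.
rewrite (@eq_dprodl _ _ _ (fun b => (i' < b)%N && (k < b)%N)); last by move=> b /=; lia.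
rewrite [X in _ * _ * (X * _ * _)]dprod_pred0; last by move=> b /=; lia.
rewrite [X in _ * _ * (_ * X)](@eq_dprodl _ _ _ (fun b => (b < i)%N && (k < b)%N)); last first.
  by move=> b /=; lia.
rewrite mul1r !mulrA -[_ * invmx (H k i') * invmx (H k i)]mulrA.
apply/commr_sym/commrM; last first.
  by apply/commr_sym/cRop => b bi; rewrite -!val_eqE /=; lia.
apply: commrM; apply/commr_sym.
  by apply: cRop => b bi; rewrite -!val_eqE /=; lia.
have kii : (k < i < i')%N by rewrite k_i.
have yb := yang_baxterV zu kii.
rewrite /GRing.comm /hecke mulrA yb -!mulrA !hop_inv0 //; congr (_ * _).
have e1 : H i' k * d = d * H i k.
  by rewrite hopd ?tpermR ?sL // ?npair // -?val_eqE /=; lia.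
have e2 : H i k * d = d * H i' k.
  by rewrite hopd ?tpermL ?sL // ?npair // -?val_eqE /=; lia.
rewrite e1 [LHS]mulrA. by rewrite e2 mulrA.
Qed.

End HeckeRelations.

Section TwistedDerivations.

(** In this section s1, s2 stand for the images of f1, f2 under s_i, d1, d2 for their divided
    differences in the commutative lemmas, and y for 1 - x_i. *)
Lemma twisted_derivationM (A : comPzRingType) (x d1 d2 f1 f2 s1 s2 : A) :
  x * d1 = f1 - s1 -> x * d2 = f2 - s2 -> x * (d1 * s2 + f1 * d2) = f1 * f2 - s1 * s2.
Proof. by move=> h1 h2; rewrite mulrDr mulrA h1 mulrCA h2; ring. Qed.

Lemma twisted_derivationD (A : comPzRingType) (x d1 d2 f1 f2 s1 s2 : A) :
  x * d1 = f1 - s1 -> x * d2 = f2 - s2 -> x * (d1 + d2) = f1 + f2 - (s1 + s2).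
Proof. by move=> h1 h2; rewrite mulrDr h1 h2; ring. Qed.

Lemma twisted_sumD (A : comPzRingType) (f1 f2 y d1 d2 s1 s2 : A) :
  (f1 + f2) + y * (d1 + d2) - (s1 + s2) = (f1 + y * d1 - s1) + (f2 + y * d2 - s2).
Proof. ring. Qed.

Lemma twisted_sumM (A : comPzRingType) (f1 f2 y d1 d2 s1 s2 : A) :
  f1 * f2 + y * (d1 * s2 + f1 * d2) - s1 * s2 =
  (f1 + y * d1 - s1) * s2 + f1 * (f2 + y * d2 - s2).
Proof. ring. Qed.

Lemma twisted_commD (A : pzRingType) (x1 x2 d a1 a2 b1 b2 : A) :
  x1 * d = d * a1 + b1 -> x2 * d = d * a2 + b2 ->
  (x1 + x2) * d = d * (a1 + a2) + (b1 + b2).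
Proof. by move=> h1 h2; rewrite mulrDl h1 h2 mulrDr addrACA. Qed.

Lemma twisted_commM (A : pzRingType) (x1 x2 d a1 a2 b1 b2 : A) :
  x1 * d = d * a1 + b1 -> x2 * d = d * a2 + b2 ->
  (x1 * x2) * d = d * (a1 * a2) + (b1 * a2 + x1 * b2).
Proof. by move=> h1 h2; rewrite -mulrA h2 mulrDr mulrA h1 mulrDl -mulrA addrA. Qed.

End TwistedDerivations.

(** * Isobaric divided differences as operators *)

Section IsobaricOperators.
Variables (R : comUnitRingType) (n : nat).
Implicit Types (w : 'S_n) (i k : 'I_n) (f g : {mpoly int[n]}).
Local Notation op := 'M[R]_#|{: 'S_n}|.
Local Notation bv := (@bv R n).
Local Notation z := (fun _ : nat => 0 : R).
Local Notation D i := (hecke R i (ordS i)).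

Definition subst0X f : op := subst_Xop z (map_mpoly intr f).
Local Notation sub := subst0X.

Lemma sub0D : {morph sub : f g / f + g}.
Proof. by move=> f g; rewrite /sub rmorphD substD. Qed.

Lemma sub0B : {morph sub : f g / f - g}.
Proof. by move=> f g; rewrite /sub rmorphB substB. Qed.

Lemma sub0M : {morph sub : f g / f * g}.
Proof. by move=> f g; rewrite /sub rmorphM /= substM //; apply: z_unit. Qed.

Lemma sub0_1 : sub 1 = 1.
Proof. by rewrite /sub rmorph1 subst1. Qed.

Lemma sub0_0 : sub 0 = 0.
Proof. by rewrite /sub rmorph0 subst0. Qed.

Lemma sub0X k : sub 'X_k = Xop z k.
Proof. by rewrite /sub map_mpolyX substX. Qed.

Lemma sub0_sum (J : Type) (r : seq J) (P : pred J) (F : J -> {mpoly int[n]}) :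
  sub (\sum_(j <- r | P j) F j) = \sum_(j <- r | P j) sub (F j).
Proof. by rewrite /sub rmorph_sum subst_sum. Qed.

Section OneReflection.
Variables (i : 'I_n) (hi : (i.+1 < n)%N).
Local Notation i' := (ordS i).
Local Notation s := (simple_refl i).

Let e' : i' = i.+1 :> nat. Proof. exact: ordSE. Qed.
Let ii : (i < i')%N. Proof. by rewrite e'. Qed.
Let nii : i != i'. Proof. exact: ltn_neq. Qed.

Lemma divdiffP f : ('X_i - 'X_i') * divdiff i f = f - msym s f.
Proof. by have /eqP := xchooseP (divdiff_subproof i f). Qed.

Let Xii : ('X_i - 'X_i' : {mpoly int[n]}) != 0.
Proof.
rewrite subr_eq0; apply/eqP => /(congr1 (mcoeff U_(i)))/eqP; rewrite !mcoeffX eqxx.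
have /negPf -> // : (U_(i') != U_(i) :> 'X_{1..n})%MM.
by apply/eqP => /mnmP/(_ i); rewrite !mnm1E eqxx eq_sym (negPf nii).
Qed.

Lemma divdiff_unique f g : ('X_i - 'X_i') * g = f - msym s f -> divdiff i f = g.
Proof. by move=> e; apply: (mulfI Xii); rewrite divdiffP e. Qed.

Lemma divdiffD : {morph divdiff i : f g / f + g}.
Proof.
move=> f g; apply: divdiff_unique; rewrite msymD.
exact: twisted_derivationD (divdiffP f) (divdiffP g).
Qed.

Lemma divdiffZ (c : int) f : divdiff i (c *: f) = c *: divdiff i f.
Proof.
by apply: divdiff_unique; rewrite -scalerAr divdiffP linearZ /= scalerBr.
Qed.

Lemma divdiffM f g : divdiff i (f * g) = divdiff i f * msym s g + f * divdiff i g.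
Proof.
apply: divdiff_unique; rewrite msymM.
exact: twisted_derivationM (divdiffP f) (divdiffP g).
Qed.

Lemma divdiff_sym f : msym s f = f -> divdiff i f = 0.
Proof. by move=> e; apply: divdiff_unique; rewrite e subrr mulr0. Qed.

Lemma isobaric_sym f : msym s f = f -> isobaric i f = f.
Proof. by move=> e; rewrite /isobaric divdiff_sym // mulr0 addr0. Qed.

Lemma msym_var (t : 'S_n) k : msym t 'X_k = 'X_(t k) :> {mpoly int[n]}.
Proof.
rewrite msymX; congr 'X_[_]; apply/mnmP => l.
by rewrite mnmE !mnm1E -(inj_eq (@perm_inj _ t)) permKV.
Qed.

(** Both corrections, the commutator with the Hecke operator and f -> pi_i f - s_i f, obey the same
    twisted Leibniz rule, so constants and variables suffice. *)
Lemma sub0_hecke f : sub f * D i = D i * sub (msym s f) + sub (isobaric i f - msym s f).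
Proof.
pose P f := sub f * D i = D i * sub (msym s f) + sub (isobaric i f - msym s f).
have PD f1 f2 : P f1 -> P f2 -> P (f1 + f2).
  move=> h1 h2; rewrite /P sub0D (twisted_commD h1 h2) msymD.
  rewrite (sub0D (msym s f1)) -(sub0D (isobaric i f1 - _)); congr (_ + sub _).
  by rewrite /isobaric divdiffD twisted_sumD.
have PM f1 f2 : P f1 -> P f2 -> P (f1 * f2).
  move=> h1 h2; rewrite /P sub0M (twisted_commM h1 h2) msymM.
  rewrite (sub0M (msym s f1)) -(sub0M (isobaric i f1 - _)) -(sub0M f1).
  rewrite -(sub0D ((isobaric i f1 - _) * _)); congr (_ + sub _).
  by rewrite /isobaric divdiffM twisted_sumM.
have PC (c : int) : P c%:MP.
  have sc : msym s c%:MP = c%:MP :> {mpoly int[n]}.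
    by rewrite -[c%:MP]mulr1 mul_mpolyC linearZ /= rmorph1.
  rewrite /P isobaric_sym // sc subrr sub0_0 addr0.
  rewrite /sub map_mpolyC substC.
  by rewrite -!mulmxE -scalemxAl -scalemxAr mulmx1 mul1mx.
(* The three cases are the three exchange relations, rewritten for X = 1 - Theta. *)
have PX k : P 'X_k.
  rewrite /P msym_var /isobaric; have [->|ki] := eqVneq k i.
    have -> : divdiff i 'X_i = 1.
      by apply: divdiff_unique; rewrite mulr1 msym_var tpermL.
    rewrite tpermL mulr1 [X in X - _]addrCA subrr addr0 sub0B sub0_1 !sub0X !XopE.
    by rewrite mulrBl mul1r Theta_hecke_i // opprB mulrBr mulr1 subKr addrA addrAC.
  have [->|ki'] := eqVneq k i'.
    have -> : divdiff i 'X_i' = -1.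
      by apply: divdiff_unique; rewrite mulrN1 opprB msym_var tpermR.
    rewrite tpermR mulrN1 opprB addrA [X in X - _]addrAC addrK sub0B sub0_1 !sub0X !XopE.
    rewrite mulrBl mul1r Theta_hecke_i' // mulrBr mulr1 opprD addrA.
    by rewrite [1 - _ - 1]addrAC subrr add0r.
  rewrite /simple_refl tperm_other // divdiff_sym ?mulr0 ?addr0 ?subrr; last first.
    by rewrite msym_var /simple_refl tperm_other.
  rewrite !sub0X sub0_0 addr0 !XopE.
  by rewrite mulrBl mulrBr mul1r mulr1 Theta_hecke_other.
rewrite -/(P f) [f]mpolyE; apply: (big_ind P) => [|g h|m _].
- exact: (PC 0).
- exact: PD.
rewrite -mul_mpolyC; apply: (PM) => //; rewrite mpolyXE_id.
apply: (big_ind P) => [|g h|k _]; [exact: PC|exact: PM|].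
by elim: (m k) => [|l IH]; [exact: PC|rewrite exprS; apply: PM].
Qed.

Lemma bv_hecke w : bv w *m D i = bv (if (w i < w i')%N then w else pcomp w s).
Proof.
have q0 v : qcover i i' v by apply/qcoverP => c; rewrite e'; lia.
rewrite /hecke rv_mulM /hop mulmxDr rv_mul1 bv_bracket // bcoef0 // q0 /=.
rewrite mulmxDl -scalemxAl !bv_opof !pcompE tpermL tpermR.
have wii : w i <> w i' :> nat by move/eqP; rewrite perm_val_inj; lia.
case: (ltngtP (w i) (w i')) wii => // h _.
  by rewrite add0r scale1r pcomp_tpermK.
by rewrite scale0r addr0.
Qed.

(** The identity ascends at i and is fixed by the Hecke operator, so the two terms with s_i f
    cancel. *)
Lemma bv1_isobaric f :
  bv 1%g *m sub (isobaric i f) = bv 1%g *m sub f *m D i.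
Proof.
rewrite -rv_mulM sub0_hecke mulmxDr rv_mulM bv_hecke !perm1 ii.
by rewrite sub0B mulmxBr addrC subrK.
Qed.

Lemma sub0_hecke_sym f : msym s f = f -> sub f * D i = D i * sub f.
Proof.
by move=> e; rewrite sub0_hecke isobaric_sym // e subrr sub0_0 addr0.
Qed.

End OneReflection.
End IsobaricOperators.

(** * Reduced words and the Grothendieck basis *)

Section ReducedWords.
Variable n : nat.
Implicit Types (w u v : 'S_n) (i x y : 'I_n) (a : seq 'I_n).
Local Notation sr := (@simple_refl n).

Definition valid_word a := all (fun i : 'I_n => i.+1 < n)%N a.
Definition word_perm a : 'S_n := foldr (fun i => pcomp (sr i)) 1%g a.

Lemma longestE x : longest n x = rev_ord x.
Proof. by rewrite permE. Qed.

Lemma plen_inv w : plen w^-1 = plen w.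
Proof.
pose f (p : 'I_n * 'I_n) := (w p.2, w p.1).
have fi : injective f by move=> [a b] [c d] [/perm_inj -> /perm_inj ->].
rewrite /plen -[RHS](card_imset _ fi); apply: eq_card => -[x y]; rewrite inE /=.
apply/idP/imsetP => [/andP[xy yx]|[[a b]]].
  by exists (w^-1 y, w^-1 x)%g; rewrite ?inE /f /= ?permKV ?yx ?xy.
by rewrite inE /= => /andP[ab ba] [-> ->]; rewrite !permK ab ba.
Qed.

Lemma pcomp_inv u v : ((pcomp u v)^-1 = pcomp v^-1 u^-1)%g.
Proof. by rewrite /pcomp invMg. Qed.

Lemma simple_reflV i : (sr i)^-1%g = sr i.
Proof. exact: tpermV. Qed.

Lemma plen_simple i w : (i.+1 < n)%N ->
  if (w i < w (ordS i))%N then plen (pcomp w (sr i)) = (plen w).+1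
  else (plen (pcomp w (sr i))).+1 = plen w.
Proof.
move=> hi; have e' := ordSE hi; have ii : (i < ordS i)%N by rewrite e'.
have q0 v : qcover i (ordS i) v by apply/qcoverP => c; rewrite e'; lia.
case: ifP => [wii|/negbT wii].
  by apply/eqP; rewrite qcover_up.
have wji : (w (ordS i) < w i)%N.
  have : w i <> w (ordS i) :> nat by move/eqP; rewrite perm_val_inj; lia.
  by lia.
by have := qcover_down ii wji; rewrite q0 e' /simple_refl => /eqP; lia.
Qed.

Lemma plen_word a : valid_word a -> (plen (word_perm a) <= size a)%N.
Proof.
elim: a => [_|i a IH /= /andP[hi va]].
  by rewrite leqn0 /plen cards_eq0; apply/eqP/setP => -[x y]; rewrite !inE !perm1 /=; lia.
rewrite -plen_inv pcomp_inv simple_reflV.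
have := plen_simple (word_perm a)^-1 hi; rewrite plen_inv.
by have := IH va; case: ifP => _; lia.
Qed.

(** An increasing v satisfies x <= v x everywhere; both sides have the same sum, so equality
    holds. *)
Lemma ltn_perm1 v : (forall x y, y = x.+1 :> nat -> (v x < v y)%N) -> v = 1%g.
Proof.
move=> h.
have le x : (x <= v x)%N.
  case: x => m mn; elim: m mn => [//|m IH] mn /=.
  have := IH (ltnW mn); have := h (Ordinal (ltnW mn)) (Ordinal mn) erefl; rewrite /=.
  by move=> h1 h2; apply: leq_ltn_trans h2 h1.
have /leqif_sum[_] : forall x, true -> ((x : nat) <= v x ?= iff (x == v x :> nat))%N.
  by move=> x _; apply/leqif_eq/le.
have -> : (\sum_x v x = \sum_(x : 'I_n) x)%N by rewrite [RHS](reindex_inj (@perm_inj _ v)).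
rewrite eqxx => /esym/forall_inP e; apply/permP => x; rewrite perm1.
by apply/esym/val_inj/eqP/e.
Qed.

Lemma reduced_word_exists u : exists a, is_reduced_word u a.
Proof.
move: {2}(plen u) (leqnn (plen u)) => m; elim: m u => [|m IH] u um.
  exists [::]; rewrite /is_reduced_word /=.
  suff -> : u = 1%g by rewrite eqxx eq_sym -leqn0; apply: (@plen_word [::]).
  apply/invg_inj; rewrite invg1; apply: ltn_perm1 => x y e.
  have hx : (x.+1 < n)%N by rewrite -e.
  have ey : y = ordS x by apply: val_inj; rewrite /= modn_small.
  have := plen_simple u^-1 hx; rewrite -ey plen_inv; case: ifP => // _; lia.
have [->|u1] := eqVneq u 1%g.
  by exists [::]; rewrite /is_reduced_word /= eqxx eq_sym -leqn0; apply: (@plen_word [::]).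
(* Words grow on the left while [plen_simple] multiplies on the right; hence the passage to the
   inverse. *)
have [i hi di] : exists2 i : 'I_n, (i.+1 < n)%N & (u^-1 (ordS i) < u^-1 i)%g%N.
  apply/exists_inP; apply: contraNT u1 => /exists_inPn ni.
  apply/eqP/invg_inj; rewrite invg1; apply: ltn_perm1 => x y e.
  have hx : (x.+1 < n)%N by rewrite -e.
  have -> : y = ordS x by apply: val_inj; rewrite /= modn_small.
  have := ni x hx; have := perm_val_inj u^-1 x (ordS x); rewrite ordSE // => e' ?.
  by rewrite ltn_neqAle e' (ltn_eqF (ltnSn x)) /= leqNgt.
have pu := plen_simple u^-1 hi.
rewrite ifF in pu; last by rewrite ltnNge ltnW.
rewrite plen_inv in pu.
have pu' : (plen (pcomp (sr i) u)).+1 = plen u by rewrite -plen_inv pcomp_inv simple_reflV.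
have [|a /and3P[va /eqP ea /eqP sa]] := IH (pcomp (sr i) u); first by lia.
exists (i :: a); rewrite /is_reduced_word /= hi va sa pu' eqxx andbT.
by rewrite ea pcompA /pcomp /simple_refl tperm2 mulg1 eqxx.
Qed.

Lemma reduced_wordP u : is_reduced_word u (reduced_word u).
Proof.
have [a ra] := reduced_word_exists u; rewrite /reduced_word; case: pickP => // h.
have /and3P[_ _ /eqP sa] := ra; have sz : size a == plen u by rewrite sa.
by have := h (Tuple sz); rewrite /= ra.
Qed.

End ReducedWords.

Section GrothendieckBasis.
Variables (R : comUnitRingType) (n : nat).
Implicit Types (w u : 'S_n) (i k : 'I_n) (f g : {mpoly int[n]}) (a : seq 'I_n).
Local Notation op := 'M[R]_#|{: 'S_n}|.
Local Notation bv := (@bv R n).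
Local Notation z := (fun _ : nat => 0 : R).
Local Notation D i := (hecke R i (ordS i)).
Local Notation sub := (@subst0X R n).

Definition act_word a (v : 'rV[R]_#|{: 'S_n}|) := foldr (fun i v => v *m D i) v a.

Lemma act_word_isobaric a f : valid_word a ->
  bv 1%g *m sub (foldr (@isobaric n) f a) = act_word a (bv 1%g *m sub f).
Proof.
elim: a => //= i a IH /andP[hi va].
by rewrite bv1_isobaric // IH.
Qed.

Lemma act_word_longest a : valid_word a -> size a = plen (word_perm a) ->
  act_word a (bv (longest n)) = bv (pcomp (longest n) (word_perm a)^-1%g).
Proof.
elim: a => [_ _|i a IH /= /andP[hi va]] /=.
  by congr bv; rewrite /pcomp invg1 mul1g.
rewrite pcomp_inv simple_reflV -plen_inv pcomp_inv simple_reflV => sa.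
have pa := plen_word va; have := plen_simple (word_perm a)^-1 hi.
(* Reducedness excludes a descent here; the longest element reverses the ascent, so the Hecke
   operator really moves the permutation. *)
rewrite plen_inv; case: ifP => [lt pu|_ pu]; last by lia.
rewrite IH //; last by lia.
rewrite bv_hecke // ifF ?pcompA // !pcompE !longestE /=.
by have := ltn_ord ((word_perm a)^-1 i)%g; have := ltn_ord ((word_perm a)^-1 (ordS i))%g; lia.
Qed.

Lemma act_word_all w : exists2 a, valid_word a & act_word a (bv (longest n)) = bv w.
Proof.
have /and3P[va /eqP ea /eqP sa] := reduced_wordP (pcomp w^-1 (longest n)).
exists (reduced_word (pcomp w^-1 (longest n))) => //.
rewrite -/(word_perm _) in ea; rewrite act_word_longest ?ea // pcomp_inv invgK pcompA /pcomp.
by rewrite mulVg mulg1.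
Qed.

(** A symmetric f commutes with all Hecke operators, and these reach every w from the longest
    element, so the eigenvalue found there holds everywhere. *)
Lemma sub0_sym_bv f c : (forall i, (i.+1 < n)%N -> msym (simple_refl i) f = f) ->
  bv (longest n) *m sub f = c *: bv (longest n) -> forall v : 'rV[R]_#|{: 'S_n}|, v *m sub f = c *: v.
Proof.
move=> sf e v; rewrite [v]rv_bvE mulmx_suml scaler_sumr; apply: eq_bigr => w _.
rewrite -scalemxAl scalerA mulrC -scalerA; congr (_ *: _).
have [a va <-] := act_word_all w; elim: a va => //= i a IH /andP[hi va].
by rewrite -rv_mulM -sub0_hecke_sym ?sf // rv_mulM IH // scalemxAl.
Qed.

Lemma fix_dprod (v : 'rV[R]_#|{: 'S_n}|) (P : pred 'I_n) (F : 'I_n -> op) :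
  (forall b, P b -> v *m F b = v) -> v *m dprod P F = v.
Proof.
move=> h; rewrite /dprod; elim: (rev _) => [|b s IH]; first by rewrite big_nil rv_mul1.
by rewrite big_cons; case: (boolP (P b)) => // Pb; rewrite rv_mulM h.
Qed.

(** The longest element has no ascent, so at q = 0 all brackets kill it and Theta_k fixes it. *)
Lemma longest_Xop k : bv (longest n) *m Xop z k = 0.
Proof.
have h (c d : 'I_n) : (c < d)%N -> bv (longest n) *m bracket z c d = 0.
  move=> cd; rewrite bv_bracket // bcoef0 // !longestE /=.
  have -> : (n - c.+1 < n - d.+1)%N = false by have := ltn_ord d; lia.
  by rewrite andbF scale0r.
rewrite XopE mulmxBr rv_mul1 /Theta rv_mulM /Lop fix_dprod => [|b /andP[_ bk]]; last first.
  by rewrite /hop mulmxDr h // addr0 rv_mul1.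
rewrite /Rop fix_dprod ?subrr // => b /andP[_ kb].
by rewrite hop_inv0 // hop_rev ?ltn_neq // mulmxBr h // subr0 rv_mul1.
Qed.

Lemma epk_mesym (A : comUnitRingType) p : @epk A n p n = mesym n A p.
Proof.
rewrite /epk /mesym; apply: eq_bigl => I.
by rewrite andbC; case: forall_inP => // h; case: h => x _.
Qed.

Lemma map_epk (p k : nat) : map_mpoly intr (@epk int n p k) = @epk R n p k.
Proof.
rewrite /epk rmorph_sum /=; apply: eq_bigr => I _.
by rewrite rmorph_prod /=; apply: eq_bigr => i _; rewrite map_mpolyX.
Qed.

Lemma epk_full_zero p (v : 'rV[R]_#|{: 'S_n}|) : (0 < p)%N -> v *m subst_Xop z (@epk R n p n) = 0.
Proof.
move=> p0; rewrite -map_epk -/(sub _) (@sub0_sym_bv _ 0) ?scale0r //.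
  by move=> i hi; rewrite epk_mesym; apply/issymP/mesym_sym.
rewrite ?scale0r /epk sub0_sum mulmx_sumr big1 // => I /andP[/eqP cI _].
rewrite /subst0X rmorph_prod /= subst_prod; last exact: z_unit.
rewrite -prod_enum_set; have : size (enum I) = p by rewrite -cardE.
case: (enum I) => [|j s]; first by move=> e; rewrite -e in p0.
by rewrite big_cons map_mpolyX substX rv_mulM longest_Xop mul0mx.
Qed.

End GrothendieckBasis.

(** * The top monomial sends the identity to the longest element *)

Section TopGrothendieck.
Variables (R : comUnitRingType) (n : nat).
Implicit Types (w : 'S_n) (b c k : 'I_n).
Local Notation op := 'M[R]_#|{: 'S_n}|.
Local Notation bv := (@bv R n).
Local Notation z := (fun _ : nat => 0 : R).

(** The hypotheses leave a single active factor in Theta_c, the inverse of [hop c b0], so Theta_c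
    sends w to w - w t and X_c = 1 - Theta_c sends it to w t. *)
Lemma bv_Xop_single w c b0 : (c < b0)%N -> (forall b, b < c -> w c < w b)%N ->
  (forall b, c < b < b0 -> w b < w c)%N -> w b0 = (w c).+1 :> nat ->
  bv w *m Xop z c = bv (pcomp w (tperm c b0)).
Proof.
move=> cb0 h1 h2 h3; set w' := pcomp w _.
have fixR v (b : 'I_n) : (c < b)%N -> ~~ (qcover c b v && (v c < v b)%N) ->
    bv v *m invmx (hop z c b) = bv v.
  move=> cb nq; rewrite hop_inv0 // hop_rev ?ltn_neq // mulmxBr rv_mul1 bv_bracket //.
  by rewrite bcoef0 // (negPf nq) scale0r subr0.
rewrite XopE mulmxBr rv_mul1 /Theta rv_mulM /Lop fix_dprod => [|b /andP[_ bc]]; last first.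
  rewrite /hop mulmxDr rv_mul1 bv_bracket // bcoef0 //.
  by rewrite [(w b < w c)%N]ltnNge ltnW ?h1 // andbF scale0r addr0.
rewrite /Rop (dprod_split b0) cb0 /= !rv_mulM (@fix_dprod _ _ (bv w)) => [|b /andP[cb b0b]]; last first.
  apply: fixR => //; apply/negP => /andP[/qcoverP/(_ b0)].
  by rewrite cb0 b0b h3 => /(_ isT); rewrite /cyc; lia.
rewrite hop_inv0 // hop_rev ?ltn_neq // mulmxBr rv_mul1 bv_bracket // bcoef0 // h3 ltnSn andbT.
have -> : qcover c b0 w.
  by apply/qcoverP => b /h2; rewrite h3 /cyc; lia.
rewrite scale1r -/w' mulmxBl !fix_dprod ?subKr // => b /andP[cb bb0]; apply: fixR => //.
  rewrite !pcompE tpermL tperm_other; [|by rewrite -val_eqE /=; lia|by rewrite -val_eqE /=; lia].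
  by rewrite h3 negb_and; have := h2 b; rewrite cb bb0 => /(_ isT); lia.
by rewrite negb_and; have := h2 b; rewrite cb bb0 => /(_ isT); lia.
Qed.

(* The one-line notation of w is n-1, ..., n-c, m, followed by the other values in increasing order. *)
Let st (c m : nat) w := forall x : 'I_n, w x = (if x < c then n.-1 - x else
  if x == c :> nat then m else if x - c.+1 < m then x - c.+1 else x - c)%N :> nat.

Let st_step c m w : (m < n.-1 - c)%N -> st c m w ->
  exists2 w', st c m.+1 w' & bv w *m Xop z c = bv w'.
Proof.
move=> mn sw; have hb : (c + m.+1 < n)%N by have := ltn_ord c; lia.
pose b0 := Ordinal hb.
have wc : w c = m :> nat by rewrite sw ltnn eqxx.
have wb0 : w b0 = m.+1 :> nat.
  rewrite sw /= ifF; last by lia.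
  rewrite ifF; last by lia.
  by rewrite ifF; lia.
exists (pcomp w (tperm c b0)).
  move=> x; rewrite pcompE; have [->|xc] := eqVneq x c.
    by rewrite tpermL wb0 ltnn eqxx.
  have [->|xb] := eqVneq x b0.
    rewrite tpermR wc /= ifF; last by lia.
    rewrite ifF; last by lia.
    by rewrite ifT; lia.
  rewrite tperm_other // sw; move: xc xb; rewrite -!val_eqE /= => xc xb.
  case: ifP => // xc'; rewrite (negPf xc).
  by case: ifP; case: ifP => //; lia.
apply: bv_Xop_single => [|b bc|b /andP[cb bb0]|] /=; first by lia.
- by rewrite wc sw bc; have := ltn_ord c; lia.
- rewrite wc sw ifF; last by lia.
  rewrite ifF; last by lia.
  by move: bb0 => /= bb0; rewrite ifT; lia.
by rewrite wc wb0.
Qed.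

Let st_pow c j w : (j <= n.-1 - c)%N -> st c 0 w ->
  exists2 w', st c j w' & bv w *m Xop z c ^+ j = bv w'.
Proof.
move=> + sw; elim: j => [_|j IH jn]; first by exists w; rewrite ?expr0 ?rv_mul1.
have [w1 s1 e1] := IH (ltnW jn); have [w2 s2 e2] := st_step jn s1.
by exists w2; rewrite // exprSr rv_mulM e1.
Qed.

(** When X_c is reached, position c holds the smallest remaining value 0; each application raises it
    by one, and n - c - 1 of them make it the largest remaining one. *)
Lemma subst0X_top :
  bv 1%g *m subst0X R (\prod_(i < n) 'X_i ^+ (n - i.+1)) = bv (longest n).
Proof.
pose S0 (c : nat) w := forall x : 'I_n, w x = (if x < c then n.-1 - x else x - c)%N :> nat.
have -> : subst0X R (\prod_(i < n) 'X_i ^+ (n - i.+1)) = \prod_(i < n) Xop z i ^+ (n - i.+1).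
  rewrite /subst0X rmorph_prod /= subst_prod; last exact: z_unit.
  apply: eq_bigr => i _; rewrite -sub0X /subst0X rmorphXn /=.
  elim: (n - i.+1)%N => [|j IH]; first by rewrite !expr0 subst1.
  by rewrite !exprS substM ?IH //; apply: z_unit.
pose f m : op := if insub m is Some c then Xop z c ^+ (n - m.+1) else 1.
have -> : \prod_(i < n) Xop z i ^+ (n - i.+1) = \prod_(0 <= m < n) f m.
  by rewrite big_mkord; apply: eq_bigr => a _; rewrite /f valK.
have H m : (m <= n)%N -> exists2 w, S0 m w & bv 1%g *m \prod_(0 <= i < m) f i = bv w.
  elim: m => [_|m IH mn].
    by exists 1%g; [move=> x; rewrite perm1 ltn0 subn0|rewrite big_geq // rv_mul1].
  have [w sw e] := IH (ltnW mn); pose c := Ordinal mn.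
  have sc : st c 0 w.
    move=> x; rewrite sw /=; case: ifP => // xm.
    by case: ifP => [/eqP ->|xm']; lia.
  have le : (n - m.+1 <= n.-1 - c)%N by rewrite /=; lia.
  have [w' s' e'] := st_pow le sc.
  exists w'; last first.
    by rewrite big_nat_recr //= rv_mulM e /f insubT.
  move=> x; rewrite s' /=; have xn := ltn_ord x.
  case: ifP => [xm|xm]; first by rewrite ifT //; lia.
  case: ifP => [/eqP ->|xm']; first by rewrite ltnSn; lia.
  by rewrite ifT ?ifF; lia.
have [w sw ->] := H n (leqnn n); congr bv; apply/permP => x; apply: val_inj.
by rewrite longestE /= sw ltn_ord; have := ltn_ord x; lia.
Qed.

Lemma subst0X_groth w : bv 1%g *m subst0X R (groth w) = bv w.
Proof.
have /and3P[va /eqP ea /eqP sa] := reduced_wordP (pcomp w^-1 (longest n)).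
rewrite -/(word_perm _) in ea.
rewrite /groth /isobaric_perm act_word_isobaric // subst0X_top.
rewrite act_word_longest ?ea // pcomp_inv invgK pcompA /pcomp.
by rewrite mulVg mulg1.
Qed.

End TopGrothendieck.

(** * Elementary symmetric polynomials span the module L_n *)

Section ElementaryRecursion.
Variables (R : comUnitRingType) (n : nat).
Implicit Types (k : 'I_n) (p r : nat) (I J : {set 'I_n}).
Local Notation epk := (@epk R n).

Lemma epk0 (k : nat) : epk 0 k = 1.
Proof.
rewrite /Defs.epk (big_pred1 set0) => [|I]; first by rewrite big_set0.
rewrite cards_eq0 /= andb_idr // => /eqP ->.
by apply/forall_inP => i; rewrite inE.
Qed.

Lemma card_ltn_ord (k : nat) : (k <= n)%N -> #|[set i : 'I_n | (i < k)%N]| = k.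
Proof.
move=> kn; rewrite -sum1dep_card -(big_ord_widen _ (fun=> 1%N)) // sum1_card card_ord //.
Qed.

Lemma epk_gt p (k : nat) : (k <= n)%N -> (k < p)%N -> epk p k = 0.
Proof.
move=> kn kp; rewrite /Defs.epk big_pred0 // => I; apply/negP => /andP[/eqP cI /forall_inP h].
have : (#|I| <= #|[set i : 'I_n | (i < k)%N]|)%N.
  by apply/subset_leq_card/subsetP => i /h; rewrite inE.
by rewrite card_ltn_ord // cI; lia.
Qed.

Lemma epkS p k : epk p.+1 k.+1 = epk p.+1 k + 'X_k * epk p k.
Proof.
rewrite /Defs.epk (bigID (fun I => k \notin I)) /=; congr (_ + _).
  apply: eq_bigl => I; apply/andP/andP => [[/andP[cI /forall_inP h] kI]|[cI /forall_inP h]].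
    split=> //; apply/forall_inP => i iI; rewrite ltn_neqAle -ltnS h // andbT.
    by apply: contraNneq kI => /val_inj <-.
  split; last by apply/negP => /h; rewrite ltnn.
  by rewrite cI; apply/forall_inP => i /h; apply: leqW.
rewrite big_distrr (reindex_onto (fun J => k |: J) (fun I => I :\ k)) /=; last first.
  by move=> I /andP[_ /negPn kI]; rewrite setD1K.
apply: congr_big => // [J|J /andP[/andP[/andP[_ /forall_inP h] _] /eqP e]].
  apply/andP/andP => [[/andP[/andP[cJ /forall_inP h] _] /eqP e]|[cJ /forall_inP h]].
    have kJ : k \notin J by rewrite -e !inE eqxx.
    split; first by move: cJ; rewrite cardsU1 kJ.
    apply/forall_inP => i iJ; rewrite ltn_neqAle -ltnS h ?inE ?iJ ?orbT // andbT.
    by apply: contraNneq kJ => /val_inj <-.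
  have kJ : k \notin J by apply/negP => /h; rewrite ltnn.
  rewrite cardsU1 kJ setU11 setU1K // !eqxx /= eqSS cJ !andbT; split=> //.
  by apply/forall_inP => i /setU1P[->|/h]; [apply: ltnSn|apply: leqW].
by rewrite big_setU1 // -e !inE eqxx.
Qed.

End ElementaryRecursion.

Section Spanning.
Variables (R : comUnitRingType) (n : nat).
Hypothesis n0 : (0 < n)%N.
Implicit Types (d k : nat) (j : 'I_n) (f g h : {mpoly R[n]}).
Local Notation bv := (@bv R n).
Local Notation z := (fun _ : nat => 0 : R).
Local Notation epk := (@epk R n).

Definition rho f := bv 1%g *m subst_Xop z f.

Lemma rhoD : {morph rho : f g / f + g}.
Proof. by move=> f g; rewrite /rho substD mulmxDr. Qed.

Lemma rhoZ c f : rho (c *: f) = c *: rho f.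
Proof. by rewrite /rho substZ -scalemxAr. Qed.

Lemma rho_ideal f g : rho f = 0 -> rho (f * g) = 0.
Proof.
by rewrite /rho substM; [rewrite rv_mulM => ->; rewrite mul0mx|apply: z_unit].
Qed.

(** With k + d = n: f is a combination of products e_{p_k}^k ... e_{p_{n-1}}^{n-1} modulo the kernel
    of [rho]. That kernel is an ideal, so congruences in the coefficients are harmless. *)
Fixpoint espan (d k : nat) f : Prop :=
  if d is d'.+1 then
    exists2 g : nat -> {mpoly R[n]}, (forall p, espan d' k.+1 (g p)) &
      f = \sum_(p < k.+1) g p * epk p k
  else exists c, rho (f - c%:MP) = 0.

Lemma espanD d k f g : espan d k f -> espan d k g -> espan d k (f + g).
Proof.
elim: d k f g => [|d IH] k f g /=.
  move=> [c1 e1] [c2 e2]; exists (c1 + c2).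
  by rewrite mpolyCD opprD addrACA rhoD e1 e2 addr0.
move=> [g1 h1 ->] [g2 h2 ->]; exists (fun p => g1 p + g2 p); first by move=> p; apply: IH.
by rewrite -big_split; apply: eq_bigr => p _; rewrite mulrDl.
Qed.

Lemma espanZ d k c f : espan d k f -> espan d k (c *: f).
Proof.
elim: d k f => [|d IH] k f /=.
  move=> [c1 e1]; exists (c * c1).
  by rewrite mpolyCM mul_mpolyC -scalerBr rhoZ e1 scaler0.
move=> [g1 h1 ->]; exists (fun p => c *: g1 p); first by move=> p; apply: IH.
by rewrite scaler_sumr; apply: eq_bigr => p _; rewrite scalerAl.
Qed.

Lemma espan0 d k f : f = 0 -> espan d k f.
Proof.
move=> ->; elim: d k => [|d IH] k /=; first by exists 0; rewrite subr0 /rho subst0 mulmx0.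
by exists (fun=> 0) => //; rewrite big1 // => p _; rewrite mul0r.
Qed.

Lemma espan_sum d k m (F : 'I_m -> {mpoly R[n]}) :
  (forall p, espan d k (F p)) -> espan d k (\sum_(p < m) F p).
Proof. by move=> h; apply: big_ind => //; [apply: espan0|apply: espanD]. Qed.

Lemma espan_mul d (k : nat) p f : (k < n)%N ->
  espan d k.+1 f -> espan d.+1 k (f * epk p k).
Proof.
move=> kn hf; have [pk|kp] := ltnP p k.+1; last first.
  by rewrite epk_gt // ?mulr0; [apply: espan0|apply: ltnW].
exists (fun r => if r == p then f else 0) => [r|].
  by case: ifP => // _; apply: espan0.
rewrite (bigD1 (Ordinal pk)) //= eqxx big1 ?addr0 // => r.
by rewrite -val_eqE /= => /negPf ->; rewrite mul0r.
Qed.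

Lemma espan1 d k : (k + d <= n)%N -> espan d k 1.
Proof.
elim: d k => [|d IH] k kd /=; first by exists 1; rewrite subrr /rho subst0 mulmx0.
rewrite -[1]mulr1 -[X in _ * X](epk0 R n k); apply: (@espan_mul d); first by lia.
by apply: IH; lia.
Qed.

(** Multiplication by x_j and by e_r^k must be treated together: the recursion e_{p+1}^{k+1} =
    e_{p+1}^k + x_k e_p^k (variables counted from 0) trades one for the other. The descent ends at k
    = n, where e_r^n acts by 0 for r > 0. *)
Lemma espan_closed d k : (k + d = n)%N ->
  (forall j f, (k <= j)%N -> espan d k f -> espan d k (f * 'X_j)) /\
  (forall r f, espan d k f -> espan d k (f * epk r k)).
Proof.
elim: d k => [|d IH] k kd.
  split=> [j f|[|r] f]; first by have := ltn_ord j; lia.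
    by rewrite epk0 mulr1.
  have -> : k = n by lia.
  case=> c e; exists 0; rewrite subr0 -(subrK c%:MP f) mulrDl rhoD rho_ideal // add0r.
  by rewrite mul_mpolyC rhoZ /rho epk_full_zero // scaler0.
have kn : (k < n)%N by lia.
have [IHx IHe] := IH k.+1 (etrans (addSnnS _ _) kd).
have eS p : epk p.+1 k.+1 = epk p.+1 k + 'X_(Ordinal kn) * epk p k := epkS R p (Ordinal kn).
have hX j f : (k <= j)%N -> espan d.+1 k f -> espan d.+1 k (f * 'X_j).
  move=> kj [g gs ->]; rewrite mulr_suml; apply: espan_sum => p.
  rewrite mulrAC; have [kj'|jk] := ltnP k j; first by apply: espan_mul (IHx _ _ _ (gs p)).
  have -> : j = Ordinal kn by apply: val_inj; rewrite /=; lia.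
  have -> : g p * 'X_(Ordinal kn) * epk p k = g p * epk p.+1 k.+1 * epk 0 k + ((-1) *: g p) * epk p.+1 k.
    by rewrite epk0 mulr1 eS scaleN1r mulrDr mulNr addrAC subrr add0r mulrA.
  by apply: espanD; apply: espan_mul => //; [apply: IHe|apply: espanZ]; apply: gs.
split=> // r; elim: r => [|r IHr] f hf; first by rewrite epk0 mulr1.
have -> : f * epk r.+1 k = f * epk r.+1 k.+1 + (-1) *: (f * 'X_(Ordinal kn) * epk r k).
  by rewrite eS scaleN1r mulrDr mulrA addrK.
apply: espanD; last first.
  by apply: espanZ; apply: IHr; apply: hX => //=.
case: hf => g gs ->; rewrite mulr_suml; apply: espan_sum => p.
by rewrite mulrAC; apply: espan_mul (IHe _ _ (gs p)).
Qed.

Lemma espan_all f : espan n.-1 1 f.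
Proof.
have [hX he] := @espan_closed n.-1 1 (etrans (add1n _) (prednK n0)).
have hX' j g : espan n.-1 1 g -> espan n.-1 1 (g * 'X_j).
  move=> hg; have [j0|j0] := posnP j; last exact: hX.
  have -> : 'X_j = epk 1 1 :> {mpoly R[n]}; last exact: he.
  by rewrite -{2}j0 epkS epk0 mulr1 j0 epk_gt // add0r.
have h1 : espan n.-1 1 1 by apply: espan1; rewrite add1n prednK.
rewrite [f]mpolyE; apply: (big_ind (espan n.-1 1)).
- exact: espan0.
- exact: espanD.
move=> m _; apply: espanZ; rewrite mpolyXE_id.
suff H (s : seq 'I_n) : espan n.-1 1 (\prod_(i <- s) 'X_i ^+ m i) by exact: H.
elim: s => [|j s IH]; first by rewrite big_nil.
rewrite big_cons; elim: (m j) => [|l IHl]; first by rewrite expr0 mul1r.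
by rewrite exprSr mulrAC; apply: hX'.
Qed.

Definition ecombination (v : 'rV[R]_#|{: 'S_n}|) :=
  exists c : {ffun 'I_n.-1 -> 'I_n} -> R, v = \sum_(p in eindex n) c p *: rho (eprod R p).

Lemma ecombinationD v1 v2 : ecombination v1 -> ecombination v2 -> ecombination (v1 + v2).
Proof.
move=> [c1 ->] [c2 ->]; exists (fun p => c1 p + c2 p).
by rewrite -big_split; apply: eq_bigr => p _; rewrite scalerDl.
Qed.

Lemma espan_ecombination d (k : nat) f (p : nat -> nat) : (k.+1 + d = n)%N ->
  (forall i, p i <= i.+1)%N -> espan d k.+1 f ->
  ecombination (rho (f * \prod_(0 <= i < k) epk (p i) i.+1)).
Proof.
elim: d k f p => [|d IH] k f p kd hp /=.
  (* Here k = n - 1, and p i <= i + 1 < n for i < n - 1, so the default [i0] is never taken. *)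
  case=> c e; pose i0 := Ordinal n0.
  pose P : {ffun 'I_n.-1 -> 'I_n} := [ffun i : 'I_n.-1 => insubd i0 (p i)].
  have PE (i : 'I_n.-1) : P i = p i :> nat.
    rewrite ffunE val_insubd; have := hp i; have := ltn_ord i; case: ifP => //; lia.
  have PI : P \in eindex n by rewrite inE; apply/forallP => i; rewrite PE.
  exists (fun p' => if p' == P then c else 0).
  rewrite (bigD1 P) //= eqxx [X in _ = _ + X]big1; last first.
    by move=> p' /andP[_ /negPf ->]; rewrite scale0r.
  rewrite addr0.
  rewrite -(subrK c%:MP f) mulrDl rhoD rho_ideal // add0r mul_mpolyC rhoZ.
  congr (_ *: rho _); rewrite /eprod.
  have -> : k = n.-1 by lia.
  by rewrite big_mkord; apply: eq_bigr => i _; rewrite PE.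
case=> g gs ->; rewrite big_distrl /=.
have h (J : finType) (F : J -> {mpoly R[n]}) :
    (forall r, ecombination (rho (F r))) -> ecombination (rho (\sum_r F r)).
  move=> hF; apply: (big_ind (fun f => ecombination (rho f))) => //.
    exists (fun=> 0); rewrite /rho subst0 mulmx0 big1 // => r _; exact: scale0r.
  by move=> f1 f2 h1 h2; rewrite rhoD; apply: ecombinationD.
apply: h => r; pose p' i := if i == k then r : nat else p i.
have -> : g r * epk r k.+1 * \prod_(0 <= i < k) epk (p i) i.+1 =
    g r * \prod_(0 <= i < k.+1) epk (p' i) i.+1.
  rewrite big_nat_recr //= /p' eqxx -mulrA; congr (_ * _); rewrite mulrC; congr (_ * _).
  by apply: eq_big_nat => i /andP[_ ik]; rewrite ltn_eqF.
apply: IH => // [|i]; first by lia.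
by rewrite /p'; case: eqP => [->|_]; [have := ltn_ord r; lia|].
Qed.

Lemma ecombination_all f : ecombination (rho f).
Proof.
have := @espan_ecombination n.-1 0 f (fun=> 0%N) (etrans (add1n _) (prednK n0)).
by rewrite big_geq // mulr1; apply=> //; apply: espan_all.
Qed.

End Spanning.

(** * Multidegrees and ranks *)

Section Multidegrees.
Variables (R : comUnitRingType) (n : nat).
Implicit Types (f g : {mpoly R[n]}) (b : 'I_n -> nat).

Definition bounded b f := forall a, a \in msupp f -> forall j, (a j <= b j)%N.

Lemma tensLP f : reflect (bounded (fun j => n - j.+1)%N f) (f \in tensL).
Proof.
rewrite unfold_in; apply: (iffP allP) => [h a /h /forallP //|h a /h ha].
exact/forallP.
Qed.

Lemma bounded_le b b' f : (forall j, b j <= b' j)%N -> bounded b f -> bounded b' f.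
Proof. by move=> bb h a /h ha j; apply: leq_trans (ha j) (bb j). Qed.

Lemma boundedD b f g : bounded b f -> bounded b g -> bounded b (f + g).
Proof. by move=> hf hg a /msuppD_le; rewrite mem_cat => /orP[/hf|/hg]. Qed.

Lemma bounded0 b : bounded b 0.
Proof. by move=> a; rewrite msupp0 in_nil. Qed.

Lemma boundedZ b c f : bounded b f -> bounded b (c *: f).
Proof. by move=> hf a /msuppZ_le /hf. Qed.

Lemma bounded_sum b (J : Type) (r : seq J) (P : pred J) (F : J -> {mpoly R[n]}) :
  (forall j, P j -> bounded b (F j)) -> bounded b (\sum_(j <- r | P j) F j).
Proof. by move=> h; apply: big_ind => //; [apply: bounded0|apply: boundedD]. Qed.

Lemma boundedM b b' f g : bounded b f -> bounded b' g ->
  bounded (fun j => b j + b' j)%N (f * g).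
Proof.
move=> hf hg a /msuppM_le /allpairsP[[a1 a2] /= [/hf h1 /hg h2 ->]] j.
by rewrite mnmDE leq_add.
Qed.

Lemma boundedC c : bounded (fun=> 0%N) c%:MP.
Proof.
by move=> a; rewrite msuppC; case: eqP => // _; rewrite inE => /eqP -> j; rewrite mnm0E.
Qed.

Lemma bounded1 : bounded (fun=> 0%N) 1.
Proof. exact: boundedC. Qed.

Lemma boundedX i : bounded (fun j => (j == i : nat)) 'X_i.
Proof. by move=> a; rewrite msuppX inE => /eqP -> j; rewrite mnm1E eq_sym. Qed.

Lemma bounded_prod (J : Type) (r : seq J) (P : pred J) (B : J -> 'I_n -> nat) F :
  (forall j, P j -> bounded (B j) (F j)) ->
  bounded (fun i => \sum_(j <- r | P j) B j i)%N (\prod_(j <- r | P j) F j).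
Proof.
move=> h; elim: r => [|j r IH].
  by rewrite big_nil; apply: bounded_le bounded1 => i; rewrite big_nil.
rewrite big_cons; case: (boolP (P j)) => [Pj|Pj].
  by apply: bounded_le (boundedM (h j Pj) IH) => i; rewrite big_cons Pj.
by apply: bounded_le IH => i; rewrite big_cons (negPf Pj).
Qed.

Lemma bounded_prod_set (I : {set 'I_n}) (F : 'I_n -> {mpoly R[n]}) :
  (forall i, bounded (fun j => (j == i : nat)) (F i)) ->
  bounded (fun j => (j \in I : nat)) (\prod_(i in I) F i).
Proof.
move=> h; apply: bounded_le (bounded_prod (B := fun i j => (j == i : nat)) _) => // j.
case: (boolP (j \in I)) => jI.
  rewrite (bigD1 j) //= eqxx big1 // => i /andP[_ ij].
  by rewrite eq_sym (negPf ij).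
by rewrite big1 // => i iI; case: eqP => // ji; rewrite ji iI in jI.
Qed.

Lemma bounded_epk (p k : nat) : bounded (fun j => (j < k)%N : nat) (@epk R n p k).
Proof.
apply: bounded_sum => I /andP[_ /forall_inP Ik].
apply: bounded_le (bounded_prod_set boundedX) => j.
by case: (boolP (j \in I)) => // /Ik ->.
Qed.

Lemma bounded_Epk q (p k : nat) : bounded (fun j => (j < k)%N : nat) (@Epk R n q p k).
Proof.
apply: bounded_sum => i _.
have -> : (-1) ^+ i *+ 'C(k - i, p - i) = ((-1) ^+ i *+ 'C(k - i, p - i))%:MP :> {mpoly R[n]}.
  by rewrite rmorphMn rmorphXn rmorphN1.
rewrite mul_mpolyC; apply/boundedZ/bounded_sum => I /andP[_ /forall_inP Ik].
rewrite -rmorph_prod mulrC mul_mpolyC; apply: boundedZ.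
apply: bounded_le (bounded_prod_set (F := fun i => 1 - 'X_i) _) => [j|j].
  by case: (boolP (j \in I)) => // /Ik ->.
apply: boundedD; first by apply: bounded_le bounded1.
by rewrite -scaleN1r; apply/boundedZ/boundedX.
Qed.

Let sum_lt (j : 'I_n) : (\sum_(i < n.-1) (j < i.+1) = n - j.+1)%N.
Proof.
have H m : (\sum_(i < m) (j < i.+1) = m - j)%N.
  elim: m => [|m IH]; first by rewrite big_ord0.
  by rewrite big_ord_recr /= IH; case: (ltnP j m.+1); lia.
by rewrite H; have := ltn_ord j; lia.
Qed.

(** The variable of index j can occur only in the n - j - 1 factors with i >= j, at most once in
    each: this is the exponent bound of L_n. *)
Lemma prod_tensL (F : 'I_n.-1 -> {mpoly R[n]}) :
  (forall i : 'I_n.-1, bounded (fun j => (j < i.+1)%N : nat) (F i)) ->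
  \prod_(i < n.-1) F i \in tensL.
Proof.
move=> h; apply/tensLP; have := @bounded_prod _ (index_enum 'I_n.-1) xpredT _ F (fun i _ => h i).
by apply: bounded_le => j; rewrite sum_lt.
Qed.

Lemma eprod_tensL p : eprod R p \in (tensL : {pred {mpoly R[n]}}).
Proof. by apply: prod_tensL => i; apply: bounded_epk. Qed.

Lemma Eprod_tensL q p : Eprod q p \in (tensL : {pred {mpoly R[n]}}).
Proof. by apply: prod_tensL => i; apply: bounded_Epk. Qed.

Lemma tensL_sum (J : finType) (P : pred J) (c : J -> R) (F : J -> {mpoly R[n]}) :
  (forall j, P j -> F j \in tensL) -> \sum_(j | P j) c j *: F j \in tensL.
Proof.
by move=> h; apply/tensLP/bounded_sum => j /h /tensLP; apply: boundedZ.
Qed.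

Lemma tensLB f g : f \in tensL -> g \in tensL -> f - g \in tensL.
Proof.
move=> /tensLP hf /tensLP hg; apply/tensLP/boundedD => //.
by rewrite -scaleN1r; apply: boundedZ.
Qed.

End Multidegrees.

(** * Injectivity from surjectivity by counting monomials *)

Section Rank.
Variables (R : comUnitRingType) (n : nat).
Implicit Types (f g : {mpoly R[n]}) (w : 'S_n).
Local Notation bv := (@bv R n).

Let T := {a : {ffun 'I_n -> 'I_n} | [forall j : 'I_n, a j <= n - j.+1]%N}.
Let mon (a : T) : 'X_{1..n} := [multinom (val a j : nat) | j < n].

Let card_T : #|{: T}| = #|{: 'S_n}|.
Proof.
rewrite [RHS](_ : _ = n`!); last by rewrite -card_Sn; apply: eq_card => w; rewrite !inE.
rewrite card_sig.
have -> : #|[pred a : {ffun 'I_n -> 'I_n} | [forall j : 'I_n, a j <= n - j.+1]%N]| =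
    #|family (fun j : 'I_n => [pred x : 'I_n | (x <= n - j.+1)%N])|.
  by apply: eq_card => a; apply/forallP/familyP.
rewrite card_family.
have -> : [seq #|[pred x : 'I_n | (x <= n - j.+1)%N]| | j : 'I_n] = [seq (n - j)%N | j : 'I_n].
  apply: eq_map => j; rewrite -[RHS](@card_ltn_ord n (n - j)) ?leq_subr //.
  by apply: eq_card => x; rewrite !inE; have := ltn_ord j; lia.
rewrite foldrE big_image /=.
elim: (n) => [|m IH]; first by rewrite big_ord0.
by rewrite big_ord_recl subn0 IH factS.
Qed.

Let mulmx_square m1 m2 (e : m1 = m2) (B : 'M[R]_(m2, m1)) (A : 'M[R]_(m1, m2)) :
  B *m A = 1%:M -> A *m B = 1%:M.
Proof. by move: A B; case: _ / e => A B; apply: mulmx1C. Qed.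

Let tensL_E f : f \in tensL -> f = \sum_(a : T) f@_(mon a) *: 'X_[mon a].
Proof.
move=> /tensLP hf; apply/mpolyP => m; rewrite raddf_sum /=.
have [ms|ms] := boolP (m \in msupp f); last first.
  rewrite memN_msupp_eq0 // big1 // => a _; rewrite mcoeffZ mcoeffX.
  by case: eqP => [e|]; rewrite ?mulr0 // e memN_msupp_eq0 // mul0r.
have mlt (j : 'I_n) : (m j < n)%N by have := hf m ms j; have := ltn_ord j; lia.
pose a0 : {ffun 'I_n -> 'I_n} := [ffun j => Ordinal (mlt j)].
have ha0 : [forall j : 'I_n, a0 j <= n - j.+1]%N.
  by apply/forallP => j; rewrite ffunE; apply: hf.
pose a : T := exist _ a0 ha0.
have ea : mon a = m by apply/mnmP => j; rewrite mnmE /= ffunE.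
rewrite (bigD1 a) //= mcoeffZ mcoeffX ea eqxx mulr1 big1 ?addr0 // => a' na.
rewrite mcoeffZ mcoeffX; case: eqP => [e|]; last by rewrite mulr0.
case/negP: na; apply/eqP/val_inj/ffunP => j; apply: val_inj.
by have /mnmP/(_ j) := etrans e (esym ea); rewrite !mnmE.
Qed.

(** L_n has n! monomials and the target has rank n!. Preimages of the basis vectors give a one-sided
    inverse of a square matrix over a commutative ring, hence a two-sided one. *)
Lemma tensL_inj (r : {mpoly R[n]} -> 'rV[R]_#|{: 'S_n}|) :
  {morph r : f g / f + g} -> (forall c f, r (c *: f) = c *: r f) ->
  (forall w, exists2 f, f \in tensL & r f = bv w) ->
  forall f, f \in tensL -> r f = 0 -> f = 0.
Proof.
move=> rD rZ rs.
have r0 : r 0 = 0 by rewrite -(scale0r 0) rZ scale0r.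
have rsum (c : T -> R) : r (\sum_a c a *: 'X_[mon a]) = \sum_a c a *: r 'X_[mon a].
  by rewrite (big_morph r rD r0); apply: eq_bigr => a _; rewrite rZ.
have /fin_all_exists[F hF] w : exists f, f \in tensL /\ r f = bv w.
  by have [f h1 h2] := rs w; exists f.
pose A : 'M[R]_(#|{: T}|, #|{: 'S_n}|) := \matrix_a r 'X_[mon (enum_val a)].
pose co f : 'rV[R]_#|{: T}| := \row_a f@_(mon (enum_val a)).
have coE f : f \in tensL -> co f *m A = r f.
  move=> hf; rewrite [in RHS](tensL_E hf) rsum mulmx_sum_row.
  rewrite (reindex_onto enum_rank enum_val) => [|a _]; last exact: enum_valK.
  apply: eq_big => [a|a _]; first by rewrite enum_rankK eqxx.
  by rewrite mxE rowK enum_rankK.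
pose B : 'M[R]_(#|{: 'S_n}|, #|{: T}|) := \matrix_w co (F (enum_val w)).
have BA : B *m A = 1%:M.
  apply/row_matrixP => a; rewrite row_mul rowK row1.
  by have [h1 h2] := hF (enum_val a); rewrite coE // h2 /bv enum_valK.
have AB := mulmx_square card_T BA.
move=> f hf f0; have : co f = 0 by rewrite -[co f]mulmx1 -AB mulmxA coE // f0 mul0mx.
move=> /rowP e; rewrite (tensL_E hf) big1 // => a _.
by have := e (enum_rank a); rewrite !mxE enum_rankK => ->; rewrite scale0r.
Qed.

End Rank.

(** * Quantum elementary polynomials act classically *)

Section ComplementedElementary.
Variables (A : comNzRingType) (n : nat).
Implicit Types (I J S : {set 'I_n}).

Lemma prod_1B (y : 'I_n -> A) J : \prod_(j in J) (1 - y j) =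
  \sum_(I : {set 'I_n} | I \subset J) (-1) ^+ #|I| * \prod_(i in I) y i.
Proof.
transitivity (\prod_j ((if j \in J then - y j else 0) + 1)).
  rewrite big_mkcond; apply: eq_bigr => j _.
  by case: ifP => _; rewrite ?add0r // addrC.
rewrite bigA_distr [RHS]big_mkcond; apply: eq_bigr => I _.
case: (boolP (I \subset J)) => [/subsetP IJ|/subsetPn[j jI jJ]]; last first.
  by rewrite (bigD1 j) //= jI (negPf jJ) mul0r.
by rewrite -prodrN [in RHS]big_mkcond; apply: eq_bigr => i _; case: ifP => // /IJ ->.
Qed.

Lemma card_supersets I S p : I \subset S -> (#|I| <= p)%N ->
  #|[set J : {set 'I_n} | [&& #|J| == p, J \subset S & I \subset J]]| =
  'C(#|S| - #|I|, p - #|I|).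
Proof.
move=> IS Ip; have <- : #|S :\: I| = (#|S| - #|I|)%N by rewrite cardsD (setIidPr IS).
rewrite -cards_draws.
rewrite -(card_in_imset (f := fun B => I :|: B) (D := [set B : {set 'I_n} | B \subset S :\: I & #|B| == p - #|I|]%N)).
  apply: eq_card => J; rewrite inE; apply/and3P/imsetP => [[/eqP cJ JS IJ]|[B]].
    exists (J :\: I); last by rewrite setUC setDE setUIl [~: I :|: I]setUC setUCr setIT; apply/esym/setUidPl.
    by rewrite inE setSD //= cardsD (setIidPr IJ) cJ.
  rewrite inE subsetD => /andP[/andP[BS dBI] /eqP cB] ->; split.
  - rewrite cardsU; have -> : I :&: B = set0 by apply: disjoint_setI0; rewrite disjoint_sym.
    by rewrite cards0 subn0 cB subnKC.
  - by rewrite subUset IS.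
  - exact: subsetUl.
move=> B1 B2; rewrite !inE !subsetD => /andP[/andP[_ d1] _] /andP[/andP[_ d2] _] e.
have h (B : {set 'I_n}) : [disjoint B & I] -> (I :|: B) :\: I = B.
  by move=> d; rewrite setDUl setDv set0U; apply/setDidPl.
by rewrite -(h B1 d1) -(h B2 d2) e.
Qed.

(** Expanding each product over J, a given I of size i is counted once for every J of size p
    containing it. These are the binomial coefficients in the definition of E_p^k. *)
Lemma elementary_1B (y : 'I_n -> A) S p :
  \sum_(J : {set 'I_n} | (#|J| == p) && (J \subset S)) \prod_(j in J) (1 - y j) =
  \sum_(i < p.+1) (-1) ^+ i *+ 'C(#|S| - i, p - i) *
    \sum_(I : {set 'I_n} | (#|I| == i) && (I \subset S)) \prod_(j in I) y j.
Proof.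
under eq_bigr do rewrite prod_1B.
rewrite (exchange_big_dep (fun I => (#|I| <= p)%N && (I \subset S))) /=; last first.
  by move=> J I /andP[/eqP <- JS] IJ; rewrite subset_leq_card // (subset_trans IJ).
rewrite (partition_big (fun I : {set 'I_n} => inord #|I| : 'I_p.+1) xpredT) //=.
apply: eq_bigr => i _; rewrite big_distrr /=.
apply: eq_big => [I|I /andP[/andP[Ip IS] /eqP ei]].
  case: (boolP (I \subset S)) => IS; last by rewrite !andbF.
  rewrite !andbT; apply/andP/idP => [[Ip /eqP <-]|/eqP ci]; first by rewrite inordK.
  by rewrite ci -ltnS ltn_ord inord_val.
have ci : #|I| = i by rewrite -ei inordK.
rewrite sumr_const -mulrnAl ci -[X in 'C(_ - X, _ - X)]ci -card_supersets //.
by congr (_ *+ _ * _); apply: eq_card => J; rewrite !inE andbA.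
Qed.

End ComplementedElementary.

Section QuantumElementary.
Variables (R : comUnitRingType) (n : nat).
Implicit Types (q : nat -> R) (I J : {set 'I_n}) (p k m : nat).
Local Notation z := (fun _ : nat => 0 : R).
Local Notation bv := (@bv R n).
Local Notation epk := (@epk R n).
Local Notation Fpk := (@Fpk R n).
Local Notation Epk := (@Epk R n).

Let low k : {set 'I_n} := [set i : 'I_n | (i < k)%N].

Let low_sub k I : [forall i in I, (i < k)%N] = (I \subset low k).
Proof.
by apply/forall_inP/subsetP => h i /h; rewrite inE.
Qed.

Lemma Fpk0 p k : Fpk z p k =
  \sum_(I : {set 'I_n} | (#|I| == p) && (I \subset low k)) \prod_(i in I) (1 - 'X_i).
Proof.
apply: eq_big => [I|I _]; first by rewrite low_sub.
by rewrite [X in _ * X]big1 ?mulr1 // => i _; rewrite subr0.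
Qed.

(** E_p^k is e_p^k rewritten in the variables 1 - x_i, with quantum factors inserted; at q = 0 the
    rewriting is undone by 1 - (1 - x_i) = x_i. *)
Lemma Epk0 p k : (k <= n)%N -> Epk z p k = epk p k.
Proof.
move=> kn; rewrite /Defs.epk.
transitivity (\sum_(J : {set 'I_n} | (#|J| == p) && (J \subset low k))
    \prod_(j in J) (1 - (1 - 'X_j)) : {mpoly R[n]}); last first.
  apply: eq_big => [I|I _]; first by rewrite low_sub.
  by apply: eq_bigr => i _; rewrite subKr.
rewrite elementary_1B card_ltn_ord //; apply: eq_bigr => i _; congr (_ * _).
exact: Fpk0.
Qed.

Lemma epk_low p k : epk p k =
  \sum_(I : {set 'I_n} | (#|I| == p) && (I \subset low k)) \prod_(j in I) 'X_j.
Proof. by apply: eq_bigl => I; rewrite low_sub. Qed.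

(** At q = 0 this is e_m in the variables 1 - x_i; expanded in the e_i(X), only the constant term
    survives. *)
Lemma Fpk0_full m (v : 'rV[R]_#|{: 'S_n}|) :
  v *m subst_Xop z (Fpk z m n) = 'C(n, m)%:R *: v.
Proof.
rewrite Fpk0 elementary_1B card_ltn_ord // subst_sum mulmx_sumr big_ord_recl.
rewrite [X in _ + X]big1 ?addr0 => [|i _]; last first.
  rewrite -epk_low mulrC substM ?rv_mulM; last exact: z_unit.
  by rewrite epk_full_zero // mul0mx.
rewrite -epk_low expr0 !subn0 substM; last exact: z_unit.
rewrite epk0 subst1 mulr1 -(mpolyC_nat n R) substC.
by rewrite -scalemxAr rv_mul1.
Qed.

(* Sum over the part J of a subset that lies beyond k. *)
Lemma Fpk0_split m k : (k <= n)%N -> Fpk z m n =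
  \sum_(J : {set 'I_n} | (#|J| <= m)%N && [disjoint J & low k])
    Fpk z (m - #|J|) k * \prod_(j in J) (1 - 'X_j).
Proof.
move=> kn; rewrite Fpk0.
rewrite (partition_big (fun I => I :\: low k)
  (fun J => (#|J| <= m)%N && [disjoint J & low k])) /=; last first.
  move=> I /andP[/eqP <- _]; rewrite subset_leq_card ?subsetDl //=.
  by rewrite -setI_eq0 setDE -setIA [~: _ :&: _]setIC setICr setI0.
apply: eq_bigr => J /andP[Jm dJ]; rewrite Fpk0 big_distrl /=.
have dUJ I : I \subset low k -> [disjoint I & J].
  by move=> Ik; rewrite disjoint_sym; apply: disjointWr dJ.
rewrite (reindex_onto (fun I => I :|: J) (fun I => I :&: low k)) /=; last first.
  by move=> I /andP[_ /eqP <-]; rewrite setID.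
apply: eq_big => [I|I /andP[/andP[_ /eqP eJ] /eqP eI]]; last first.
  by rewrite (big_setID (low k)) /= eI eJ.
apply/andP/andP => [[/andP[/andP[/eqP cI _] _] /eqP eI]|[/eqP cI Ik]].
  have Ik : I \subset low k by rewrite -eI subsetIr.
  split=> //; move: cI; rewrite cardsU disjoint_setI0 ?dUJ // cards0 subn0 => <-.
  by rewrite addnK.
have IJ0 := disjoint_setI0 (dUJ I Ik).
have J0 : J :&: low k = set0 by apply: disjoint_setI0.
rewrite cardsU IJ0 cards0 subn0 cI subnK // eqxx setIUl J0 setU0 setDUl.
have -> : I :\: low k = set0 by apply/eqP; rewrite setD_eq0.
rewrite set0U (setDidPl _ ) // eqxx (setIidPl Ik) eqxx /=; split=> //; rewrite andbT.
by apply/subsetP => i _; rewrite inE ltn_ord.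
Qed.

End QuantumElementary.


(** * Removing the quantum parameters *)

Section QuantumToClassical.
Variables (R : comUnitRingType) (n : nat).
Implicit Types (q : nat -> R) (I J : {set 'I_n}) (p k m j : nat) (f : {mpoly R[n]}).
Local Notation z := (fun _ : nat => 0 : R).
Local Notation bv := (@bv R n).
Local Notation epk := (@epk R n).
Local Notation Fpk := (@Fpk R n).
Local Notation Epk := (@Epk R n).
Local Notation rv := 'rV[R]_#|{: 'S_n}|.

(** The surviving parameters q 0, ..., q (k - 2) are those seen by F_p^k on S_k. A bracket reaching
    a position b >= k has q (b - 1) in its weight and so becomes classical. *)
Definition truncate q k : nat -> R := fun m => if (m.+1 < k)%N then q m else 0.

Lemma truncate_unit q k : (forall i, 1 - q i \is a GRing.unit) ->
  forall i, 1 - truncate q k i \is a GRing.unit.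
Proof. by move=> qu i; rewrite /truncate; case: ifP => // _; rewrite subr0 unitr1. Qed.

Lemma bracket_truncate q k (a b : 'I_n) : (a < b)%N -> (k <= b)%N ->
  bracket (truncate q k) a b = bracket z a b.
Proof.
move=> ab kb; apply: mx_bv_ext => w; rewrite !bv_bracket //; congr (_ *: _).
rewrite /bcoef; case: ifP => // _; case: ifP => // _.
have -> : qint z a b = 0 by rewrite /qint big_ltn // mul0r.
have eb : b = b.-1.+1 :> nat by lia.
rewrite /qint eb big_nat_recr /=; last by lia.
by rewrite {2}/truncate ifF ?mulr0 //; lia.
Qed.

Lemma hop_truncate q k (a b : 'I_n) : a != b -> (k <= a)%N || (k <= b)%N ->
  hop (truncate q k) a b = hop z a b.
Proof.
move=> nab kab; case: (ltngtP a b) => [ab|ba|/val_inj e]; last by rewrite e eqxx in nab.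
  by rewrite /hop bracket_truncate //; lia.
by rewrite !(@hop_rev _ _ _ b a) ?ltn_neq // bracket_truncate //; lia.
Qed.

Lemma Theta_truncate q k (i : 'I_n) : (k <= i)%N -> Theta (truncate q k) i = Theta z i.
Proof.
move=> ki; congr (_ * _); apply: eq_dprod => // b /= bi.
  by rewrite hop_truncate ?ki ?orbT // ltn_neq.
by rewrite hop_truncate ?ki // ltn_neq.
Qed.

Local Notation Fop q m k := (subst_Xop q (Fpk q m k)).

Lemma Fpk_agree q q' m (k : 'I_n) (u : rv) :
  (forall i, 1 - q i \is a GRing.unit) -> (forall i, 1 - q' i \is a GRing.unit) ->
  (forall i, (i.+1 < k)%N -> q i = q' i) -> supp (fixes_from k) u ->
  u *m Fop q m k = u *m Fop q' m k /\ supp (fixes_from k.+1) (u *m Fop q m k).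
Proof.
move=> qu qu' qq su; rewrite !subst_Fpk // !mulmx_sumr.
have h I : (#|I| == m) && [forall i in I, (i < k)%N] ->
    u *m FI q I = u *m FI q' I /\ supp (fixes_from k.+1) (u *m FI q I).
  by move=> /andP[_ /forall_inP Ik]; apply: FI_agree.
split; first by apply: eq_bigr => I /h[].
by apply: supp_sum => I /h[].
Qed.

Lemma Fpk_identity q m (k : 'I_n) : (forall i, 1 - q i \is a GRing.unit) ->
  bv 1%g *m Fop q m k = bv 1%g *m Fop z m k.
Proof.
move=> qu; rewrite !subst_Fpk //; last exact: z_unit.
by rewrite !mulmx_sumr; apply: eq_bigr => I _; apply: FI_identity.
Qed.

Lemma subst_later q k J : (forall i, 1 - q i \is a GRing.unit) ->
  [disjoint J & [set i : 'I_n | (i < k)%N]] ->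
  subst_Xop (truncate q k) (\prod_(j in J) (1 - 'X_j)) = subst_Xop z (\prod_(j in J) (1 - 'X_j)).
Proof.
move=> qu dJ; rewrite !subst_prod; [|exact: z_unit|exact: truncate_unit].
apply: eq_bigr => j jJ; rewrite !subst_1BX Theta_truncate //.
by have := disjointFr dJ jJ; rewrite inE ltnNge => /negbFE.
Qed.

(* The J = set0 term of the m-th sum is A m; the others involve smaller indices. *)
Lemma convolution_inj (D : nat -> {set 'I_n} -> bool) (A B : nat -> 'M[R]_#|{: 'S_n}|)
    (G : {set 'I_n} -> 'M[R]_#|{: 'S_n}|) (u : rv) :
  (forall m, D m set0) -> (forall m J, D m J -> #|J| <= m)%N -> G set0 = 1 ->
  (forall m, \sum_(J | D m J) u *m A (m - #|J|)%N *m G J =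
             \sum_(J | D m J) u *m B (m - #|J|)%N *m G J) ->
  forall m, u *m A m = u *m B m.
Proof.
move=> D0 Dm G0 h m; elim/ltn_ind: m => m IH; move: (h m).
rewrite (bigD1 set0) //= [in RHS](bigD1 set0) //= G0 !rv_mul1 cards0 subn0.
rewrite (eq_bigr (fun J => u *m B (m - #|J|)%N *m G J)); first exact: addIr.
move=> J /andP[/Dm Jm]; rewrite -cards_eq0 -lt0n => J0.
by rewrite IH // ltn_subrL J0 (leq_trans J0 Jm).
Qed.

(** The vector u has to come from 1 through operators with the truncated parameters, since the mixed
    polynomial used here is evaluated at these and commutes with them. *)
Lemma Fpk_classical q (k : 'I_n) (u : rv) f :
  (forall i, 1 - q i \is a GRing.unit) ->
  u = bv 1%g *m subst_Xop (truncate q k) f ->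
  forall m, u *m Fop (truncate q k) m k = u *m Fop z m k.
Proof.
move=> qu uf; have tu := truncate_unit k qu.
pose D m J := (#|J| <= m)%N && [disjoint J & [set i : 'I_n | (i < k)%N]].
have [G GE] : exists G : {set 'I_n} -> 'M[R]_#|{: 'S_n}|,
    forall J, subst_Xop z (\prod_(j in J) (1 - 'X_j)) = G J by eexists.
(* [P q0 m] is F_m^n with the parameters q0 on its first k variables and the other variables
   classical. *)
have [P [P1 P2]] : exists P : (nat -> R) -> nat -> {mpoly R[n]},
    (forall q0 m, P q0 m = \sum_(J : {set 'I_n} | D m J)
      Fpk q0 (m - #|J|) k * \prod_(j in J) (1 - 'X_j)) /\
    (forall m, P z m = Fpk z m n).
  eexists; split=> [q0 m|m]; first by reflexivity.
  by apply: esym; apply: Fpk0_split; apply: ltnW (ltn_ord k).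
have PE q0 m (v : rv) : (forall i, 1 - q0 i \is a GRing.unit) ->
    (forall J, D m J -> subst_Xop q0 (\prod_(j in J) (1 - 'X_j)) = G J) ->
    v *m subst_Xop q0 (P q0 m) = \sum_(J | D m J) v *m Fop q0 (m - #|J|) k *m G J.
  move=> q0u h; rewrite P1 subst_sum mulmx_sumr; apply: eq_bigr => J DJ.
  rewrite (substM q0u) (h J DJ); exact: rv_mulM.
have PtE m (v : rv) : v *m subst_Xop (truncate q k) (P (truncate q k) m) =
    \sum_(J | D m J) v *m Fop (truncate q k) (m - #|J|) k *m G J.
  by apply: (PE _ m v tu) => J /andP[_ dJ]; rewrite -GE; apply: subst_later.
have PzE m (v : rv) : v *m subst_Xop z (P z m) = \sum_(J | D m J) v *m Fop z (m - #|J|) k *m G J.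
  by apply: (PE _ m v (@z_unit R)) => J _; apply: GE.
have Pz m (v : rv) : v *m subst_Xop z (P z m) = 'C(n, m)%:R *: v.
  by rewrite P2; apply: Fpk0_full.
have Pt m : u *m subst_Xop (truncate q k) (P (truncate q k) m) = 'C(n, m)%:R *: u.
  (* On 1 the first k variables take no quantum step, and after truncation those beyond k act
     classically, so the two sums agree term by term. *)
  have e : bv 1%g *m subst_Xop (truncate q k) (P (truncate q k) m) = 'C(n, m)%:R *: bv 1%g.
    refine (etrans (PtE m _) (etrans _ (etrans (esym (PzE m _)) (Pz m _)))).
    apply: eq_bigr => J _.
    apply: (congr1 (fun v : rv => v *m G J)); exact: Fpk_identity.
  (* Commutation carries the scalar from 1 to u. *)
  by rewrite uf -rv_mulM (subst_comm tu) rv_mulM e scalemxAl.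
apply: (@convolution_inj D _ _ G) => [m|m J /andP[] //||m].
- by rewrite /D cards0 leq0n /= -setI_eq0 set0I.
- by rewrite -GE big_set0 subst1.
- exact: (etrans (esym (PtE m u)) (etrans (Pt m) (etrans (esym (Pz m u)) (PzE m u)))).
Qed.

(** Two replacements: q by its truncation, because u is supported on S_k, and then the truncation by
    0, because u lies in the orbit of 1 under the truncated operators. *)
Lemma Epk_classical q (k : 'I_n) p (u : rv) f :
  (forall i, 1 - q i \is a GRing.unit) -> supp (fixes_from k) u ->
  u = bv 1%g *m subst_Xop (truncate q k) f ->
  u *m subst_Xop q (Epk q p k) = u *m subst_Xop z (epk p k) /\
  supp (fixes_from k.+1) (u *m subst_Xop q (Epk q p k)).
Proof.
move=> qu su uf; have tu := truncate_unit k qu.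
have E q0 (v : rv) : (forall i, 1 - q0 i \is a GRing.unit) ->
    v *m subst_Xop q0 (Epk q0 p k) =
    \sum_(i < p.+1) ((-1) ^+ i *+ 'C(k - i, p - i)) *: (v *m Fop q0 i k).
  move=> q0u; rewrite /Defs.Epk subst_sum mulmx_sumr; apply: eq_bigr => i _.
  have -> : (-1) ^+ i *+ 'C(k - i, p - i) = ((-1) ^+ i *+ 'C(k - i, p - i))%:MP :> {mpoly R[n]}.
    by rewrite rmorphMn rmorphXn rmorphN1.
  by rewrite mul_mpolyC substZ -scalemxAr.
have qt i : (i.+1 < k)%N -> q i = truncate q k i by move=> ik; rewrite /truncate ik.
have h i := @Fpk_agree q _ i k u qu tu qt su.
split.
  have -> : epk p k = Epk z p k by rewrite Epk0 // ltnW.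
  refine (etrans (E q u qu) (etrans _ (esym (E z u (@z_unit R))))).
  apply: eq_bigr => i _; have [e _] := h i.
  exact (congr1 (fun v : rv => ((-1) ^+ i *+ 'C(k - i, p - i)) *: v)
    (etrans e (Fpk_classical qu uf i))).
by rewrite (E q u qu); apply: supp_sum => i _; apply: suppZ; have [_] := h i.
Qed.

Lemma Eprod_classical q (p : nat -> nat) j : (forall i, 1 - q i \is a GRing.unit) -> (j < n)%N ->
  bv 1%g *m subst_Xop q (\prod_(0 <= i < j) Epk q (p i) i.+1) =
    bv 1%g *m subst_Xop z (\prod_(0 <= i < j) epk (p i) i.+1) /\
  supp (fixes_from j.+1) (bv 1%g *m subst_Xop q (\prod_(0 <= i < j) Epk q (p i) i.+1)).
Proof.
move=> + jn; elim: j jn q => [|j IH] jn q qu.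
  have h q0 (F : nat -> {mpoly R[n]}) :
      bv 1%g *m subst_Xop q0 (\prod_(0 <= i < 0) F i) = bv 1%g.
    by rewrite big_geq // subst1 rv_mul1.
  split; first exact: etrans (h q _) (esym (h z _)).
  rewrite (h q).
  by apply: supp_bv => x _; rewrite perm1.
pose k := Ordinal jn; have tu := truncate_unit k qu.
(* The induction hypothesis serves both q and its truncation. Both give the classical vector, which
   is therefore also a value of truncated operators at 1. *)
have [e1 s1] := IH (ltnW jn) q qu; have [e2 _] := IH (ltnW jn) _ tu.
have [h1 h2] := @Epk_classical q k (p j) _ _ qu s1 (etrans e1 (esym e2)).
have hM q0 (v : rv) g g' : (forall i, 1 - q0 i \is a GRing.unit) ->
    v *m subst_Xop q0 (g * g') = v *m subst_Xop q0 g *m subst_Xop q0 g'.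
  by move=> q0u; rewrite (substM q0u); apply: rv_mulM.
have E : bv 1%g *m subst_Xop q (\prod_(0 <= i < j.+1) Epk q (p i) i.+1) =
    bv 1%g *m subst_Xop q (\prod_(0 <= i < j) Epk q (p i) i.+1) *m subst_Xop q (Epk q (p j) k).
  by rewrite (big_nat_recr _ _ _ (leq0n j)) /=; apply: (hM q).
have E0 : bv 1%g *m subst_Xop z (\prod_(0 <= i < j.+1) epk (p i) i.+1) =
    bv 1%g *m subst_Xop z (\prod_(0 <= i < j) epk (p i) i.+1) *m subst_Xop z (epk (p j) k).
  by rewrite (big_nat_recr _ _ _ (leq0n j)) /=; apply: (hM z); apply: z_unit.
split; last exact: (eq_ind_r (supp (fixes_from j.+2)) h2 E).
exact: (etrans E (etrans h1 (etrans (congr1 (mulmx^~ _) e1) (esym E0)))).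
Qed.

Lemma evalX1_Eprod q (p : {ffun 'I_n.-1 -> 'I_n}) : (0 < n)%N ->
  (forall i, 1 - q i \is a GRing.unit) ->
  bv 1%g *m subst_Xop q (Eprod q p) = rho (eprod R p).
Proof.
move=> n0 qu; pose p' i : nat := if insub i is Some i' then p i' else 0%N.
have jn : (n.-1 < n)%N by rewrite prednK.
have [e _] := @Eprod_classical q p' n.-1 qu jn.
have h (F : nat -> nat -> {mpoly R[n]}) :
    \prod_(0 <= i < n.-1) F (p' i) i.+1 = \prod_(i < n.-1) F (p i) i.+1.
  by rewrite big_mkord; apply: eq_bigr => i _; rewrite /p' valK.
exact: etrans (congr1 _ (congr1 _ (esym (h _)))) (etrans e (congr1 _ (congr1 _ (h _)))).
Qed.

End QuantumToClassical.

(** * The elementary basis and the Grothendieck basis *)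

Section ElementaryBasis.
Variables (R : comUnitRingType) (n : nat).
Hypothesis n0 : (0 < n)%N.
Implicit Types (f g : {mpoly R[n]}) (w : 'S_n).
Local Notation bv := (@bv R n).

Lemma rho_groth w : rho (grothR R w) = bv w.
Proof. exact: subst0X_groth. Qed.

Lemma rho_sum (J : finType) (P : pred J) (c : J -> R) (F : J -> {mpoly R[n]}) :
  rho (\sum_(j | P j) c j *: F j) = \sum_(j | P j) c j *: rho (F j).
Proof.
rewrite /rho subst_sum mulmx_sumr; apply: eq_bigr => j _.
exact: rhoZ.
Qed.

(** The preimage of w is an e-combination with the same value as the Grothendieck polynomial, which
    is not yet known to lie in L_n. *)
Lemma rho_inj f : f \in tensL -> rho f = 0 -> f = 0.
Proof.
apply: tensL_inj => [|c g|w]; [exact: rhoD|exact: rhoZ|].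
have [c e] := ecombination_all n0 (grothR R w).
exists (\sum_(p in eindex n) c p *: eprod R p).
  by apply: tensL_sum => p _; apply: eprod_tensL.
by rewrite rho_sum -e rho_groth.
Qed.

Lemma rho_eq f g : f \in tensL -> g \in tensL -> rho f = rho g -> f = g.
Proof.
move=> hf hg e; apply/eqP; rewrite -subr_eq0; apply/eqP/rho_inj; first exact: tensLB.
by rewrite -scaleN1r rhoD rhoZ e scaleN1r subrr.
Qed.

Lemma tensL_eprod f : f \in tensL -> exists c, f = \sum_(p in eindex n) c p *: eprod R p.
Proof.
move=> hf; have [c e] := ecombination_all n0 f; exists c.
apply: rho_eq => //; first by apply: tensL_sum => p _; apply: eprod_tensL.
by rewrite rho_sum.
Qed.

End ElementaryBasis.

(** * Grothendieck polynomials lie in L_n *)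

Section IsobaricElementary.
Variable n : nat.
Implicit Types (f g : {mpoly int[n]}) (i j : 'I_n) (p k : nat).
Local Notation epk := (@epk int n).
Local Notation tensL := (tensL : {pred {mpoly int[n]}}).

Lemma msym_epk i p k : (i.+1 < n)%N -> k != i.+1 -> msym (simple_refl i) (epk p k) = epk p k.
Proof.
move=> i1 ki; set s := simple_refl i.
have sK : involutive s by move=> j; rewrite /s /simple_refl tpermK.
have slt j : (s j < k)%N = (j < k)%N.
  have := ordSE i1; rewrite /s /simple_refl.
  by case: tpermP => [->|->|//] e; rewrite e; lia.
rewrite /Defs.epk linear_sum /= (reindex_inj (imset_inj (@perm_inj _ s))) /=.
apply: eq_big => [I|I _].
  rewrite card_imset; last exact: perm_inj.
  congr (_ && _); apply/forall_inP/forall_inP => h j.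
    by move=> jI; rewrite -slt h // imset_f.
  by case/imsetP => l lI ->; rewrite slt h.
rewrite rmorph_prod /= big_imset /=; last by move=> ? ? _ _; apply: perm_inj.
by apply: eq_bigr => j _; rewrite msym_var sK.
Qed.

Lemma divdiff_X i : (i.+1 < n)%N -> divdiff i 'X_i = 1.
Proof.
by move=> i1; apply: (divdiff_unique i1); rewrite mulr1 msym_var /simple_refl tpermL.
Qed.

Lemma divdiff_epk i p : (i.+1 < n)%N ->
  divdiff i (epk p i.+1) = if p is p'.+1 then epk p' i else 0.
Proof.
move=> i1; case: p => [|p]; first by rewrite epk0 divdiff_sym // rmorph1.
have ii : (i : nat) != i.+1 by rewrite neq_ltn ltnSn.
rewrite epkS (divdiffD i1) (divdiffM i1) divdiff_X // mul1r msym_epk //.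
by rewrite !(divdiff_sym i1) ?msym_epk // mulr0 add0r addr0.
Qed.

(** Only the factor e_p^{i+1} fails to be symmetric under s_i. Its divided difference e_{p-1}^i
    times 1 - x_i has the same multidegree bound as e_p^{i+1} itself. *)
Lemma isobaric_eprod i (p : {ffun 'I_n.-1 -> 'I_n}) : (i.+1 < n)%N ->
  isobaric i (eprod int p) \in tensL.
Proof.
move=> i1; have i0 : (i < n.-1)%N by lia.
pose k0 := Ordinal i0; pose G := \prod_(k < n.-1 | k != k0) epk (p k) k.+1.
have GE : eprod int p = epk (p k0) i.+1 * G by rewrite /eprod (bigD1 k0).
have sG : msym (simple_refl i) G = G.
  rewrite rmorph_prod; apply: eq_bigr => k kk; apply: msym_epk => //.
have dE : divdiff i (eprod int p) = divdiff i (epk (p k0) i.+1) * G.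
  by rewrite GE (divdiffM i1) sG (divdiff_sym i1 sG) mulr0 addr0.
pose F (k : 'I_n.-1) := if k == k0 then (1 - 'X_i) * divdiff i (epk (p k0) i.+1)
  else epk (p k) k.+1.
have FE : (1 - 'X_i) * divdiff i (eprod int p) = \prod_(k < n.-1) F k.
  rewrite dE mulrA (bigD1 k0) //= {1}/F eqxx; congr (_ * _).
  by apply: eq_bigr => k /negPf kk; rewrite /F kk.
have hF : \prod_(k < n.-1) F k \in tensL.
  apply: prod_tensL => k; rewrite /F; case: eqP => [->|_]; last exact: bounded_epk.
  have b1 : bounded (fun j => (j == i : nat)) (1 - 'X_i : {mpoly int[n]}).
    apply: boundedD; first by apply: bounded_le (@bounded1 int n).
    by rewrite -scaleN1r; apply/boundedZ/boundedX.
  have b2 : bounded (fun j => (j < i)%N : nat) (divdiff i (epk (p k0) i.+1)).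
    by rewrite divdiff_epk //; case: (p k0 : nat) => [|p']; [apply: bounded0|apply: bounded_epk].
  apply: bounded_le (boundedM b1 b2) => j.
  by rewrite -val_eqE /=; case: ltngtP; rewrite ltnS; lia.
rewrite /isobaric FE; apply/tensLP/boundedD; apply/tensLP => //.
exact: eprod_tensL.
Qed.

Lemma isobaric_tensL i f : (i.+1 < n)%N -> f \in tensL -> isobaric i f \in tensL.
Proof.
move=> i1 hf; have n0 : (0 < n)%N by apply: leq_ltn_trans i1.
have [c ->] := tensL_eprod n0 hf.
have isoD : {morph isobaric i : g h / g + h}.
  by move=> g h; rewrite /isobaric (divdiffD i1) mulrDr addrACA.
have iso0 : isobaric i 0 = 0 by rewrite (isobaric_sym i1) ?rmorph0.
rewrite (big_morph _ isoD iso0).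
rewrite (eq_bigr (fun p : {ffun 'I_n.-1 -> 'I_n} => c p *: isobaric i (eprod int p))).
  by apply: tensL_sum => p _; apply: isobaric_eprod.
by move=> p _; rewrite /isobaric (divdiffZ i1) scalerDr scalerAr.
Qed.

Lemma groth_tensL (w : 'S_n) : groth w \in tensL.
Proof.
have /and3P[va _ _] := reduced_wordP (pcomp w^-1 (longest n)).
rewrite /groth /isobaric_perm; elim: (reduced_word _) va => /= [_|i a IH /andP[i1 va]].
  have hX (k : 'I_n) : true ->
      bounded (fun j => (j == k) * (n - k.+1))%N ('X_k ^+ (n - k.+1) : {mpoly int[n]}).
    move=> _ a; rewrite mpolyXn msuppX inE => /eqP -> j.
    by rewrite mulmnE mnm1E eq_sym.
  apply/tensLP; apply: bounded_le (bounded_prod (r := index_enum 'I_n) hX) => j.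
  by rewrite (bigD1 j) //= eqxx mul1n big1 ?addn0 // => k; rewrite eq_sym => /negPf ->.
exact: isobaric_tensL (IH va).
Qed.

End IsobaricElementary.

Lemma grothR_tensL (R : comUnitRingType) n (w : 'S_n) :
  grothR R w \in (tensL : {pred {mpoly R[n]}}).
Proof.
apply/tensLP => a; rewrite mcoeff_msupp mcoeff_map_mpoly => ha.
move/tensLP: (groth_tensL w); apply; rewrite mcoeff_msupp.
by apply: contraNneq ha => ->.
Qed.

(** * The quantization map inverts evaluation at the operators *)

Section Inversion.
Variables (R : comUnitRingType) (n : nat) (q : nat -> R).
Hypothesis n0 : (0 < n)%N.
Hypothesis q_unit : forall i, 1 - q i \is a GRing.unit.
Implicit Types (f g F : {mpoly R[n]}) (w : 'S_n) (u : 'rV[R]_#|{: 'S_n}|).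
Local Notation bv := (@bv R n).
Local Notation tensL := (tensL : {pred {mpoly R[n]}}).

Lemma of_groth_coord_tensL u : of_groth_coord u \in tensL.
Proof. by apply: tensL_sum => w _; apply: grothR_tensL. Qed.

Lemma rho_of_groth_coord u : rho (of_groth_coord u) = u.
Proof.
rewrite rho_sum [RHS]rv_bvE; apply: eq_bigr => w _.
by congr (_ *: _); apply: rho_groth.
Qed.

Lemma of_groth_coord_rho f : f \in tensL -> of_groth_coord (rho f) = f.
Proof.
move=> hf; apply: (rho_eq n0) => //; first exact: of_groth_coord_tensL.
exact: rho_of_groth_coord.
Qed.

Lemma ecoordE f : f \in tensL -> f = \sum_(p in eindex n) ecoord f p *: eprod R p.
Proof.
by move=> hf; apply: (epsilon_spec (inhabits (fun=> 0))
  (fun c => f = \sum_(p in eindex n) c p *: eprod R p)); apply: tensL_eprod.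
Qed.

Lemma Qhat_tensL f : Qhat q f \in tensL.
Proof. by apply: tensL_sum => p _; apply: Eprod_tensL. Qed.

Lemma subst_Qhat f : f \in tensL -> bv 1%g *m subst_Xop q (Qhat q f) = rho f.
Proof.
move=> hf; rewrite {2}(ecoordE hf) rho_sum /Qhat subst_sum mulmx_sumr.
apply: eq_bigr => p _; rewrite substZ -scalemxAr.
apply: (congr1 ( *:%R _)); exact: evalX1_Eprod.
Qed.

Lemma evalX1_Qhat f : f \in tensL -> evalX1 q (Qhat q f) = f.
Proof.
move=> hf; apply: etrans (of_groth_coord_rho hf).
exact: congr1 (subst_Qhat hf).
Qed.

Lemma evalX1_inj F1 F2 : F1 \in tensL -> F2 \in tensL ->
  evalX1 q F1 = evalX1 q F2 -> F1 = F2.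
Proof.
move=> h1 h2 /(congr1 (@rho R n)); rewrite !rho_of_groth_coord => e.
apply/eqP; rewrite -subr_eq0; apply/eqP.
pose r F := bv 1%g *m subst_Xop q F.
apply: (@tensL_inj _ _ r); last 2 first.
- exact: tensLB.
- by rewrite /r substB mulmxBr e subrr.
- by move=> f g; rewrite /r substD mulmxDr.
- by move=> c f; rewrite /r substZ -scalemxAr.
(* Surjectivity at the quantum level comes from the quantization map itself, so the rank argument
   applies again. *)
move=> w; exists (Qhat q (grothR R w)); first exact: Qhat_tensL.
by rewrite /r subst_Qhat; [apply: rho_groth|apply: grothR_tensL].
Qed.

Lemma psi_Qhat f : f \in tensL -> psi q f = Qhat q f.
Proof.
move=> hf; have := epsilon_spec (inhabits 0) (fun F => F \in tensL /\ evalX1 q F = f).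
case=> [|h1 h2]; first by exists (Qhat q f); split; [apply: Qhat_tensL|apply: evalX1_Qhat].
by apply: evalX1_inj => //; [apply: Qhat_tensL|rewrite evalX1_Qhat].
Qed.

End Inversion.

Lemma qlaurent_unit m i : 1 - qlaurent m i \is a GRing.unit.
Proof.
(* Out of range [qlaurent] is 0. In range, 1 - q_j is nonzero, having constant coefficient 1, and
   its inverse is one of the generators. *)
rewrite /qlaurent; case: insubP => [j _ _|_]; last by rewrite subr0 unitr1.
set u : laurent m := 1 - _.
have uE : val u = FracField.tofrac (1 - 'X_j : {mpoly int[m]}).
  by rewrite rmorphB rmorph1 rmorphB rmorph1.
have u0 : val u != 0.
  rewrite uE tofrac_eq0; apply/eqP => /(congr1 (mcoeff 0%MM)).
  rewrite mcoeffB mcoeff1 eqxx mcoeffX mcoeff0.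
  have /negPf -> // : (U_(j) != 0 :> 'X_{1..m})%MM by rewrite mnm1_eq0.
apply/andP; split; first exact: u0.
by rewrite uE; apply/laurent_predP/in_laurent_inv.
Qed.

Theorem corollary5p7 (n : nat) (hn : (2 <= n)%N) :
  (forall f : {mpoly (laurent n.-1)[n]}, f \in tensL ->
     psi (qlaurent n.-1) f = Qhat (qlaurent n.-1) f) /\
  (forall w : 'S_n,
     evalX1 (qlaurent n.-1) (qgroth (qlaurent n.-1) w) =
     grothR (laurent n.-1) w).
Proof.
have n0 := ltnW hn; have qu := @qlaurent_unit n.-1.
split=> [f hf|w]; first exact: psi_Qhat.
by apply: evalX1_Qhat => //; apply: grothR_tensL.
Qed.
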